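(* Let $X$ be a Polish space with Borel probability measure $\mu$. Let $\Gamma$ be a finitely generated one-ended amenable group with finite generating set $S$, and let $G=G(S,a)$ be the Schreier graph of a free null-preserving Borel action $a$ of $\Gamma$ on $(X,\mu)$. Then $G$ admits a layered connected toast a.e., i.e. there is a $G$-invariant $\mu$-conull Borel set $X'\subseteq X$ such that there exists a toast for $G|_{X'}$ that is both layered and connected.
   Context: The Schreier graph $G(S,a)$ has vertex set $X$, with $x\ne y$ adjacent iff $y=s\cdot x$ or $x=s\cdot y$ for some $s\in S$. A connected graph is one-ended if for every finite set $F$ of vertices the induced subgraph on the complement of $F$ has exactly one infinite connected component; a finitely generated group is one-ended if its Cayley graph is. The action is null-preserving if its orbit equivalence relation $E$ is: for any partial Borel injection $\gamma:X\rightharpoonup X$ with graph contained in $E$, $\mathrm{dom}(\gamma)$ is $\mu$-null iff $\mathrm{im}(\gamma)$ is $\mu$-null. A set is $G$-invariant if it is a union of connected components of $G$; $G|_{X'}$ is the induced subgraph. Toasts (for a Borel graph $G$ on $X$). $X^{<\omega}$ is the (standard Borel) space of finite subsets of $X$. For $K\subseteq X$, $E(K)$ is the set of edges of the subgraph induced on $K$, and $B_1(K)$ is the set of vertices at graph distance at most $1$ from $K$. A Borel collection $\mathcal{T}\subset X^{<\omega}$ is a toast for $G$ if (T1) $\bigcup_{K\in\mathcal{T}}E(K)=E(G)$, and (T2) for every pair of distinct $K,L\in\mathcal{T}$, either $B_1(K)\cap L=\emptyset$, or $B_1(K)\subseteq L$, or $B_1(L)\subseteq K$. It is connected if (T3)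 for every $K\in\mathcal{T}$ the induced subgraph on $K\setminus\bigcup_{K\supsetneq L\in\mathcal{T}}L$ is connected. It is layered if (T4) for each $i\ge 1$, $\bigcup\mathcal{T}_i\subseteq\bigcup\mathcal{T}_{i+1}$, where $\mathcal{T}_1$ is the family of minimal elements of $\mathcal{T}$ with respect to containment, and inductively $\mathcal{T}_{i+1}$ is the family of minimal elements of $\mathcal{T}\setminus(\mathcal{T}_1\cup\dots\cup\mathcal{T}_i)$. *)

(* Defs.v *)
From HB Require Import structures.
From mathcomp Require Import all_boot all_order all_algebra finmap.
From mathcomp Require Import all_classical all_reals all_analysis.
From Stdlib Require Import Relation_Operators.

Set Implicit Arguments.
Unset Strict Implicit.
Unset Printing Implicit Defensive.

Import Order.TTheory GRing.Theory Num.Theory.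
Local Open Scope classical_set_scope.
Local Open Scope ring_scope.

Definition completely_metrizable (R : realType) (X : topologicalType) : Prop :=
  exists d : X -> X -> R,
    [/\ (forall x y, d x y = 0 <-> x = y),
        (forall x y, d x y = d y x),
        (forall x y z, d x z <= d x y + d y z),
        (forall x (A : set X),
           nbhs x A <-> exists2 e : R, 0 < e & [set y | d x y < e] `<=` A) &
        (forall u : nat -> X,
           (forall e : R, 0 < e -> exists N : nat, forall m n : nat,
              (N <= m)%N -> (N <= n)%N -> d (u m) (u n) < e) ->
           exists l : X, u @ \oo --> l)].

Definition separable_space (X : topologicalType) : Prop :=
  exists2 D : set X, countable D & dense D.

Definition polish (R : realType) (X : topologicalType) : Prop :=
  separable_space X /\ completely_metrizable R X.

Notation Borel X := (g_sigma_algebraType (@open X)).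

(* Simple graphs on a subset of [V]; an edge is represented by its two
   orientations. *)
Record graph (V : Type) := Graph {
  vertices : set V ;
  adj : V -> V -> Prop ;
  adj_sym : forall x y, adj x y -> adj y x ;
  adj_irrefl : forall x, ~ adj x x ;
  adj_vertices : forall x y, adj x y -> vertices x }.

Section graphs.
Context {V : Type}.
Implicit Types (G : graph V) (A C : set V).

Definition edges G : set (V * V) := [set p | adj G p.1 p.2].

Lemma induced_sym G A x y :
  [/\ adj G x y, A x & A y] -> [/\ adj G y x, A y & A x].
Proof. by case=> xy Ax Ay; split=> //; exact: adj_sym. Qed.

Lemma induced_irrefl G A x : ~ [/\ adj G x x, A x & A x].
Proof. by case=> xx _ _; exact: adj_irrefl xx. Qed.

Lemma induced_vertices G A x y :
  [/\ adj G x y, A x & A y] -> (vertices G `&` A) x.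
Proof. by case=> xy Ax _; split=> //; exact: adj_vertices xy. Qed.

Definition induced_subgraph G A : graph V :=
  Graph (@induced_sym G A) (@induced_irrefl G A) (@induced_vertices G A).

Definition component G (x : V) : set V :=
  [set y | clos_refl_trans V (adj G) x y].

Definition components G : set (set V) := component G @` vertices G.

Definition connected_graph G : Prop :=
  forall x y, vertices G x -> vertices G y -> component G x y.

Definition one_ended G : Prop :=
  connected_graph G /\
  forall F : set V, F `<=` vertices G -> finite_set F ->
    exists! C : set V,
      components (induced_subgraph G (~` F)) C /\ infinite_set C.

Definition graph_invariant G A : Prop :=
  exists2 P : set (set V), P `<=` components G & A = \bigcup_(C in P) C.

(* The vertices at graph distance 0 or 1 from [A], for [A] a set of vertices. *)
Definition ball1 G A : set V := A `|` [set y | exists2 x, A x & adj G x y].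

End graphs.

Section schreier.
Context {H : groupType} {X : Type}.
Variables (S : {fset H}) (act : H -> X -> X).

Definition schreier_adj (x y : X) : Prop :=
  x <> y /\ exists2 s : H, s \in S & y = act s x \/ x = act s y.

Lemma schreier_adj_sym x y : schreier_adj x y -> schreier_adj y x.
Proof. by case=> /nesym xy [s sS] [] e; split=> //; exists s; auto. Qed.

Lemma schreier_adj_irrefl x : ~ schreier_adj x x.
Proof. by case. Qed.

Lemma schreier_adj_vertices x y : schreier_adj x y -> [set: X] x.
Proof. by []. Qed.

Definition schreier : graph X :=
  Graph schreier_adj_sym schreier_adj_irrefl schreier_adj_vertices.

End schreier.

Section groups.
Variable H : groupType.

Definition generates (S : {fset H}) : Prop :=
  forall K : {pred H}, group_closed K -> {subset S <= K} ->
    forall g : H, g \in K.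

(* The left-multiplication convention is the one of Schreier graphs; inversion
   is an isomorphism onto the Cayley graph for right multiplication. *)
Definition cayley (S : {fset H}) : graph H :=
  schreier S (fun s h : H => (s * h)%g).

Definition one_ended_group : Prop :=
  exists2 S : {fset H}, generates S & one_ended (cayley S).

Definition amenable (R : realType) : Prop :=
  exists m : set H -> R,
    [/\ (forall A, 0 <= m A),
        m [set: H] = 1,
        (forall A B, A `&` B = set0 -> m (A `|` B) = m A + m B) &
        (forall (g : H) A, m [set (g * h)%g | h in A] = m A)].

Definition is_group_action (X : Type) (act : H -> X -> X) : Prop :=
  (forall x, act 1%g x = x) /\
  (forall g h x, act (g * h)%g x = act g (act h x)).

Definition is_free (X : Type) (act : H -> X -> X) : Prop :=
  forall g x, act g x = x -> g = 1%g.

Definition orbit_rel (X : Type) (act : H -> X -> X) : set (X * X) :=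
  [set p | exists g, p.2 = act g p.1].

Definition is_borel_action d (X : measurableType d) (act : H -> X -> X)
    : Prop :=
  forall g, measurable_fun [set: X] (act g).

End groups.

(* [negligible] rather than [mu _ = 0]: [mu] is unconstrained on
   non-measurable sets, and [f @` D] is not known a priori to be measurable. *)
Definition null_preserving (R : realType) d (X : measurableType d)
    (mu : probability X R) (E : set (X * X)) : Prop :=
  forall (D : set X) (f : X -> X),
    measurable D -> measurable_fun D f -> {in D &, injective f} ->
    (forall x, D x -> E (x, f x)) ->
    (mu.-negligible D <-> mu.-negligible (f @` D)).

Section toasts.
Context {d} {X : measurableType d}.
Implicit Types (G : graph X) (T : set {fset X}) (K L : {fset X}).

(* The Borel structure on finite sets is the quotient one, along the maps
   (x_1, ..., x_n) |-> {x_1, ..., x_n} for all n. *)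
Definition borel_fsets T : Prop :=
  forall n : nat, measurable [set t : n.-tuple X | T [fset x in tval t]%fset].

Record toast G T : Prop := Toast {
  toast_vertices : forall K, T K -> [set` K] `<=` vertices G ;
  toast_borel : borel_fsets T ;
  toast_cover : \bigcup_(K in T) edges (induced_subgraph G [set` K]) = edges G ;
  toast_nested : forall K L, T K -> T L -> K <> L ->
    [\/ ball1 G [set` K] `&` [set` L] = set0,
        ball1 G [set` K] `<=` [set` L] |
        ball1 G [set` L] `<=` [set` K] ] }.

Definition connected_toast G T : Prop :=
  forall K, T K ->
    connected_graph (induced_subgraph G
      ([set` K] `\` \bigcup_(L in [set L | T L /\ (L `<` K)%fset]) [set` L])).

Definition minimal_elements T : set {fset X} :=
  [set K | T K /\ forall L, T L -> (L `<=` K)%fset -> L = K].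

Fixpoint remainder T (i : nat) : set {fset X} :=
  if i is j.+1 then remainder T j `\` minimal_elements (remainder T j) else T.

(* Layers are numbered from 0: [layer T i] is the family T_(i+1) obtained after
   i removals of minimal elements. *)
Definition layer T (i : nat) : set {fset X} := minimal_elements (remainder T i).

Lemma layerE T i :
  layer T i =
  minimal_elements (T `\` \bigcup_(j in [set j | (j < i)%N]) layer T j).
Proof.
congr minimal_elements; elim: i => [|i IH] /=.
  by apply/seteqP; split=> [K TK|K []//]; split=> // -[].
rewrite {1}IH setDDl; congr (_ `\` _); apply/seteqP; split=> K.
  case=> [[j /= ji Kj]|Ki]; last by exists i => /=.
  by exists j => //=; exact: leq_trans ji _.
case=> j /=; rewrite ltnS leq_eqVlt => /orP[/eqP ->|ji Kj]; first by right.
by left; exists j.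
Qed.

Definition layered_toast T : Prop :=
  forall i : nat, \bigcup_(K in layer T i) [set` K]
    `<=` \bigcup_(K in layer T i.+1) [set` K].

End toasts.

(* Main.v *)
Require Import Defs.
From HB Require Import structures.
From mathcomp Require Import all_boot all_order all_algebra finmap.
From mathcomp Require Import all_classical all_reals all_analysis.
From mathcomp Require Import ring lra zify.

Set Implicit Arguments.
Unset Strict Implicit.
Unset Printing Implicit Defensive.

Import Order.TTheory GRing.Theory Num.Theory.
Local Open Scope classical_set_scope.
Local Open Scope ring_scope.

(** A Borel set [P] and an equivalence relation on the orbits make up a
    "tiling" when the classes have bounded diameter, [P] is connected inside
    each class and contains the inner boundary of each class, so that removing
    [P] leaves bounded components.

    In the group, one-endedness gives superlinear growth, hence maximal
    [n]-separated sets whose mean is small compared with [1 / n]. Cut the group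
    into pieces of translates of a Foelner set, and in each piece join such a
    net and the boundary of the piece into a connected set by paths of length
    [O(n)]: this is a tiling whose [P] has arbitrarily small mean. Next, cover
    [X] greedily by translates of a Foelner set, keeping at each stage, by a
    Hahn decomposition, the centres for which the boundary of the tile is small
    compared with the part of the tile not covered before; then copy in each
    tile a translate of the tiling of the group, chosen by averaging. The
    resulting Borel cut of [X] has arbitrarily small measure; no invariance of
    the measure is involved, since a Hahn decomposition compares the measures
    of the translates of a set directly.

    Finally take such cuts [P_i], with the measure of a large neighbourhood of
    [P_i] summable, and let [C_i] be the union of [P_i] and of the
    [r_i]-neighbourhood of [C_(i+1)], where [r_i] bounds the diameter of the
    classes of the [i]-th tiling. The toast consists of the components of the
    complements of the [C_i]. What remains of such a component once the smaller
    ones are removed is connected, because adding to [P_i] the points that are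
    [r_i]-close to the complement of a connected set [L] makes its trace on [L]
    connected. *)

(** * Connectivity along a finitely generated group action *)

(** Bounded tiles are cheap; connectedness of the cut is what costs. Joining the points of a
    [2n]-dense net inside a tile takes at most [4n + 2] points for each point of the net, while the
    mean of the net is at most one over the size of the ball of radius [n]. The product is small
    exactly when balls outgrow every multiple of [n], which is where one-endedness enters. The
    connected pattern is built once, in the group, and only copied to [X]: a class that a tile
    truncates goes entirely into the cut, so no connection has to be repaired there.

    The order of the choices matters. The diameters of the first tilings must be known before the
    next cut is taken, because it is the neighbourhood of that cut, with the previous diameters
    added up as radius, that has to be small. These neighbourhoods act as buffers: a component of
    one level lies with all its neighbours in a single component of the next level.

    Foelner sets are extracted from the invariant mean: a group without them would double itself, by
    Hall's theorem. *)

Section WordBalls.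
Variables (H : groupType) (S : {fset H}).

Definition symgen : {fset H} :=
  (1%g |` (S `|` [fset s^-1%g | s in S]))%fset.

Fixpoint wball n : {fset H} :=
  if n is k.+1 then [fset (s * g)%g | s in symgen, g in wball k]%fset
  else [fset 1%g]%fset.

Lemma symgen1 : 1%g \in symgen.
Proof. by rewrite !inE eqxx. Qed.

Lemma symgenS s : s \in S -> s \in symgen.
Proof. by move=> sS; rewrite !inE sS orbT. Qed.

Lemma symgenE s :
  s \in symgen -> [\/ s = 1%g, s \in S | exists2 t, t \in S & s = t^-1%g].
Proof.
rewrite !inE => /or3P[/eqP ->|sS|]; first exact: Or31.
  exact: Or32.
by move=> /imfsetP[/= t tS ->]; apply: Or33; exists t.
Qed.

Lemma symgenV s : s \in symgen -> s^-1%g \in symgen.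
Proof.
case/symgenE => [->|sS|[t tS ->]]; first by rewrite invg1 symgen1.
  by rewrite !inE (in_imfset _ (fun s => s^-1%g) sS) !orbT.
by rewrite invgK symgenS.
Qed.

Lemma wballSP n g :
  reflect (exists s h, [/\ s \in symgen, h \in wball n & g = (s * h)%g])
          (g \in wball n.+1).
Proof.
apply: (iffP idP) => [/imfset2P[/= s sS [h hn ->]]|[s [h [sS hn ->]]]].
  by exists s, h.
by apply/imfset2P; exists s => //; exists h.
Qed.

Lemma wball1 n : 1%g \in wball n.
Proof.
elim: n => [|n IH]; first by rewrite inE.
by apply/wballSP; exists 1%g, 1%g; rewrite symgen1 mulg1.
Qed.

Lemma wballM m n g h :
  g \in wball m -> h \in wball n -> (g * h)%g \in wball (m + n).
Proof.
elim: m g => [|m IH] g; first by rewrite inE => /eqP ->; rewrite mul1g.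
case/wballSP => s [k [sS km ->]] hn; rewrite addSn; apply/wballSP.
by exists s, (k * h)%g; split=> //; [exact: IH|rewrite mulgA].
Qed.

Lemma wball_split m n g : g \in wball (m + n) ->
  exists h k, [/\ h \in wball m, k \in wball n & g = (h * k)%g].
Proof.
elim: m g => [|m IH] g; first by exists 1%g, g; rewrite wball1 mul1g.
rewrite addSn => /wballSP[s [k [sS /IH[h [l [hm ln ->]]] ->]]].
exists (s * h)%g, l; split=> //; last by rewrite mulgA.
by apply/wballSP; exists s, h.
Qed.

Lemma wball_symgen s : s \in symgen -> s \in wball 1.
Proof.
by move=> sS; apply/wballSP; exists s, 1%g; rewrite wball1 mulg1.
Qed.

Lemma wballV n g : g \in wball n -> g^-1%g \in wball n.
Proof.
elim: n g => [|n IH] g; first by rewrite !inE => /eqP ->; rewrite invg1.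
case/wballSP => s [h [sS hn ->]]; rewrite invgM -addn1.
by apply: wballM; [exact: IH|exact/wball_symgen/symgenV].
Qed.

Lemma wball_le m n g : (m <= n)%N -> g \in wball m -> g \in wball n.
Proof.
by move=> /subnKC <- gm; rewrite -(mulg1 g) wballM // wball1.
Qed.

Lemma wball_gen : generates S -> forall g, exists n, g \in wball n.
Proof.
move=> gS; pose K : {pred H} := fun g => `[< exists n, g \in wball n >].
have KP g : g \in K <-> exists n, g \in wball n by split=> /asboolP.
move=> g; apply/KP; apply: gS => [|s sS]; last first.
  by apply/KP; exists 1%N; exact/wball_symgen/symgenS.
split; first by apply/KP; exists 0%N; exact: wball1.
move=> x y /KP[m xm] /KP[n yn]; apply/KP.
by exists (m + n)%N; apply: wballM => //; exact: wballV.
Qed.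

Lemma wball_gen_fset (F : {fset H}) : generates S ->
  exists n, (F `<=` wball n)%fset.
Proof.
move=> gS; elim/finSet_rect: F => F IH.
have [->|[x xF]] := fset_0Vmem F; first by exists 0%N; exact: fsub0set.
have [|n Fn] := IH (F `\ x)%fset; first exact: fproperD1.
have [k xk] := wball_gen gS x; exists (n + k)%N; apply/fsubsetP => y yF.
have [->|yx] := eqVneq y x; first exact: wball_le (leq_addl _ _) xk.
by apply: (wball_le (leq_addr _ _)); apply: (fsubsetP Fn); rewrite !inE yx.
Qed.

(** An index codes a radius and a position in that ball, the identity filling the gaps. This turns
    quantifiers over the group into countable ones. *)
Definition group_enum (n : nat) : H :=
  let: (i, k) := odflt (0, 0)%N (@choice.unpickle (nat * nat)%type n) in
  nth 1%g (wball i) k.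

Lemma group_enumP : generates S -> forall g, exists n, group_enum n = g.
Proof.
move=> gS g; have [i gi] := wball_gen gS g.
exists (choice.pickle (i, index g (wball i))); rewrite /group_enum choice.pickleK /=.
exact: nth_index.
Qed.

End WordBalls.

Section ActionGraphs.
Variables (H : groupType) (S : {fset H}) (X : Type) (act : H -> X -> X).
Hypothesis hact : is_group_action act.
Implicit Types (A B : set X) (x y z w : X).

Lemma act1 x : act 1%g x = x. Proof. by case: hact. Qed.

Lemma actM g h x : act (g * h)%g x = act g (act h x).
Proof. by case: hact. Qed.

Lemma actK g : cancel (act g) (act g^-1%g).
Proof. by move=> x; rewrite -actM mulVg act1. Qed.

Lemma actVK g : cancel (act g^-1%g) (act g).
Proof. by move=> x; rewrite -actM mulgV act1. Qed.

Definition nb x y := exists2 s, s \in symgen S & y = act s x.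

Definition within n x y := exists2 b, b \in wball S n & y = act b x.

Lemma nb_refl x : nb x x.
Proof. by exists 1%g; rewrite ?symgen1 ?act1. Qed.

Lemma nb_sym x y : nb x y -> nb y x.
Proof. by case=> s sS ->; exists s^-1%g; rewrite ?symgenV ?actK. Qed.

Lemma nb_within x y : nb x y <-> within 1 x y.
Proof.
split=> [[s sS ->]|[b /wballSP[s [h [sS]]]]].
  by exists s => //; exact: wball_symgen.
by rewrite inE => /eqP -> -> ->; exists s; rewrite ?mulg1.
Qed.

Lemma within_refl n x : within n x x.
Proof. by exists 1%g; rewrite ?wball1 ?act1. Qed.

Lemma within_sym n x y : within n x y -> within n y x.
Proof. by case=> b bn ->; exists b^-1%g; rewrite ?wballV ?actK. Qed.

Lemma within_trans m n x y z :
  within m x y -> within n y z -> within (m + n) x z.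
Proof.
case=> b bm -> [c cn ->]; exists (c * b)%g; last by rewrite actM.
by rewrite addnC wballM.
Qed.

Lemma within_le m n x y : (m <= n)%N -> within m x y -> within n x y.
Proof. by move=> mn [b bm ->]; exists b => //; exact: wball_le bm. Qed.

Lemma within0 x y : within 0 x y -> y = x.
Proof. by case=> b; rewrite inE => /eqP -> ->; rewrite act1. Qed.

Lemma withinS n x y : within n.+1 x y -> exists2 z, nb x z & within n z y.
Proof.
case=> b; rewrite -addn1 => /wball_split[h [k [hn k1 ->]]] ->.
exists (act k x); last by exists h; rewrite ?actM.
by apply/nb_within; exists k.
Qed.

Fixpoint steps A n x y : Prop :=
  if n is k.+1 then A x /\ exists2 z, nb x z & steps A k z y
  else x = y /\ A y.

Definition conn A x y := exists n, steps A n x y.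

Definition connected A := forall x y, A x -> A y -> conn A x y.

Lemma steps_fst A n x y : steps A n x y -> A x.
Proof. by case: n => [[->]|n []]. Qed.

Lemma steps_lst A n x y : steps A n x y -> A y.
Proof. by elim: n x => [x []|n IH x [_ [z _ /IH]]]. Qed.

Lemma steps_sub A B n x y : A `<=` B -> steps A n x y -> steps B n x y.
Proof.
move=> AB; elim: n x => [x [-> /AB]|n IH x [/AB Bx [z xz /IH]]] //=.
by split=> //; exists z.
Qed.

Lemma steps_trans A m n x y z :
  steps A m x y -> steps A n y z -> steps A (m + n) x z.
Proof.
elim: m x => [x [-> _]|m IH x [Ax [w xw wy]] yz] //=.
by split=> //; exists w => //; exact: IH.
Qed.

Lemma steps1 A x y : A x -> A y -> nb x y -> steps A 1 x y.
Proof. by move=> Ax Ay xy; split=> //; exists y. Qed.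

Lemma steps_refl A n x : A x -> steps A n x x.
Proof.
move=> Ax; elim: n => // n IH; split=> //; exists x => //; exact: nb_refl.
Qed.

Lemma steps_sym A n x y : steps A n x y -> steps A n y x.
Proof.
elim: n x => [x [-> //]|n IH x [Ax [z xz zy]]]; rewrite -addn1.
by apply: steps_trans (IH _ zy) (steps1 (steps_fst zy) Ax (nb_sym xz)).
Qed.

Lemma steps_within A n x y : steps A n x y -> within n x y.
Proof.
elim: n x => [x [-> _]|n IH x [_ [z /nb_within xz /IH]]].
  exact: within_refl.
by rewrite -add1n; exact: within_trans.
Qed.

Lemma within_steps A n x y :
  within n x y -> (forall w, within n x w -> A w) -> steps A n x y.
Proof.
elim: n x => [x /within0 ->|n IH x /withinS[z xz zy] hA] /=.
  by move=> hA; split=> //; exact/hA/within_refl.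
split; first exact/hA/within_refl.
exists z => //; apply: IH => // w zw; apply: hA; rewrite -add1n.
by apply: within_trans zw; exact/nb_within.
Qed.

Lemma conn_refl A x : A x -> conn A x x.
Proof. by exists 0%N. Qed.

Lemma conn_sym A x y : conn A x y -> conn A y x.
Proof. by case=> n xy; exists n; exact: steps_sym. Qed.

Lemma conn_trans A x y z : conn A x y -> conn A y z -> conn A x z.
Proof. by case=> m xy [n yz]; exists (m + n)%N; exact: steps_trans yz. Qed.

Lemma conn_sub A B x y : A `<=` B -> conn A x y -> conn B x y.
Proof. by move=> AB [n xy]; exists n; exact: steps_sub xy. Qed.

Lemma conn_fst A x y : conn A x y -> A x.
Proof. by case=> n /steps_fst. Qed.

Lemma conn_lst A x y : conn A x y -> A y.
Proof. by case=> n /steps_lst. Qed.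

Lemma conn1 A x y : A x -> A y -> nb x y -> conn A x y.
Proof. by exists 1%N; exact: steps1. Qed.

Lemma conn_step A x y z : conn A x y -> nb y z -> A z -> conn A x z.
Proof.
move=> xy yz Az; apply: (conn_trans xy); apply: conn1 => //.
exact: conn_lst xy.
Qed.

Lemma conn_ind A x (P : X -> Prop) :
  (A x -> P x) ->
  (forall y z, conn A x y -> P y -> nb y z -> A z -> P z) ->
  forall y, conn A x y -> P y.
Proof.
move=> P0 PS y [n /steps_sym]; elim: n y => [y [-> Ax]|n IH y]; first exact: P0.
case=> Ay [z yz zx]; apply: (PS z) => //; last exact: nb_sym.
  by exists n; exact: steps_sym.
exact: IH.
Qed.

Lemma conn_component A x y : conn A x y -> conn [set z | conn A x z] x y.
Proof.
move=> xy; move: (xy); move: y xy; apply: conn_ind => [Ax _|y z xy IH yz Az xz].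
  exact/conn_refl/conn_refl.
exact: conn_step (IH xy) yz xz.
Qed.

Lemma conn_within A x y : conn A x y -> exists n, within n x y.
Proof. by case=> n /steps_within; exists n. Qed.

Lemma conn_exit A B x y : conn A x y -> B x ->
  conn (A `&` B) x y \/
  exists z w, [/\ conn (A `&` B) x z, nb z w, ~ B w & conn A x w].
Proof.
move=> xy Bx; move: y xy; apply: conn_ind => [Ax|y z xy [xy'|?] yz Az].
- by left; exact: conn_refl.
- have [Bz|nBz] := pselect (B z); first by left; exact: conn_step xy' yz _.
  by right; exists y, z; split=> //; exact: conn_step xy yz Az.
- by right.
Qed.

End ActionGraphs.

(** * Tilings and the connectedness of their skeletons *)

Section Tiled.
Variables (H : groupType) (S : {fset H}) (X : Type) (act : H -> X -> X).
Hypothesis hact : is_group_action act.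
Implicit Types (L P Q : set X) (x y z w : X).

Local Notation nb := (nb S act).
Local Notation within := (within S act).
Local Notation conn := (conn S act).
Local Notation connected := (connected S act).

(** Connectedness is asked of the part of [P] in each class, not of the class; by [tiled_bd], a step
    between two classes has both ends in [P]. *)
Record tiled (R : nat) P (e : X -> X -> Prop) : Prop := Tiled {
  tiled_refl : forall x, e x x ;
  tiled_sym : forall x y, e x y -> e y x ;
  tiled_trans : forall x y z, e x y -> e y z -> e x z ;
  tiled_within : forall x y, e x y -> within R x y ;
  tiled_conn : forall x y, e x y -> P x -> P y ->
    conn ([set z | e x z] `&` P) x y ;
  tiled_bd : forall x y, nb x y -> ~ e x y -> P x }.

Variables (R : nat) (P : set X) (e : X -> X -> Prop).
Hypothesis tP : tiled R P e.

Lemma tiled_le R' : (R <= R')%N -> tiled R' P e.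
Proof.
case: tP => ? ? ? eR ? ? RR'; split=> // x y /eR; exact: within_le.
Qed.

Lemma tiled_comp x y : conn (~` P) x y -> within R x y.
Proof.
move=> xy; apply: (tiled_within tP); move: y xy; apply: (conn_ind hact) => //.
  by move=> _; exact: tiled_refl tP _.
move=> y z xy exy yz _; apply: (tiled_trans tP exy); apply: contrapT => nyz.
by have := conn_lst xy; apply; exact: (tiled_bd tP yz nyz).
Qed.

(** When [L] is a component of the complement of the next cut, this is the trace on [L] of the
    current cut. *)
Definition thick L := L `&` (P `|` [set z | exists2 w, within R z w & ~ L w]).

Let in_tile L y := [set z | e y z] `<=` L.

Let thick_out L y z : L z -> ~ in_tile L y -> e y z -> thick L z.
Proof.
move=> Lz /existsNP[w /not_implyP[yw nLw]] yz; split=> //; right.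
exists w => //; apply: (tiled_within tP).
by apply: (tiled_trans tP) yw; exact: tiled_sym tP _ _ yz.
Qed.

(** Walk from [q] to a point outside [L]. The walk stays within [R] of its end, hence in [thick L]
    as long as it is in [L]; since the class of [q] lies in [L], the walk leaves the class, and it
    does so from a point of [P]. *)
Let thick_in L q : in_tile L q -> thick L q ->
  exists p, [/\ P p, e q p & conn (thick L) q p].
Proof.
move=> qL qQ; case: (qQ) => Lq [Pq|[w qw nLw]].
  by exists q; split; [|exact: tiled_refl tP _|exact: conn_refl].
have [n [nR qLw]] : exists n, (n <= R)%N /\ steps S act setT n q w.
  by exists R; split=> //; exact: within_steps.
move: qL qQ Lq {qw}; elim: n q nR qLw => [q _ [qw _] _ _|n IH q nR].
  by rewrite qw.
case=> _ [z qz zw] qL qQ Lq.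
have [eqz|neqz] := pselect (e q z); last first.
  exists q; split; [exact: tiled_bd tP _ _ qz neqz|exact: tiled_refl tP _|].
  exact: conn_refl.
have zL : in_tile L z by move=> t /= zt; apply/qL/(tiled_trans tP eqz).
have Lz : L z by exact: qL.
have zQ : thick L z.
  split=> //; right; exists w => //; apply: (@within_le _ _ _ _ n).
    exact: ltnW.
  exact: steps_within zw.
have [p [Pp zp qp]] := IH _ (ltnW nR) zw zL zQ Lz.
exists p; split=> //; first exact: tiled_trans tP _ _ _ eqz zp.
by apply: conn_trans qp; exact: conn1.
Qed.

Let tile_conn L y p q : in_tile L y -> e y p -> e y q -> P p -> P q ->
  conn (thick L) p q.
Proof.
move=> yL yp yq Pp Pq; have py := tiled_sym tP yp.
apply: conn_sub (tiled_conn tP (tiled_trans tP py yq) Pp Pq).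
move=> t [/= pt Pt]; split; last by left.
by apply: yL; exact: tiled_trans tP _ _ _ yp pt.
Qed.

(* Follow a path of [L], keeping track of the whole of [thick L] inside the
   current tile when that tile is included in [L], and of the current vertex
   otherwise: in the latter case the tile meets the complement of [L], so that
   the vertex is in [thick L]. *)
Lemma thick_connected L : connected L -> connected (thick L).
Proof.
move=> cL x y xQ yQ; have Lx : L x by case: xQ.
have Ly : L y by case: yQ.
pose inv z := forall q, thick L q -> e z q -> q = z \/ in_tile L z ->
  conn (thick L) x q.
suff inv_y : inv y by apply: inv_y => //; [exact: tiled_refl tP _|left].
have in_tileE u v : e u v -> in_tile L u -> in_tile L v.
  by move=> uv uL t /= vt; apply/uL/(tiled_trans tP uv).
have := cL x y Lx Ly; move: (y); apply: (conn_ind hact) => [_|u v xu IH uv Lv].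
  move=> q qQ xq [->|xL]; first exact: conn_refl.
  have [p [Pp xp px]] := thick_in xL xQ.
  have [p' [Pp' xp' p'q]] := thick_in (in_tileE _ _ xq xL) qQ.
  apply: (conn_trans px); apply: conn_trans (conn_sym hact p'q).
  by apply: (tile_conn xL) => //; exact: tiled_trans tP _ _ _ xq xp'.
have Lu := conn_lst xu.
have [euv|neuv] := pselect (e u v).
  have [uL|nuL] := pselect (in_tile L u).
    move=> q qQ vq _; apply: IH => //; last by right.
    exact: tiled_trans tP _ _ _ euv vq.
  move=> q qQ vq [->|/in_tileE vL]; last first.
    by exfalso; apply/nuL/vL; exact: tiled_sym tP _ _ euv.
  have uQ : thick L u by apply: thick_out nuL _ => //; exact: tiled_refl tP _.
  apply: conn_step uv _; last exact: thick_out nuL euv.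
  by apply: IH => //; [exact: tiled_refl tP _|left].
have Pu : P u by exact: tiled_bd tP _ _ uv neuv.
have Pv : P v.
  apply: (tiled_bd tP (nb_sym hact uv)) => evu; apply: neuv.
  exact: tiled_sym tP _ _ evu.
have xv : conn (thick L) x v.
  apply: conn_step uv _; last by split=> //; left.
  by apply: IH; [split=> //; left|exact: tiled_refl tP _|left].
move=> q qQ vq [->//|vL]; apply: (conn_trans xv).
have [p [Pp qp cqp]] := thick_in (in_tileE _ _ vq vL) qQ.
apply: conn_trans (conn_sym hact cqp); apply: (tile_conn vL) => //.
  exact: tiled_refl tP _.
exact: tiled_trans tP _ _ _ vq qp.
Qed.

End Tiled.

Lemma fset_uniform (T : choiceType) (Q : nat -> T -> Prop) (F : {fset T}) :
  (forall m n t, (m <= n)%N -> Q m t -> Q n t) ->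
  (forall t, t \in F -> exists n, Q n t) ->
  exists n, forall t, t \in F -> Q n t.
Proof.
move=> Qle; elim/finSet_rect: F => F IH QF.
have [->|[x xF]] := fset_0Vmem F; first by exists 0%N.
have [||n Qn] := IH (F `\ x)%fset; first exact: fproperD1.
  by move=> t; rewrite !inE => /andP[_ /QF].
have [k Qk] := QF x xF; exists (n + k)%N => t tF.
have [->|tx] := eqVneq t x; first exact: Qle (leq_addl _ _) Qk.
by apply: (Qle _ _ _ (leq_addr _ _)); apply: Qn; rewrite !inE tx.
Qed.

(** * Hall's theorem for infinitely many finite sets *)

Section Hall.
Variables (I V : choiceType) (N : I -> {fset V}).
Implicit Types (B : set (I * V)) (A : {fset I}).

Let rest B i := [fset v in N i | `[< ~ B (i, v) >]]%fset.

Let nbr B A := (\bigcup_(i <- A) rest B i)%fset.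

Let hall B := forall A, (#|` A| <= #|` nbr B A|)%N.

Let nbrP B A v : reflect (exists2 i, i \in A & v \in rest B i) (v \in nbr B A).
Proof.
apply: (iffP (bigfcupP _ _ _ _)) => [[i /andP[iA _] vi]|[i iA vi]].
  by exists i.
by exists i => //; rewrite iA.
Qed.

Let restP B i v : reflect (v \in N i /\ ~ B (i, v)) (v \in rest B i).
Proof.
rewrite !inE /=; apply: (iffP andP) => [[-> /asboolP]//|[-> ?]].
by split=> //; exact/asboolP.
Qed.

(** Here [B] is a set of removed edges. Hall's condition at [A] involves finitely many edges, and
    those removed by the union of a chain are already removed by one member; [set0] stands in when
    there are none. *)
Let hall_bigcup (F : set (set (I * V))) :
  hall set0 -> F `<=` hall -> total_on F subset -> hall (\bigcup_(B in F) B).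
Proof.
move=> h0 Fh Ftot A.
have fin (E : {fset I * V}) : exists B, hall B /\ (B = set0 \/ F B) /\
    forall p, p \in E -> (\bigcup_(B in F) B) p -> B p.
  elim/finSet_rect: E => E IH; have [->|[p pE]] := fset_0Vmem E.
    by exists set0; split=> //; split; [left|].
  have [|B [hB [FB EB]]] := IH (E `\ p)%fset; first exact: fproperD1.
  have [[C FC Cp]|nFp] := pselect ((\bigcup_(B in F) B) p); last first.
    exists B; split=> //; split=> // q qE Fq; apply: EB => //.
    by rewrite !inE qE andbT; apply/eqP => qp; rewrite qp in Fq.
  have hE (D : set (I * V)) : B `<=` D -> D p ->
      forall q, q \in E -> (\bigcup_(B in F) B) q -> D q.
    move=> BD Dp q qE Fq; have [->//|qp] := eqVneq q p.
    by apply/BD/EB => //; rewrite !inE qp.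
  case: FB => [B0|FB].
    by exists C; split; [exact: Fh|split; [right|apply: hE; rewrite ?B0]].
  have [BC|CB] := Ftot _ _ FB FC.
    by exists C; split; [exact: Fh|split; [right|exact: hE]].
  by exists B; split=> //; split; [right|apply: hE => //; exact: CB].
have [B [hB [_ BE]]] :=
  fin [fset p | p in [seq (i, v) | i <- enum_fset A, v <- enum_fset (N i)]]%fset.
apply: leq_trans (hB A) _; apply: fsubset_leq_card; apply/fsubsetP => v.
case/nbrP => i iA /restP[vN nB]; apply/nbrP; exists i => //; apply/restP.
split=> // Fv; apply: nB; apply: BE => //.
by rewrite !inE /=; apply/allpairsPdep; exists i, v.
Qed.

(* Rado's argument: a maximal set of edges whose removal preserves Hall's
   condition leaves a single edge at each [i], by submodularity of the number
   of neighbours. *)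
Lemma Hall_matching :
  (forall A, (#|` A| <= #|` (\bigcup_(i <- A) N i)%fset|)%N) ->
  exists f : I -> V, injective f /\ forall i, f i \in N i.
Proof.
move=> hN; have h0 : hall set0.
  move=> A; apply: leq_trans (hN A) _; apply: fsubset_leq_card.
  apply/fsubsetP => v /bigfcupP[i /andP[iA _] vN].
  by apply/nbrP; exists i => //; apply/restP; split=> // -[].
have [B [hB maxB]] := Zorn_bigcup (fun F => @hall_bigcup F h0).
have ex1 i : exists v, v \in rest B i.
  have := hB [fset i]%fset; rewrite cardfs1 cardfs_gt0 => /fset0Pn[v].
  by case/nbrP => j; rewrite inE => /eqP -> ?; exists v.
have uniq1 x y1 y2 : y1 \in rest B x -> y2 \in rest B x -> y1 = y2.
  move=> y1x y2x; apply: contrapT => y12.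
  have bad y : y \in rest B x -> exists A, x \notin A /\
      (#|` nbr B A `|` (rest B x `\ y)| <= #|` A|)%fset%N.
    move=> /restP[yN nB].
    have /maxB/existsNP[A] : B `<` (B `|` [set (x, y)]).
      by split; [move=> p Bp; left|move=> /(_ (x, y)) h; apply/nB/h; right].
    move=> /negP; rewrite -ltnNge => ltA.
    have restE i : i != x -> rest (B `|` [set (x, y)]) i = rest B i.
      move=> ix; apply/fsetP => v; apply/restP/restP => -[vN h]; split=> //.
        by move=> Bv; apply: h; left.
      by case=> // -[/eqP]; rewrite (negbTE ix).
    have restx : rest (B `|` [set (x, y)]) x = (rest B x `\ y)%fset.
      apply/fsetP => v; rewrite in_fsetD1; apply/restP/andP.
        move=> [vN h]; split; first by apply/eqP => vy; apply: h; right; rewrite vy.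
        by apply/restP; split=> // Bv; apply: h; left.
      by case=> /eqP vy /restP[vN h]; split=> // -[//|[]].
    have xA : x \in A.
      apply: contraLR ltA => xA; rewrite -leqNgt.
      apply: leq_trans (hB A) _; apply: fsubset_leq_card; apply/fsubsetP => v.
      case/nbrP => i iA vi; apply/nbrP; exists i => //; rewrite restE //.
      by apply: contraNneq xA => <-.
    exists (A `\ x)%fset; rewrite !inE eqxx; split=> //.
    rewrite -ltnS; move: ltA; rewrite (cardfsD1 x A) xA add1n; apply: leq_trans.
    rewrite ltnS; apply: fsubset_leq_card; apply/fsubsetP => v /fsetUP[].
      case/nbrP => i; rewrite in_fsetD1 => /andP[ix iA] vi; apply/nbrP.
      by exists i => //; rewrite restE.
    by rewrite -restx => vx; apply/nbrP; exists x.
  have [A1 [xA1 le1]] := bad _ y1x; have [A2 [xA2 le2]] := bad _ y2x.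
  set U1 := (_ `|` _)%fset in le1; set U2 := (_ `|` _)%fset in le2.
  have leI : (#|` (A1 `&` A2)%fset| <= #|` (U1 `&` U2)%fset|)%N.
    apply: leq_trans (hB _) _; apply: fsubset_leq_card; apply/fsubsetP => v.
    case/nbrP => i; rewrite inE => /andP[i1 i2] vi.
    by apply/fsetIP; split; rewrite in_fsetU; apply/orP; left; apply/nbrP;
      exists i.
  have leU : (#|` (A1 `|` A2)%fset| < #|` (U1 `|` U2)%fset|)%N.
    have := hB (x |` (A1 `|` A2))%fset.
    rewrite cardfsU1 inE (negbTE xA1) (negbTE xA2) add1n => /leq_trans -> //.
    apply: fsubset_leq_card; apply/fsubsetP => v /nbrP[i].
    case/fset1UP => [-> vx|/fsetUP[] iA vi]; apply/fsetUP.
    - have [vy|vy] := eqVneq v y1; [right|left]; rewrite in_fsetU; apply/orP; right.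
        by rewrite in_fsetD1 vx vy andbT; exact/eqP.
      by rewrite in_fsetD1 vx vy.
    - by left; rewrite in_fsetU; apply/orP; left; apply/nbrP; exists i.
    - by right; rewrite in_fsetU; apply/orP; left; apply/nbrP; exists i.
  have := cardfsUI A1 A2; have := cardfsUI U1 U2; lia.
have [f fP] := choice ex1; exists f; split=> [i j fij|i]; last first.
  by have /restP[] := fP i.
apply/eqP; apply: contraT => ij; have := hB [fset i; j]%fset.
suff /fsubset_leq_card : (nbr B [fset i; j] `<=` [fset f i])%fset.
  by rewrite cardfs2 ij cardfs1 => h /leq_trans/(_ h).
apply/fsubsetP => v /nbrP[k] /fset2P[] -> vk; apply/fset1P.
  exact: uniq1 _ _ _ vk (fP i).
by rewrite fij; exact: uniq1 _ _ _ vk (fP j).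
Qed.

End Hall.

(** * Means, contents and growth *)

Section Contents.
Variables (R : realType) (T : Type) (M : set (set T)) (m : set T -> R).

Definition ind (A : set T) (x : T) : R := (`[< A x >])%:R.

Lemma indT (A : set T) x : A x -> ind A x = 1.
Proof. by rewrite /ind => /asboolT ->. Qed.

Lemma indF (A : set T) x : ~ A x -> ind A x = 0.
Proof. by rewrite /ind => /asboolF ->. Qed.

Lemma ind_ge0 (A : set T) x : 0 <= ind A x.
Proof. by rewrite /ind ler0n. Qed.

Lemma ind_le1 (A : set T) x : ind A x <= 1.
Proof. by rewrite /ind lern1 leq_b1. Qed.

(** Finitely additive measures on an algebra [M]: all sets for a mean, the measurable ones for a
    finite measure. *)
Record is_content : Prop := Content {
  contentT : M setT ;
  contentI : forall A B, M A -> M B -> M (A `&` B) ;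
  contentC : forall A, M A -> M (~` A) ;
  content_ge0 : forall A, M A -> 0 <= m A ;
  contentU : forall A B, M A -> M B -> A `&` B = set0 ->
    m (A `|` B) = m A + m B }.

Hypothesis mP : is_content.

Let content0 : m set0 = 0.
Proof.
have M0 : M set0 by rewrite -setCT; apply: (contentC mP); exact: contentT mP.
have := contentU mP M0 M0; rewrite setI0 setU0 => /(_ erefl) e.
by apply/eqP; rewrite -(subrr (m set0)) {2}e addrK.
Qed.

Let content_split A E : M A -> M E ->
  m E = m (A `&` E) + m (~` A `&` E).
Proof.
move=> MA ME; rewrite -(contentU mP).
- by rewrite -setIUl setUv setTI.
- exact: contentI mP _ _ MA ME.
- exact: contentI mP _ _ (contentC mP MA) ME.
by rewrite setIACA setICr set0I.
Qed.

(* The constant [k] records the sets already known to contain [E]. *)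
Let content_pos (I : Type) (r : seq I) (A : I -> set T) (c : I -> R) k E :
  (forall i, M (A i)) -> M E ->
  (forall x, E x -> 0 <= k + \sum_(i <- r) c i * ind (A i) x) ->
  0 <= k * m E + \sum_(i <- r) c i * m (A i `&` E).
Proof.
move=> MA; elim: r k E => [|i r IH] k E ME pos.
  rewrite big_nil addr0; have [[x Ex]|noE] := pselect (exists x, E x).
    rewrite mulr_ge0 ?(content_ge0 mP) //.
    by have := pos x Ex; rewrite big_nil addr0.
  rewrite (_ : E = set0) ?content0 ?mulr0 // -subset0 => x Ex.
  by apply: noE; exists x.
have MI : M (A i `&` E) by exact: contentI mP _ _ (MA i) ME.
have MC : M (~` A i `&` E) by exact: contentI mP _ _ (contentC mP (MA i)) ME.
have pos1 x : (A i `&` E) x -> 0 <= k + c i + \sum_(j <- r) c j * ind (A j) x.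
  by move=> [Ax Ex]; have := pos x Ex; rewrite big_cons indT // mulr1 addrA.
have pos2 x : (~` A i `&` E) x -> 0 <= k + \sum_(j <- r) c j * ind (A j) x.
  by move=> [nA Ex]; have := pos x Ex; rewrite big_cons indF // mulr0 add0r.
have := addr_ge0 (IH _ _ MI pos1) (IH _ _ MC pos2).
rewrite big_cons (content_split (MA i) ME).
have -> : \sum_(j <- r) c j * m (A j `&` E) =
    \sum_(j <- r) c j * m (A j `&` (A i `&` E)) +
    \sum_(j <- r) c j * m (A j `&` (~` A i `&` E)).
  rewrite -big_split /=; apply: eq_bigr => j _.
  rewrite (content_split (MA i) (contentI mP (MA j) ME)) mulrDr.
  by rewrite setICA [in X in _ + X]setICA.
by congr (_ <= _); ring.
Qed.

(** This does the work of an integral: averaging and counting arguments reduce to a pointwise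
    inequality between combinations of indicators. *)
Lemma content_le (I J : Type) (r : seq I) (s : seq J) (A : I -> set T)
    (B : J -> set T) (c : I -> R) (d : J -> R) :
  (forall i, M (A i)) -> (forall j, M (B j)) ->
  (forall x, \sum_(i <- r) c i * ind (A i) x <= \sum_(j <- s) d j * ind (B j) x) ->
  \sum_(i <- r) c i * m (A i) <= \sum_(j <- s) d j * m (B j).
Proof.
move=> MA MB le; rewrite -subr_ge0.
pose AB (k : I + J) := match k with inl i => A i | inr j => B j end.
pose cd (k : I + J) := match k with inl i => - c i | inr j => d j end.
have negE (F : I -> R) : - \sum_(i <- r) c i * F i = \sum_(i <- r) - c i * F i.
  by rewrite -sumrN; apply: eq_bigr => i _; rewrite mulNr.
have sumE (F : set T -> R) :
    \sum_(k <- [seq inr j | j <- s] ++ [seq inl i | i <- r]) cd k * F (AB k) =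
    \sum_(j <- s) d j * F (B j) - \sum_(i <- r) c i * F (A i).
  by rewrite big_cat !big_map negE.
set rs := _ ++ _ in sumE.
have ABT : \sum_(k <- rs) cd k * m (AB k `&` setT) = \sum_(k <- rs) cd k * m (AB k).
  by apply: eq_bigr => k _; rewrite setIT.
have := @content_pos _ rs AB cd 0 setT; rewrite mul0r add0r ABT sumE.
apply=> [[i|j]||x _]; [exact: MA|exact: MB|exact: contentT mP|].
by rewrite add0r (sumE (fun C => ind C x)) subr_ge0; exact: le.
Qed.

End Contents.

Section Means.
Variables (R : realType) (H : groupType) (m : set H -> R).

Definition is_mean : Prop :=
  [/\ (forall A, 0 <= m A), m [set: H] = 1,
      (forall A B, A `&` B = set0 -> m (A `|` B) = m A + m B) &
      (forall (g : H) A, m [set (g * h)%g | h in A] = m A)].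

Hypothesis mP : is_mean.

Lemma mean_ge0 A : 0 <= m A. Proof. by case: mP. Qed.

Lemma meanT : m [set: H] = 1. Proof. by case: mP. Qed.

Lemma meanU A B : A `&` B = set0 -> m (A `|` B) = m A + m B.
Proof. by case: mP => _ _ + _; apply. Qed.

Lemma mean_translate (g : H) A : m [set h | A (g * h)%g] = m A.
Proof.
case: mP => _ _ _ mI; rewrite -(mI g); congr m.
apply/seteqP; split=> [_ [h Ah <-] //|h Ah].
by exists (g^-1 * h)%g; rewrite /= ?mulVKg.
Qed.

Lemma mean_content : is_content setT m.
Proof. by split=> // *; [exact: mean_ge0|exact: meanU]. Qed.

Lemma mean_le (I J : Type) (r : seq I) (s : seq J) (A : I -> set H)
    (B : J -> set H) (c : I -> R) (d : J -> R) :
  (forall g, \sum_(i <- r) c i * ind R (A i) g <=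
             \sum_(j <- s) d j * ind R (B j) g) ->
  \sum_(i <- r) c i * m (A i) <= \sum_(j <- s) d j * m (B j).
Proof. exact: (content_le mean_content). Qed.

Lemma mean_mono A B : A `<=` B -> m A <= m B.
Proof.
move=> AB; have := @mean_le _ _ [:: tt] [:: tt] (fun=> A) (fun=> B)
  (fun=> 1) (fun=> 1).
rewrite !big_seq1 !mul1r; apply=> g; rewrite !big_seq1 !mul1r.
have [Ag|nAg] := pselect (A g); first by rewrite !indT //; exact: AB.
by rewrite indF // ind_ge0.
Qed.

Definition fmul (K F : {fset H}) : {fset H} :=
  [fset (k * g)%g | k in K, g in F]%fset.

Lemma fmulP (K F : {fset H}) g :
  reflect (exists k h, [/\ k \in K, h \in F & g = (k * h)%g]) (g \in fmul K F).
Proof.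
apply: (iffP idP) => [/imfset2P[/= k kK [h hF ->]]|[k [h [kK hF ->]]]].
  by exists k, h.
by apply/imfset2P; exists k => //; exists h.
Qed.

Lemma fmulA K L F : fmul (fmul K L) F = fmul K (fmul L F).
Proof.
apply/fsetP => g; apply/fmulP/fmulP.
  move=> [_ [h [/fmulP[k [l [kK lL ->]]] hF ->]]].
  by exists k, (l * h)%g; split; rewrite ?mulgA //; apply/fmulP; exists l, h.
move=> [k [_ [kK /fmulP[l [h [lL hF ->]]] ->]]].
by exists (k * l)%g, h; split; rewrite ?mulgA //; apply/fmulP; exists k, l.
Qed.

(* A two-to-one matching of the group into itself along translations by [K]
   would double the mean. *)
Lemma mean_not_doubling (K : {fset H}) :
  ~ forall F : {fset H}, (2 * #|` F| <= #|` fmul K F|)%N.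
Proof.
move=> dbl; pose N (p : H * bool) : {fset H} := fmul K [fset p.1]%fset.
have [|f [f_inj fN]] := @Hall_matching (H * bool)%type H N.
  move=> A; pose A1 := [fset p.1 | p in A]%fset.
  have -> : (\bigcup_(p <- A) N p)%fset = fmul K A1.
    apply/fsetP => g; apply/bigfcupP/fmulP.
      move=> [p /andP[pA _] /fmulP[k [h [kK /fset1P -> ->]]]].
      by exists k, p.1; split=> //; apply/imfsetP; exists p.
    move=> [k [_ [kK /imfsetP[/= p pA ->] ->]]]; exists p; first by rewrite pA.
    by apply/fmulP; exists k, p.1; split=> //; exact/fset1P.
  apply: leq_trans (dbl A1).
  have le b : (#|` [fset p in A | p.2 == b]%fset| <= #|` A1|)%N.
    have /card_in_imfsetP/eqP <- :
        {in [fset p in A | p.2 == b]%fset &, injective (fun p : H * bool => p.1)}.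
      move=> [g1 b1] [g2 b2]; rewrite !inE /= => /andP[_ /eqP ->].
      by move=> /andP[_ /eqP ->] ->.
    apply: fsubset_leq_card; apply/fsubsetP => g /imfsetP[/= p].
    by rewrite !inE => /andP[pA _] ->; apply/imfsetP; exists p.
  have sub : (A `<=` [fset p in A | p.2 == true] `|`
                     [fset p in A | p.2 == false])%fset.
    by apply/fsubsetP => p pA; rewrite !inE pA; case: p.2.
  apply: leq_trans (fsubset_leq_card sub) _; rewrite cardfsU mul2n -addnn.
  by apply: leq_trans (leq_subr _ _) _; exact: leq_add.
pose r := [seq (k, b) | k <- enum_fset K, b <- [:: true; false]].
pose A (p : H * bool) : set H := [set g | f (g, p.2) = (p.1 * g)%g].
pose B (p : H * bool) : set H := [set h | f ((p.1)^-1 * h, p.2)%g = h].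
have AB p : m (A p) = m (B p).
  rewrite -(mean_translate p.1 (B p)); congr m.
  by apply/seteqP; split=> g; rewrite /A /B /= mulKg.
have : \sum_(u <- [:: tt]) 2 * m [set: H] <= \sum_(p <- r) 1 * m (A p).
  apply: mean_le => g; rewrite big_seq1 indT // mulr1.
  rewrite big_allpairs /= exchange_big /= !big_cons big_nil addr0.
  have ge1 b : 1 <= \sum_(k <- K) 1 * ind R (A (k, b)) g.
    have := fN (g, b) => /fmulP[k [_ [kK /fset1P -> e]]].
    rewrite (big_fsetD1 k) //= mul1r indT // lerDl sumr_ge0 // => h _.
    by rewrite mul1r ind_ge0.
  by have := ge1 true; have := ge1 false; lra.
have : \sum_(p <- r) 1 * m (B p) <= \sum_(u <- [:: tt]) 1 * m [set: H].
  apply: mean_le => g; rewrite big_seq1 indT // mulr1.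
  have [[p [pr Bp]]|nB] := pselect (exists p, p \in r /\ B p g); last first.
    rewrite big1_seq // => p /= pr; rewrite indF ?mulr0 // => Bp.
    by apply: nB; exists p.
  have ur : uniq r by rewrite allpairs_uniq // => -[? ?] [].
  rewrite (bigD1_seq p) //= big1 ?addr0 ?mul1r ?ind_le1 // => q qp.
  rewrite mul1r indF // => Bq; move/negP: qp; apply; apply/eqP.
  have [e1 e2] := f_inj _ _ (etrans Bq (esym Bp)).
  by move: e1 e2 {Bp Bq pr}; case: p q => [k b] [l c] /= /mulIg/invg_inj -> ->.
under [X in X <= _]eq_bigr do rewrite -AB.
by rewrite !big_seq1 meanT; lra.
Qed.

(** If [K] expanded every finite set by the factor [1 + e], a power of [K] would at least double
    every finite set. *)
Lemma mean_Folner (K : {fset H}) (e : R) : 1%g \in K -> 0 < e ->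
  exists2 F : {fset H}, F != fset0 & (#|` fmul K F|%:R <= (1 + e) * #|` F|%:R)%R.
Proof.
move=> K1 e0; apply: contrapT => noF.
have big (F : {fset H}) : (1 + e) * #|` F|%:R <= #|` fmul K F|%:R :> R.
  have [->|F0] := eqVneq F fset0; first by rewrite cardfs0 mulr0 ler0n.
  by rewrite leNgt; apply/negP => /ltW ?; apply: noF; exists F.
pose Kn n := iter n (fmul K) [fset 1%g]%fset.
have bign n (F : {fset H}) : (1 + e) ^+ n * #|` F|%:R <= #|` fmul (Kn n) F|%:R :> R.
  elim: n => [|n IH].
    rewrite expr0 mul1r ler_nat; apply: fsubset_leq_card; apply/fsubsetP => g gF.
    by apply/fmulP; exists 1%g, g; rewrite inE eqxx mul1g.
  rewrite exprS -mulrA /Kn iterS fmulA; apply: le_trans (big _).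
  by rewrite ler_pM2l // addr_gt0.
(* Then [n * e > 1], and Bernoulli's inequality gives [(1 + e) ^+ n >= 2]. *)
have [n n_gt] : exists n : nat, e^-1 < n%:R.
  by exists (Num.bound e^-1); rewrite archi_boundP // invr_ge0 ltW.
apply: (@mean_not_doubling (Kn n)) => F.
rewrite -(ler_nat R) natrM; apply: le_trans (bign n F); rewrite ler_wpM2r //.
apply: le_trans (_ : 1 + n%:R * e <= _).
  by rewrite -lerBlDl -ler_pdivrMr // (_ : 2 - 1 = 1) ?div1r ?ltW //; lra.
elim: n {n_gt} => [|n IH]; first by rewrite expr0 mul0r addr0.
rewrite exprS; apply: le_trans (_ : (1 + e) * (1 + n%:R * e) <= _); last first.
  by rewrite ler_pM2l // addr_gt0.
have : 0 <= n%:R * e * e by rewrite !mulr_ge0 // ltW.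
by rewrite -natr1 !mulrDl !mulrDr; lra.
Qed.

End Means.

(** Taking [F0] invariant up to [e] under the ball of radius [2n] leaves a margin of [n] on both
    sides of [F]: the shell between [F0] and [F1] holds the positions that are [n]-close to the
    boundary of [F], from inside or from outside. *)
Lemma mean_Folner_shells (R : realType) (H : groupType) (m : set H -> R)
    (S : {fset H}) (n : nat) (e : R) : is_mean m -> 0 < e ->
  exists F0 F F1 : {fset H},
    [/\ F != fset0,
        (forall b g, b \in wball S n -> g \in F0 -> (b * g)%g \in F),
        (forall b g, b \in wball S n -> g \in F -> (b * g)%g \in F1),
        (F0 `<=` F)%fset && (F `<=` F1)%fset &
        (#|` (F1 `\` F0)%fset|%:R <= e * #|` F|%:R)%R].
Proof.
move=> mP e0; have [F0 F0n le] := mean_Folner mP (wball1 S (n + n)) e0.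
exists F0, (fmul (wball S n) F0), (fmul (wball S n) (fmul (wball S n) F0)).
have sub F : (F `<=` fmul (wball S n) F)%fset.
  by apply/fsubsetP => g gF; apply/fmulP; exists 1%g, g; rewrite wball1 mul1g.
have sub01 := fsubset_trans (sub F0) (sub _).
split.
- apply: contra_neq F0n => F00; apply/eqP; rewrite -fsubset0 -F00; exact: sub.
- by move=> b g bn gF; apply/fmulP; exists b, g.
- by move=> b g bn gF; apply/fmulP; exists b, g.
- by rewrite !sub.
- rewrite cardfsDS // natrB ?fsubset_leq_card // lerBlDr.
  rewrite -fmulA (_ : fmul (wball S n) (wball S n) = wball S (n + n)); last first.
    apply/fsetP => g; apply/fmulP/idP => [[k [h [kn hn ->]]]|/wball_split//].
    exact: wballM.
  apply: le_trans le _; rewrite mulrDl mul1r addrC lerD2r ler_pM2l // ler_nat.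
  exact/fsubset_leq_card/sub.
Qed.

Section SchreierConn.
Variables (H : groupType) (S : {fset H}) (X : Type) (act : H -> X -> X).
Hypothesis hact : is_group_action act.

Lemma schreier_adjE x y : schreier_adj S act x y <-> x <> y /\ nb S act x y.
Proof.
split=> [[xy [s sS e]]|[xy [s /symgenE sS ys]]]; split=> //.
  case: e => [->|->]; first by exists s => //; exact: symgenS.
  by apply: (nb_sym hact); exists s => //; exact: symgenS.
case: sS ys => [->|sS ->|[t tS ->] yt]; first by rewrite (act1 hact) => /esym.
  by exists s => //; left.
by exists t => //; right; rewrite yt (actVK hact).
Qed.

Lemma clos_conn (G : graph X) (A : set X) x y :
  (forall u v, adj G u v <-> [/\ u <> v, nb S act u v, A u & A v]) -> A x ->
  Relation_Operators.clos_refl_trans X (adj G) x y <-> conn S act A x y.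
Proof.
move=> GE Ax; split=> [|xy].
  move=> xy; suff : A x -> conn S act A x y by apply.
  elim: xy => [u v /GE[_ uv Au Av] _|u Au|u v w uv IHu vw IHv Au].
  - exact: conn1.
  - exact: conn_refl.
  - by have uv' := IHu Au; exact: conn_trans uv' (IHv (conn_lst uv')).
move: y xy; apply: (conn_ind hact) => [_|y z xy IH yz Az].
  exact: Relation_Operators.rt_refl.
have [<-//|nyz] := pselect (y = z).
apply: (Relation_Operators.rt_trans _ _ _ _ _ IH).
apply: Relation_Operators.rt_step; apply/GE; split=> //.
exact: conn_lst xy.
Qed.

End SchreierConn.

(** * Superlinear growth of one-ended groups *)

Section Growth.
Variables (H : groupType) (S : {fset H}).
Hypothesis gS : generates S.

Local Notation lmul := (fun s h : H => (s * h)%g).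
Local Notation conn := (conn S lmul).

Lemma lmul_action : is_group_action lmul.
Proof. by split=> [x|g h x]; rewrite ?mul1g ?mulgA. Qed.

Let wlen_ex g : exists n, g \in wball S n. Proof. exact: wball_gen. Qed.

Definition wlen g : nat := ex_minn (wlen_ex g).

Arguments wlen _%_g.

Lemma wlenE g n : (g \in wball S n) = (wlen g <= n)%N.
Proof.
rewrite /wlen; case: ex_minnP => k gk kmin; apply/idP/idP; first exact: kmin.
by move=> kn; exact: wball_le gk.
Qed.

Lemma wlenM g h : (wlen (g * h) <= wlen g + wlen h)%N.
Proof. by rewrite -wlenE wballM // wlenE. Qed.

Lemma wlenV g : wlen g^-1 = wlen g.
Proof.
have le h : (wlen h^-1 <= wlen h)%N by rewrite -wlenE wballV // wlenE.
by apply/eqP; rewrite eqn_leq le -{1}(invgK g) le.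
Qed.

Lemma wlen_split g m n : wlen g = (m + n)%N ->
  exists h k, [/\ wlen h = m, wlen k = n & g = (h * k)%g].
Proof.
move=> gmn; have : g \in wball S (m + n) by rewrite wlenE gmn.
move=> /wball_split[h [k []]]; rewrite !wlenE => hm kn e.
by exists h, k; have := wlenM h k; rewrite -e gmn; split=> //; lia.
Qed.

Lemma nb_wlen x y : nb S lmul x y -> (wlen y <= (wlen x).+1)%N.
Proof.
case=> s /wball_symgen; rewrite wlenE => s1 ->; apply: leq_trans (wlenM _ _) _.
by rewrite -add1n leq_add2r.
Qed.

(** Right translations are automorphisms of this graph, so annuli around the identity can be moved
    around any point. *)
Lemma nb_mulr x y p : nb S lmul x y -> nb S lmul (x * p)%g (y * p)%g.
Proof. by case=> s sS ->; exists s => //=; rewrite mulgA. Qed.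

Lemma conn_lmul x y : conn setT x y.
Proof.
have [n yn] := wball_gen gS (y * x^-1)%g; exists n.
by apply: (within_steps lmul_action) => //; exists (y * x^-1)%g; rewrite ?mulgVK.
Qed.

Hypothesis oS : one_ended (cayley S).

Let outer d := [set x | (d < wlen x)%N].

Let outerE d : outer d = ~` [set` wball S d].
Proof.
by apply/seteqP; split=> x; rewrite /outer /= wlenE ltnNge => /negP.
Qed.

Let finite_bounded (C : set H) : finite_set C ->
  exists n, forall y, C y -> (wlen y < n)%N.
Proof.
move=> /finite_fsetP[F ->].
by apply: fset_uniform => [m n y mn /leq_trans->//|y _]; exists (wlen y).+1.
Qed.

Let comp_outer d x : outer d x ->
  component (induced_subgraph (cayley S) (~` [set` wball S d])) x =
  [set y | conn (outer d) x y].
Proof.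
move=> dx; rewrite -outerE.
have E y : component (induced_subgraph (cayley S) (outer d)) x y <->
    conn (outer d) x y.
  apply: (clos_conn lmul_action) => // u v /=; split.
    by case=> /(schreier_adjE S lmul_action)[].
  by case=> uv nuv du dv; split=> //; exact/(schreier_adjE S lmul_action).
by apply/seteqP; split=> y /E.
Qed.

(** Each component of [outer d] has a point of length at most [d + 1], where a path to the identity
    leaves it. So there are finitely many components, and the finite ones are bounded. *)
Let far_comp d : exists h, (d < h)%N /\
  forall x, (h <= wlen x)%N -> infinite_set [set y | conn (outer d) x y].
Proof.
have [|w|n nP] := @fset_uniform _ (fun n w =>
  finite_set [set y | conn (outer d) w y] ->
  forall y, conn (outer d) w y -> (wlen y < n)%N) (wball S d.+1).
- by move=> m n t mn h ft y wy; apply: leq_trans (h ft _ wy) mn.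
- move=> _; have [/finite_bounded[n nP]|nf] :=
    pselect (finite_set [set y | conn (outer d) w y]); first by exists n.
  by exists 0%N => /nf.
exists (maxn n d.+1); split; first by rewrite leq_max ltnSn orbT.
move=> x hx; have dx : outer d x by apply: leq_trans hx; rewrite leq_max ltnSn orbT.
have [|[z [w [xz zw dw _]]]] := conn_exit lmul_action (conn_lmul x 1%g) dx.
  by move=> c1; have [_] := conn_lst c1; rewrite /outer /= ltnNge -wlenE wball1.
have {}xz : conn (outer d) x z by apply: conn_sub xz => t [].
have : (wlen z <= d.+1)%N.
  have := nb_wlen (nb_sym lmul_action zw); move/negP: dw; rewrite -leqNgt => dw.
  by move/leq_trans; apply.
rewrite -wlenE => /nP zP fx.
suff fz : finite_set [set y | conn (outer d) z y].
  have := zP fz x (conn_sym lmul_action xz).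
  by rewrite ltnNge (leq_trans (leq_maxl _ _) hx).
by apply: sub_finite_set fx => y; exact: conn_trans.
Qed.

Let conn_bounded A x y : conn A x y ->
  exists n, conn (A `&` [set u | (wlen u <= n)%N]) x y.
Proof.
move: y; apply: (conn_ind lmul_action) => [Ax|y z xy [n IH] yz Az].
  by exists (wlen x); apply: conn_refl; split=> /=.
exists (maxn n (wlen z)); apply: conn_step yz _; last first.
  by split=> //=; rewrite leq_maxr.
apply: conn_sub IH => u [Au un]; split=> //=; exact: leq_trans un (leq_maxl _ _).
Qed.

(** Points far enough away lie in the unique infinite component of [outer d]; a common bound [r]
    exists because the sphere of radius [h] is finite. *)
Let shell_connected d : exists h r, (d < h)%N /\ forall x z,
  wlen x = h -> wlen z = h ->
  conn (outer d `&` [set u | (wlen u <= r)%N]) x z.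
Proof.
have [h [dh hP]] := far_comp d; exists h.
have [||r rP] := @fset_uniform _ (fun r (p : H * H) =>
    wlen p.1 = h -> wlen p.2 = h ->
    conn (outer d `&` [set u | (wlen u <= r)%N]) p.1 p.2)
  [fset p | p in [seq (x, z) | x <- enum_fset (wball S h),
                               z <- enum_fset (wball S h)]]%fset.
- move=> m n p mn IH p1 p2; apply: conn_sub (IH p1 p2) => u [du um].
  by split=> //; exact: leq_trans um mn.
- move=> [x z] _ /=.
  have [xh|nxh] := pselect (wlen x = h); last by exists 0%N.
  have [zh|nzh] := pselect (wlen z = h); last by exists 0%N.
  have dx : outer d x by rewrite /outer /= xh.
  have dz : outer d z by rewrite /outer /= zh.
  have xinf : infinite_set [set y | conn (outer d) x y] by apply: hP; rewrite xh.
  have zinf : infinite_set [set y | conn (outer d) z y] by apply: hP; rewrite zh.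
  have [_ /(_ [set` wball S d])[//||C [_ Cuniq]]] := oS; first exact: finite_fset.
  have Cx : C = [set y | conn (outer d) x y].
    apply: Cuniq; split=> //; rewrite -comp_outer //; exists x => //.
    by split=> //; rewrite -outerE.
  have Cz : C = [set y | conn (outer d) z y].
    apply: Cuniq; split=> //; rewrite -comp_outer //; exists z => //.
    by split=> //; rewrite -outerE.
  have : C z by rewrite Cz; exact: conn_refl.
  by rewrite Cx => /conn_bounded[n nP]; exists n.
exists r; split=> // x z xh zh; apply: (rP (x, z)) => //.
by rewrite !inE; apply/allpairsPdep; exists x, z; rewrite !wlenE xh zh.
Qed.

Let wlen_onto n : exists g, wlen g = n.
Proof.
have [_ /(_ set0)[//|//|C [[_ Cinf] _]]] := oS.
have [g ng] : exists g, (n < wlen g)%N.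
  apply: contrapT => /forallNP ng; apply: Cinf.
  apply: (@sub_finite_set _ _ [set` wball S n]); last exact: finite_fset.
  by move=> g _ /=; rewrite wlenE leqNgt; apply/negP.
have : wlen g = (wlen g - n + n)%N by rewrite subnK // ltnW.
by move=> /wlen_split[h [k [_ kn _]]]; exists k.
Qed.

(* The midpoint of a geodesic issued from the identity is the origin of
   geodesics going towards and away from the identity. *)
Let midpoint r p := wlen p = r /\ forall h, (h <= r)%N ->
  exists x z, [/\ wlen x = h, wlen z = h,
    wlen (x * p) = (r - h)%N & wlen (z * p) = (r + h)%N].

Let ex_midpoint r : exists p, midpoint r p.
Proof.
have [g gr] := wlen_onto (r + r).
have [u [p [ur pr gup]]] := wlen_split gr.
exists p; split=> // h hr.
have [u2 [u1 [u2h u1h uE]]] : exists u2 u1,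
    [/\ wlen u2 = (r - h)%N, wlen u1 = h & u = (u2 * u1)%g].
  by apply: wlen_split; rewrite subnK.
have [v [q [vh qh pE]]] : exists v q,
    [/\ wlen v = h, wlen q = (r - h)%N & p = (v * q)%g].
  by apply: wlen_split; rewrite subnKC.
exists v^-1%g, u1; split=> //; first by rewrite wlenV.
  by rewrite pE mulKg.
have := wlenM u2 (u1 * p); rewrite mulgA -uE -gup gr u2h.
by have := wlenM u1 p; rewrite u1h pr; lia.
Qed.

(** In an annulus around the midpoint [p], a point nearer to the identity than [p] is connected to a
    farther one. The path avoids the [d]-ball of [p], yet must cross the sphere of radius [r] around
    the identity. *)
Let sphere_point d : exists h D, forall r p, (h <= r)%N -> midpoint r p ->
  exists g, wlen g = r /\ (d < wlen (g * p^-1) <= D)%N.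
Proof.
have [h [D [dh hD]]] := shell_connected d; exists h, D => r p hr [pr mp].
have [x [z [xh zh xp zp]]] := mp h hr.
have h0 := leq_ltn_trans (leq0n d) dh.
pose B : set H := [set c | (wlen (c * p) < r)%N].
have Bx : B x by rewrite /B /= xp; lia.
have [|[c [c' [cc' nbc nBc' cxc']]]] :=
    conn_exit lmul_action (hD x z xh zh) Bx.
  by move=> cz; have [_] := conn_lst cz; rewrite /B /= zp ltnNge leq_addr.
have [dc' c'D] := conn_lst cxc'.
exists (c' * p)%g; rewrite mulgK; split; last exact/andP.
have := nb_wlen (nb_mulr p nbc); have [_] := conn_lst cc'.
move/negP: nBc'; rewrite /B /= -leqNgt => h1 h2 h3.
by apply/eqP; rewrite eqn_leq h1 (leq_trans h3 h2).
Qed.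

(** A new point farther from [p] than the previous bound [D] differs from all those found before. *)
Let sphere_card k : exists r0 D, forall r p, (r0 <= r)%N -> midpoint r p ->
  exists F : {fset H}, (k <= #|` F|)%N /\
    forall g, g \in F -> wlen g = r /\ (wlen (g * p^-1) <= D)%N.
Proof.
elim: k => [|k [r0 [D IH]]]; first by exists 0%N, 0%N => r p _ _; exists fset0.
have [h [D' hD]] := sphere_point D; exists (maxn r0 h), (maxn D D') => r p.
rewrite geq_max => /andP[r0r hr] mp; have [F [kF FP]] := IH r p r0r mp.
have [g [gr /andP[Dg gD]]] := hD r p hr mp; exists (g |` F)%fset; split.
  rewrite cardfsU1; case: (boolP (g \in F)) => [/FP[_]|_]; first lia.
  by rewrite add1n ltnS.
move=> g' /fset1UP[->|/FP[? le]]; split=> //; rewrite leq_max ?gD ?orbT //.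
by rewrite le.
Qed.

(** Every sphere beyond radius [r0] has at least [2k] elements by [sphere_card], so the balls grow
    at rate [2k] from there on. *)
Lemma one_ended_growth k : exists2 n, (0 < n)%N & (k * n <= #|` wball S n|)%N.
Proof.
have [r0 [D r0P]] := sphere_card (2 * k).
have le n : (n * (2 * k) <= #|` wball S (r0 + n)|)%N.
  elim: n => [|n IH]; first by rewrite mul0n.
  have [p mp] := ex_midpoint (r0 + n).+1.
  have [|F [kF FP]] := r0P (r0 + n).+1 p _ mp; first by lia.
  rewrite addnS mulSn addnC.
  have sub : (wball S (r0 + n) `|` F `<=` wball S (r0 + n).+1)%fset.
    apply/fsubsetP => g /fsetUP[|/FP[gr _]]; first exact: wball_le.
    by rewrite wlenE gr.
  apply: leq_trans (fsubset_leq_card sub); rewrite cardfsU.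
  rewrite (_ : (_ `&` _)%fset = fset0) ?cardfs0 ?subn0 ?leq_add //.
  apply/eqP; rewrite -fsubset0; apply/fsubsetP => g /fsetIP[+ /FP[gr _]].
  by rewrite wlenE gr; lia.
(* The uncounted spheres below [r0] are why the rate was doubled: [2k (r0 + 1)] is at least
   [k (2 r0 + 1)]. *)
exists (r0 + r0.+1)%N; first by rewrite addnS.
by apply: leq_trans (le r0.+1); lia.
Qed.

End Growth.

Lemma one_ended_group_growth (H : groupType) (S : {fset H}) :
  generates S -> one_ended_group H ->
  forall k, exists2 n, (0 < n)%N & (k * n <= #|` wball S n|)%N.
Proof.
move=> gS [S' gS' oS'] k.
have [c S'c] := wball_gen_fset (symgen S') gS.
have sub n : (wball S' n `<=` wball S (n * c))%fset.
  elim: n => [|n IH]; first exact: fsubset_refl.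
  apply/fsubsetP => g /wballSP[s [h [sS' hn ->]]]; rewrite mulSn wballM //.
    exact: (fsubsetP S'c).
  exact: (fsubsetP IH).
(* The factor [c.+1] makes up for rescaling the balls from [S'] to [S]; the successor keeps the
   radius positive. *)
have [n n0 le] := one_ended_growth gS' oS' (k * c.+1).
exists (n * c.+1)%N; first by rewrite muln_gt0 n0.
apply: leq_trans (leq_trans le _); first by lia.
apply: fsubset_leq_card; apply: fsubset_trans (sub n) _; apply/fsubsetP => g.
by apply: wball_le; rewrite leq_mul.
Qed.

(** * Tilings of the group by connected skeletons *)

Lemma dependent_sequence (T : Type) (Q : nat -> seq T -> T -> Prop) :
  (forall n s, exists x, Q n s x) ->
  exists u : nat -> T, forall n, Q n (mkseq u n) (u n).
Proof.
move=> exQ; have [g gP] := choice (fun p => exQ p.1 p.2).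
pose L := fix L n := if n is k.+1 then rcons (L k) (g (k, L k)) else [::].
pose u n := g (n, L n).
have LE n : L n = mkseq u n by elim: n => // n IH; rewrite mkseqS -IH.
by exists u => n; rewrite -LE; exact: (gP (n, L n)).
Qed.

Lemma greedy_set (C : nat -> set nat -> Prop) :
  exists U : set nat, forall n, U n <-> C n (U `&` [set k | (k < n)%N]).
Proof.
have [|u uP] := @dependent_sequence Prop (fun n s x =>
  x = C n [set k | (k < n)%N /\ nth False s k]).
  by move=> n s; exists (C n [set k | (k < n)%N /\ nth False s k]).
exists [set n | u n] => n /=; rewrite {1}uP.
suff -> : [set k | (k < n)%N /\ nth False (mkseq u n) k] =
    [set n | u n] `&` [set k | (k < n)%N] by [].
apply/seteqP; split=> k /= [].
  by move=> kn; rewrite nth_mkseq.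
by move=> uk kn; rewrite nth_mkseq.
Qed.

Section Spanning.
Variables (H : groupType) (S : {fset H}) (X : choiceType) (act : H -> X -> X).
Hypothesis hact : is_group_action act.

Local Notation nb := (nb S act).
Local Notation within := (within S act).
Local Notation steps := (steps S act).
Local Notation conn := (conn S act).
Local Notation connected := (connected S act).

Lemma steps_fset A n x y : steps A n x y ->
  exists V : {fset X}, [/\ (#|` V| <= n.+1)%N, x \in V, y \in V &
    forall v, v \in V -> [/\ A v, within n x v & conn [set` V] x v]].
Proof.
elim: n x => [x [<- Ax]|n IH x [Ax [z xz zy]]].
  exists [fset x]%fset; rewrite cardfs1 inE eqxx; split=> // v /fset1P ->.
  by split=> //; [exact: within_refl|apply: conn_refl; rewrite /= inE].
have [V [Vn zV yV VP]] := IH z zy; exists (x |` V)%fset; split.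
- by rewrite cardfsU1; apply: leq_trans (leq_add (leq_b1 _) Vn) _.
- exact: fset1U1.
- exact: fset1Ur.
move=> v /fset1UP[->|/VP[Av zv cv]].
  by split=> //; [exact: within_refl|apply: conn_refl; exact: fset1U1].
split=> //.
  by rewrite -add1n; apply: within_trans zv => //; exact/nb_within.
apply: (@conn_trans _ _ _ _ _ _ z).
  by apply: conn1 => //; [exact: fset1U1|exact: fset1Ur].
by apply: conn_sub cv => w /=; exact: fset1Ur.
Qed.

Let span_good (M D0 : set X) rho (f : X -> {fset X}) (z : X) :=
  [/\ z \in f z, (#|` f z| <= (2 * rho).+2)%N &
      forall y, y \in f z -> M y /\ within (2 * rho).+1 z y].

(* Grow a connected set by attaching one new point of [D0] at a time, along a
   path of length at most [2 rho + 1]: a point [rho]-close to the part already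
   attached has a neighbour that is [rho]-close to the rest. *)
Lemma span_connected (M D0 : set X) rho : finite_set M -> connected M ->
  (forall y, M y -> exists2 z, D0 z & steps M rho y z) ->
  exists f : X -> {fset X}, [/\
    (forall z, D0 z -> M z -> z \in f z),
    (forall z, (#|` f z| <= (2 * rho).+2)%N),
    (forall z y, y \in f z -> M y /\ within (2 * rho).+1 z y) &
    connected [set y | exists2 z, D0 z /\ M z & y \in f z]].
Proof.
move=> /finite_fsetP[Mf ME] cM dM.
pose U (E : {fset X}) (f : X -> {fset X}) :=
  [set y | exists2 z, z \in E & y \in f z].
have [[x Mx]|noM] := pselect (exists x, M x); last first.
  exists (fun=> fset0); split=> [z _ Mz|z|z y|y y' [z [_ Mz]]] //.
  by exfalso; apply: noM; exists z.
have [z0 Dz0 xz0] := dM x Mx; have Mz0 := steps_lst xz0.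
suff grow n (E : {fset X}) f : z0 \in E ->
    (forall z, z \in E -> D0 z /\ span_good M D0 rho f z) ->
    connected (U E f) -> (#|` Mf `\` E|%fset <= n)%N ->
    exists E' f', [/\ (forall z, D0 z -> M z -> z \in E'),
      (forall z, z \in E' -> D0 z /\ span_good M D0 rho f' z) &
      connected (U E' f')].
  have [||||E [f [allE fE cE]]] := grow #|` Mf| [fset z0]%fset (fun=> [fset z0]%fset).
  - exact/fset1P.
  - move=> z /fset1P ->; split=> //; split; rewrite ?inE ?cardfs1 //.
    by move=> y /fset1P ->; split=> //; exact: within_refl.
  - move=> y y' [? _ /fset1P ->] [? _ /fset1P ->]; apply: conn_refl.
    by exists z0; rewrite inE.
  - exact/fsubset_leq_card/fsubsetDl.
  exists (fun z => if z \in E then f z else fset0); split.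
  - by move=> z Dz Mz; rewrite allE //; have [_ []] := fE z (allE _ Dz Mz).
  - by move=> z; case: ifP => // /fE[_ []].
  - by move=> z y; case: ifP => // /fE[_ [_ _]]; apply.
  rewrite (_ : [set y | _] = U E f) //; apply/seteqP; split=> y.
    by move=> [z [Dz Mz]]; rewrite allE // => yz; exists z; rewrite ?allE.
  move=> [z zE yz]; have [Dz [zz _ fM]] := fE z zE; exists z; rewrite ?zE //.
  by split=> //; have [] := fM _ zz.
elim: n E f => [|n IH] E f z0E fE cE En.
  exists E, f; split=> // z _ Mz.
  move: En; rewrite leqn0 cardfs_eq0 -fsubset0 => /fsubsetP/(_ z).
  rewrite inE (_ : z \in Mf) ?andbT; last by move: Mz; rewrite ME.
  by have [//|zE] := boolP (z \in E) => /(_ isT).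
have [allE|/existsNP[u /not_implyP[Du /not_implyP[Mu uE]]]] :=
    pselect (forall z, D0 z -> M z -> z \in E); first by exists E, f.
have [z [z1 [Dz Mz zE [z1E zz1]]]] : exists z z1,
    [/\ D0 z, M z, z \notin E & z1 \in E /\ exists2 k, (k <= (2 * rho).+1)%N &
      steps M k z z1].
  pose B : set X := [set y | exists2 z1, z1 \in E & steps M rho y z1].
  have stepE z : z \in E -> steps M rho z z.
    move=> zE; have [_ [zz _ fM]] := fE z zE.
    by have [Mz _] := fM _ zz; exact: steps_refl.
  have Bz0 : B z0 by exists z0 => //; exact: stepE.
  have [cu|[v [w [z0v vw nBw z0w]]]] := conn_exit hact (cM z0 u Mz0 Mu) Bz0.
    have [_ [z1 z1E uz1]] := conn_lst cu; exists u, z1; split=> //; first exact/negP.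
    by split=> //; exists rho => //; lia.
  have [Mv [z1 z1E vz1]] := conn_lst z0v; have Mw := conn_lst z0w.
  have [z Dz wz] := dM w Mw; exists z, z1; split=> //.
  - exact: steps_lst wz.
  - by apply/negP => zE; apply: nBw; exists z.
  split=> //; exists (rho + (1 + rho))%N; first by lia.
  apply: (steps_trans (steps_sym hact wz)); apply: (steps_trans _ vz1).
  by apply: steps1 => //; exact: nb_sym.
move: zz1 => [k kr /steps_fset[V [Vk zV z1V VP]]].
pose f' y := if y == z then V else f y.
have f'E y : y \in E -> f' y = f y.
  by move=> yE; rewrite /f'; case: eqVneq => // yz; move: zE; rewrite -yz yE.
have f'z : f' z = V by rewrite /f' eqxx.
apply: (IH (z |` E)%fset f').
- exact: fset1Ur.
- move=> y /fset1UP[->|yE]; last by rewrite /span_good f'E //; exact: fE.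
  split=> //; split; rewrite f'z //; first exact: leq_trans Vk _.
  by move=> w /VP[Mw zw _]; split=> //; exact: within_le kr zw.
- have UV y : y \in V -> U (z |` E)%fset f' y.
    by move=> yV; exists z; rewrite ?f'z //; exact: fset1U1.
  have UE y : U E f y -> U (z |` E)%fset f' y.
    by move=> [w wE yw]; exists w; rewrite ?f'E //; exact: fset1Ur.
  have z1U : U E f z1 by have [_ [z1z1 _ _]] := fE z1 z1E; exists z1.
  have cz1 y : U (z |` E)%fset f' y -> conn (U (z |` E)%fset f') y z1.
    move=> [w /fset1UP[->|wE]].
      rewrite f'z => yV; apply: (@conn_trans _ _ _ _ _ _ z).
        apply: (conn_sym hact); have [_ _] := VP _ yV.
        by apply: conn_sub => t /UV.
      by have [_ _] := VP _ z1V; apply: conn_sub => t /UV.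
    rewrite f'E // => yw; apply: conn_sub (cE y z1 _ z1U) => //.
    by exists w.
  move=> y y' Uy Uy'; apply: conn_trans (cz1 y Uy) _.
  exact/(conn_sym hact)/cz1.
- have zME : z \in (Mf `\` E)%fset.
    by apply/fsetDP; split=> //; move: Mz; rewrite ME.
  move: En; rewrite (cardfsD1 z) zME add1n ltnS; apply: leq_trans.
  apply/fsubset_leq_card/fsubsetP => y /fsetDP[yM /negP yzE].
  apply/fsetD1P; split; first by apply/eqP => yz; apply: yzE; rewrite yz fset1U1.
  by apply/fsetDP; split=> //; apply/negP => yE; apply/yzE/fset1Ur.
Qed.

(** The spanning family is chosen as a function of the class as a set, not of one of its points, so
    that all points of a class share it. *)
Lemma span_classes (e : X -> X -> Prop) (D0 : set X) rho :
  (forall x, e x x) -> (forall x y, e x y -> e y x) ->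
  (forall x y z, e x y -> e y z -> e x z) ->
  (forall x, finite_set [set y | e x y]) ->
  (forall x, connected [set y | e x y]) ->
  (forall y, exists2 z, D0 z & steps [set w | e y w] rho y z) ->
  exists f : X -> {fset X}, [/\
    (forall z, D0 z -> z \in f z),
    (forall z, (#|` f z| <= (2 * rho).+2)%N),
    (forall z y, y \in f z -> e z y /\ within (2 * rho).+1 z y) &
    let D := [set y | exists2 z, D0 z & y \in f z] in
    forall x y, e x y -> D x -> D y -> conn ([set z | e x z] `&` D) x y].
Proof.
move=> er es et fin con dense.
have eE x y : e x y -> [set w | e x w] = [set w | e y w].
  by move=> xy; apply/seteqP; split=> w /=; apply: et => //; exact: es.
have [|F FP] := @choice (set X) (X -> {fset X}) (fun M f =>
  (exists x, M = [set y | e x y]) -> [/\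
    (forall z, D0 z -> M z -> z \in f z),
    (forall z, (#|` f z| <= (2 * rho).+2)%N),
    (forall z y, y \in f z -> M y /\ within (2 * rho).+1 z y) &
    connected [set y | exists2 z, D0 z /\ M z & y \in f z]]).
  move=> M; have [[x ->]|nM] := pselect (exists x, M = [set y | e x y]);
    last by exists (fun=> fset0).
  have [|f fP] := @span_connected _ D0 rho (fin x) (con x).
    by move=> y xy; have [z Dz yz] := dense y; exists z; rewrite // (eE _ _ xy).
  by exists f.
have cls x : exists x0, [set y | e x y] = [set y | e x0 y] by exists x.
exists (fun z => F [set y | e z y] z); split.
- by move=> z Dz; have [h _ _ _] := FP _ (cls z); exact: h.
- by move=> z; have [_ h _ _] := FP _ (cls z).
- by move=> z y yz; have [_ _ h _] := FP _ (cls z); exact: h.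
move=> D x y xy; have [_ _ fM h] := FP _ (cls x).
have DE w : e x w -> D w ->
    exists2 z, D0 z /\ e x z & w \in F [set y | e x y] z.
  move=> xw [z Dz wz]; have [_ _ fz _] := FP _ (cls z).
  have [/= zw _] := fz _ _ wz; have xz := et _ _ _ xw (es _ _ zw).
  by exists z => //; rewrite (eE _ _ xz).
move=> Dx Dy; apply: conn_sub (h x y (DE x (er x) Dx) (DE y xy Dy)).
move=> w [z [Dz xz] wz]; split; first by have [] := fM _ _ wz.
by exists z => //; rewrite -(eE _ _ xz).
Qed.

End Spanning.

(** * Mass transport and averaging for an invariant mean *)

Section MeanTransport.
Variables (R : realType) (H : groupType) (m : set H -> R).
Hypothesis mP : is_mean m.
Variables (K : {fset H}) (Z : set H) (f : H -> {fset H}).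
Hypothesis fK : forall z y, Z z -> y \in f z -> (y * z^-1)%g \in K.

Let A (b : H) : set H := [set z | Z z /\ (b * z)%g \in f z].
Let B (b : H) : set H := [set y | Z (b^-1 * y)%g /\ y \in f (b^-1 * y)%g].

Let AB b : m (B b) = m (A b).
Proof.
rewrite -(mean_translate mP b (B b)); congr m.
by apply/seteqP; split=> z; rewrite /A /B /= mulKg.
Qed.

Let sumA g : \sum_(b <- K) 1 * ind R (A b) g = #|` f g|%:R * ind R Z g.
Proof.
have [Zg|nZ] := pselect (Z g); last first.
  by rewrite (indF _ nZ) mulr0 big1 // => b _; rewrite indF ?mulr0 // => -[].
rewrite (indT _ Zg) mulr1; pose V := [fset (y * g^-1)%g | y in f g]%fset.
have -> : #|` f g| = #|` V|.
  by rewrite card_imfset //; exact: mulIg.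
have VK : (V `<=` K)%fset.
  by apply/fsubsetP => b /imfsetP[/= y yg ->]; exact: fK.
rewrite card_fset_sum1 natr_sum.
transitivity (\sum_(b <- V) 1 * ind R (A b) g).
  apply/esym/(big_fset_incl _ VK) => b _ bV; rewrite mul1r indF // => -[_ bg].
  move/negP: bV; apply; apply/imfsetP; exists (b * g)%g => //.
  by rewrite mulgK.
apply: eq_big_seq => b /imfsetP[/= y yg ->].
by rewrite mul1r indT //; split=> //; rewrite mulgVK.
Qed.

(** Each [z] sends a unit to every point of [f z]. Sorted by the translation [b] in [K], the sources
    [A b] and the targets [B b] have equal means; the sources count [f z] at each [z], the targets
    at least one at each point of [D]. *)
Lemma mean_transport_le N (D : set H) :
  (forall z, Z z -> (#|` f z| <= N)%N) ->
  D `<=` [set y | exists2 z, Z z & y \in f z] -> m D <= N%:R * m Z.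
Proof.
move=> fN Df; apply: (@le_trans _ _ (\sum_(b <- K) 1 * m (B b))).
  have := @mean_le R H m mP _ _ [:: tt] K (fun=> D) B (fun=> 1) (fun=> 1).
  rewrite big_seq1 mul1r; apply=> y; rewrite big_seq1 mul1r.
  have [Dy|nD] := pselect (D y); last first.
    by rewrite (indF _ nD) sumr_ge0 // => b _; rewrite mul1r ind_ge0.
  have [z Zz yz] := Df _ Dy; have bK := fK Zz yz.
  have By : B (y * z^-1)%g y by rewrite /B /= invgM invgK mulgVK.
  rewrite (big_fsetD1 _ bK) /= (indT _ By) (indT _ Dy) mul1r lerDl.
  by rewrite sumr_ge0 // => b _; rewrite mul1r ind_ge0.
under eq_bigr do rewrite AB.
have := @mean_le R H m mP _ _ K [:: tt] A (fun=> Z) (fun=> 1) (fun=> N%:R).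
rewrite big_seq1; apply=> g; rewrite big_seq1 sumA.
have [Zg|nZ] := pselect (Z g); last by rewrite (indF _ nZ) !mulr0.
by rewrite ler_wpM2r ?ind_ge0 // ler_nat fN.
Qed.

(** The same transport read backwards: the sets [f z] being disjoint, the targets count at most one
    everywhere. *)
Lemma mean_transport_ge (t : R) : (forall z, Z z -> t <= #|` f z|%:R) ->
  (forall z z' y, Z z -> Z z' -> y \in f z -> y \in f z' -> z = z') ->
  t * m Z <= 1.
Proof.
move=> ft finj; apply: (@le_trans _ _ (\sum_(b <- K) 1 * m (A b))).
  have := @mean_le R H m mP _ _ [:: tt] K (fun=> Z) A (fun=> t) (fun=> 1).
  rewrite big_seq1; apply=> g; rewrite big_seq1 sumA.
  have [Zg|nZ] := pselect (Z g); last by rewrite (indF _ nZ) !mulr0.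
  by rewrite ler_wpM2r ?ind_ge0 // ft.
under eq_bigr do rewrite -AB.
have := @mean_le R H m mP _ _ K [:: tt] B (fun=> setT) (fun=> 1) (fun=> 1).
rewrite big_seq1 mul1r (meanT mP); apply=> y; rewrite big_seq1 mul1r indT //.
have [[b [bK Bb]]|nB] := pselect (exists b, b \in K /\ B b y); last first.
  rewrite big1_seq // => b /= bK; rewrite indF ?mulr0 // => Bb.
  by apply: nB; exists b.
rewrite (big_fsetD1 _ bK) /= mul1r big1_seq ?addr0 ?ind_le1 // => c /=.
move=> /fsetD1P[cb _]; rewrite mul1r indF // => Bc.
move/eqP: cb; apply; apply: invg_inj; apply: (@mulIg _ y).
by case: Bb Bc => [Zb yb] [Zc yc]; exact: finj yc yb.
Qed.

End MeanTransport.

Section MeanAverage.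
Variables (R : realType) (H : groupType) (m : set H -> R).
Hypothesis mP : is_mean m.
Variables (F : {fset H}) (w : H -> R) (A : set H).

Let sum_translate : (\sum_(b <- F) w b) * m A =
  \sum_(b <- F) w b * m [set g | A (b * g)%g].
Proof.
by rewrite mulr_suml; apply: eq_bigr => b _; rewrite mean_translate.
Qed.

Lemma mean_average_le (t : R) :
  (forall g, \sum_(b <- F) w b * ind R A (b * g)%g <= t) ->
  (\sum_(b <- F) w b) * m A <= t.
Proof.
move=> le; rewrite sum_translate; have := @mean_le R H m mP _ _ F [:: tt]
  (fun b => [set g | A (b * g)%g]) (fun=> setT) w (fun=> t).
rewrite big_seq1 (meanT mP) mulr1; apply=> g.
by rewrite big_seq1 indT // mulr1; exact: le.
Qed.

(** The weighted proportion of [F * g] in [A], averaged over [g], is [m A]; so some [g] does not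
    exceed [d]. This will position the pattern in a tile. *)
Lemma mean_choose (d : R) : (forall b, 0 <= w b) -> m A < d ->
  exists g, \sum_(b <- F) w b * ind R A (b * g)%g <= d * \sum_(b <- F) w b.
Proof.
move=> w0 Ad; have W0 : 0 <= \sum_(b <- F) w b by exact: sumr_ge0.
(* With zero total weight the strict comparison below is void, but any translate works. *)
have [W|W] := eqVneq (\sum_(b <- F) w b) 0.
  exists 1%g; rewrite W mulr0 -[leRHS]W; apply: ler_sum => b _.
  by rewrite ler_piMr // ind_le1.
apply: contrapT => /forallNP big.
have := @mean_le R H m mP _ _ [:: tt] F (fun=> setT)
  (fun b => [set g | A (b * g)%g]) (fun=> d * \sum_(b <- F) w b) w.
rewrite big_seq1 (meanT mP) mulr1 -sum_translate.
move=> h; have {}h := h _; have : d * \sum_(b <- F) w b <= (\sum_(b <- F) w b) * m A.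
  apply: h => g; rewrite big_seq1 indT // mulr1 leNgt; apply/negP => /ltW.
  exact: big.
by rewrite leNgt [d * _]mulrC ltr_pM2l ?Ad // lt0r W.
Qed.

End MeanAverage.

Section Owners.
Variables (H : groupType) (S : {fset H}) (X : Type) (act : H -> X -> X).
Hypothesis hact : is_group_action act.
Variables (n : nat) (F0 F F1 : {fset H}).
Hypothesis F0F : forall b g, b \in wball S n -> g \in F0 -> (b * g)%g \in F.
Hypothesis FF1 : forall b g, b \in wball S n -> g \in F -> (b * g)%g \in F1.

Definition covers x y := exists2 g, g \in F & y = act g x.

(* [B k] is the set of centres of the translates of [F] chosen at stage [k];
   a point belongs to the first chosen translate that contains it. *)
Definition owns (B : nat -> set X) k x y :=
  [/\ B k x, covers x y & forall j z, (j < k)%N -> B j z -> ~ covers z y].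

(** Two ways to lose the owner near [y]: either [w] leaves the translate at [x], and [y] is in its
    shell from inside, or [w] is covered earlier from some [z], and [y], not covered by [z], is in
    the shell of [z] from outside. *)
Lemma owns_bd B k x y w : owns B k x y -> within S act n y w ->
  ~ owns B k x w -> exists j z g, [/\ B j z, g \in F1, g \notin F0 & y = act g z].
Proof.
case=> Bx [g gF yE] yfirst [b bn wE] nw.
have [xw|nxw] := pselect (covers x w); last first.
  exists k, x, g; split=> //.
    by rewrite -(mul1g g) FF1 // wball1.
  apply/negP => g0; apply: nxw; exists (b * g)%g; first exact: F0F.
  by rewrite wE yE actM.
have [j [z [jk Bz [h hF wh]]]] : exists j z, [/\ (j < k)%N, B j z & covers z w].
  apply: contrapT => nj; apply: nw; split=> // j z jk Bz zw.
  by apply: nj; exists j, z.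
have yh : y = act (b^-1 * h)%g z by rewrite actM // -wh wE actK.
exists j, z, (b^-1 * h)%g; split=> //; first by rewrite FF1 // wballV.
apply/negP => /(F0F (wball1 S n)); rewrite mul1g => bh.
by apply: (yfirst j z jk Bz); exists (b^-1 * h)%g.
Qed.

Lemma owns_stage B j k x z y : owns B j x y -> owns B k z y -> j = k.
Proof.
move=> [Bx xy fj] [Bz zy fk]; case: (ltngtP j k) => // [jk|kj].
  by case: (fk _ _ jk Bx).
by case: (fj _ _ kj Bz).
Qed.

Lemma covers_owned B k x y : B k x -> covers x y -> exists j z, owns B j z y.
Proof.
move=> Bx xy; have : exists j, `[< exists2 z, B j z & covers z y >].
  by exists k; apply/asboolP; exists x.
case/ex_minnP => j /asboolP[z Bz zy] jmin; exists j, z; split=> // i w ij Bw wy.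
by have /jmin : `[< exists2 z, B i z & covers z y >];
  [apply/asboolP; exists w|rewrite leqNgt ij].
Qed.

End Owners.

Lemma sum_ind (R : realType) (H : groupType) (F : {fset H}) (P : set H) :
  \sum_(b <- F) 1 * ind R P b = #|` [fset b in F | `[< P b >]]%fset|%:R.
Proof.
rewrite card_fset_sum1 natr_sum -(big_fset_incl _ (fset_sub F (fun b => `[< P b >]))) /=.
  apply: eq_big_seq => b; rewrite !inE /= => /andP[_ /asboolP Pb].
  by rewrite mul1r indT.
move=> b bF; rewrite !inE /= bF /= => /asboolP nP.
by rewrite mul1r indF.
Qed.

Section GroupTiling.
Variables (R : realType) (H : groupType) (m : set H -> R) (S : {fset H}).
Hypothesis gS : generates S.
Hypothesis mP : is_mean m.

Local Notation lmul := (fun s h : H => (s * h)%g).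
Local Notation within := (within S lmul).
Local Notation conn := (conn S lmul).

Lemma meanU_le A B : m (A `|` B) <= m A + m B.
Proof.
have -> : A `|` B = A `|` (B `\` A).
  apply/seteqP; split=> g [Ag|Bg]; [by left| |by left|by right; case: Bg].
  by have [Ag|nAg] := pselect (A g); [left|right].
rewrite (meanU mP) ?lerD2l; last by rewrite setDE setIC -setIA setICl setI0.
by apply: (mean_mono mP) => g [].
Qed.

(** Centres more than [2n] apart carry disjoint balls of radius [n]; a point refused by the greedy
    choice is [2n]-close to an earlier centre. *)
Lemma ex_net n : exists N : set H,
  (forall y, exists2 z, N z & within (n + n) y z) /\
  m N * #|` wball S n|%:R <= 1.
Proof.
pose g := group_enum S.
have [U UP] := greedy_set (fun i V => forall k, V k -> ~ within (n + n) (g i) (g k)).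
exists [set x | exists2 i, U i & x = g i]; split.
  move=> y; have [i iy] := group_enumP gS y.
  have [Ui|nU] := pselect (U i).
    by exists y; [exists i; rewrite ?iy|exact: within_refl (lmul_action _) _ _].
  have /existsNP[k /not_implyP[[Uk _] /contrapT ik]] : ~ forall k,
      (U `&` [set k | (k < i)%N]) k -> ~ within (n + n) (g i) (g k).
    by move=> /UP.
  by exists (g k); [exists k|rewrite -iy].
rewrite mulrC; apply: (@mean_transport_ge _ _ _ mP (wball S n) _
  (fun x => [fset (b * x)%g | b in wball S n]%fset)).
- by move=> z y _ /imfsetP[/= b bn ->]; rewrite mulgK.
- by move=> z _; rewrite card_imfset //; exact: mulIg.
move=> z z' y [i Ui zi] [k Uk zk] /imfsetP[/= b bn yb] /imfsetP[/= c cn yc].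
have zz' : within (n + n) z z'.
  exists (c^-1 * b)%g; first by rewrite wballM // wballV.
  by rewrite -mulgA -yb yc mulKg.
have z'z := within_sym (lmul_action _) zz'.
case: (ltngtP i k) => [ik|ki|]; last by rewrite zi zk => ->.
  by have /UP/(_ i) := Uk; rewrite -zi -zk => /(_ (conj Ui ik)).
by have /UP/(_ k) := Ui; rewrite -zi -zk => /(_ (conj Uk ki)).
Qed.

(** A translate is chosen when at least [t] of its points are uncovered. Refused ones have fewer,
    which by averaging bounds the uncovered set. Chosen ones own at least [t] points, so the centres
    have mean at most [1 / t], and boundary points lie in the shells around them. *)
Lemma ex_group_tiles (F0 F F1 : {fset H}) n (t : R) : 0 < t ->
  (forall b g, b \in wball S n -> g \in F0 -> (b * g)%g \in F) ->
  (forall b g, b \in wball S n -> g \in F -> (b * g)%g \in F1) ->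
  exists B : nat -> set H, [/\
    (forall k x x', B k x -> B k x' -> x = x'),
    #|` F|%:R * m [set y | ~ exists k x, owns lmul F B k x y] <= t &
    t * m [set y | exists k x w, [/\ owns lmul F B k x y, within n y w &
                                 ~ owns lmul F B k x w]]
      <= #|` F1 `\` F0|%fset%:R].
Proof.
move=> t0 F0F FF1; pose g := group_enum S.
have [U UP] := greedy_set (fun i V => t <= #|` [fset b in F |
  `[< forall k, V k -> ~ covers lmul F (g k) (b * g i)%g >]]%fset|%:R).
pose B k : set H := [set x | U k /\ x = g k].
exists B; split; first by move=> k x x' [_ ->] [_ ->].
  have -> : #|` F|%:R = \sum_(b <- F) (1 : R) by rewrite card_fset_sum1 natr_sum.
  apply: (mean_average_le mP) => x; have [i <-] := group_enumP gS x.
  rewrite (sum_ind R F (fun b => ~ exists k x, owns lmul F B k x (b * group_enum S i)%g)).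
  have [Ui|nU] := pselect (U i).
    rewrite (_ : [fset _ in _ | _]%fset = fset0) ?cardfs0 ?ltW //.
    apply/fsetP => b; rewrite !inE; apply/negP => /andP[bF /asboolP]; apply.
    by apply: (@covers_owned _ _ _ _ _ i (g i)) => //; exists b.
  have {nU}: ~ _ := fun h => nU ((UP i).2 h); move/negP; rewrite -ltNge => /ltW.
  apply: le_trans; rewrite ler_nat; apply/fsubset_leq_card/fsubsetP => b.
  rewrite !inE => /andP[-> /asboolP nb] /=; apply/asboolP => k [Uk _] kb.
  by apply: nb; apply: (@covers_owned _ _ _ _ _ k (g k)).
pose Z : set H := [set x | exists k, B k x].
have Zge : t * m Z <= 1.
  apply: (@mean_transport_ge _ _ _ mP F _ (fun x => [fset y in [fset (b * x)%g | b in F]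
     | `[< exists k, owns lmul F B k x y >]]%fset)).
  - by move=> z y _; rewrite !inE => /andP[/imfsetP[/= b bF ->] _]; rewrite mulgK.
  - move=> z [k [Uk zk]]; apply: le_trans ((UP k).1 Uk) _; rewrite ler_nat.
    have cardE (V : {fset H}) : #|` V| = #|` [fset (b * g k)%g | b in V]%fset|.
      by rewrite card_imfset //; exact: mulIg.
    rewrite cardE; apply/fsubset_leq_card/fsubsetP => _ /imfsetP[/= b + ->].
    rewrite !inE => /andP[bF /asboolP nb]; apply/andP; split.
      by apply/imfsetP; exists b; rewrite // zk.
    apply/asboolP; exists k; split=> //; first by exists b; rewrite // zk.
    by move=> j x jk [Uj ->]; apply: nb.
  - move=> z z' y _ _; rewrite !inE => /andP[_ /asboolP[k ky]].
    move=> /andP[_ /asboolP[k' k'y]]; have e := owns_stage ky k'y.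
    by move: ky k'y; rewrite e => -[[_ ->] _ _] [[_ ->] _ _].
set Q := [set y | _].
have QZ : m Q <= #|` (F1 `\` F0)%fset|%:R * m Z.
  apply: (@mean_transport_le _ _ _ mP (F1 `\` F0)%fset Z
    (fun x => [fset (b * x)%g | b in (F1 `\` F0)%fset]%fset)).
  - by move=> z y _ /imfsetP[/= b bF ->]; rewrite mulgK.
  - by move=> z _; rewrite card_imfset //; exact: mulIg.
  move=> y [k [x [w [xy yw nxw]]]].
  have [j [z [b [Bz b1 b0 ->]]]] := owns_bd (lmul_action _) F0F FF1 xy yw nxw.
  exists z; first by exists j.
  by apply/imfsetP; exists b => //=; apply/fsetDP; split=> //; exact/negP.
apply: (@le_trans _ _ (t * (#|` (F1 `\` F0)%fset|%:R * m Z))).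
  by rewrite ler_pM2l.
by rewrite mulrCA ler_piMr // ler0n.
Qed.

Let group_tiling_of n (t c : R) (F0 F F1 : {fset H}) : (0 < n)%N -> 0 < t ->
  (forall b g, b \in wball S (n + n) -> g \in F0 -> (b * g)%g \in F) ->
  (forall b g, b \in wball S (n + n) -> g \in F -> (b * g)%g \in F1) ->
  t / #|` F|%:R + #|` (F1 `\` F0)%fset|%:R / t + #|` wball S n|%:R^-1 <= c ->
  F != fset0 ->
  exists r D e, tiled S lmul r D e /\ m D <= (2 * (n + n)).+2%:R * c.
Proof.
move=> n0 t0 F0F FF1 le_c Fn0.
have [B [B1 mA mQ]] := ex_group_tiles t0 F0F FF1.
set A := [set y | ~ _] in mA; set Q := [set y | _] in mQ.
have [N [Nnet mN]] := ex_net n.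
pose D0 := A `|` Q `|` N.
have mD0 : m D0 <= c.
  apply: le_trans le_c; apply: le_trans (meanU_le _ _) _; apply: lerD.
    apply: le_trans (meanU_le _ _) _; apply: lerD.
      by rewrite ler_pdivlMr ?ltr0n ?cardfs_gt0 // mulrC.
    by rewrite ler_pdivlMr // mulrC.
  rewrite -div1r ler_pdivlMr // ltr0n cardfs_gt0; apply/fset0Pn.
  by exists 1%g; exact: wball1.
pose M k : set H := [set y | exists x, owns lmul F B k x y].
(* Components of cells rather than cells: a translate deprived of earlier ones may be disconnected,
   and spanning needs connected classes. Unowned points are alone in their class. *)
pose e x y := x = y \/ exists k, conn (M k) x y.
have la : is_group_action lmul by exact: lmul_action.
have M_stage j k y : M j y -> M k y -> j = k.
  by move=> [x xy] [z zy]; exact: owns_stage xy zy.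
have eM x y k : M k x -> e x y -> conn (M k) x y.
  move=> kx [<-|[j xy]]; first exact: conn_refl.
  by rewrite (M_stage _ _ _ kx (conn_fst xy)).
have er x : e x x by left.
have es x y : e x y -> e y x.
  by case=> [->|[k xy]]; [left|right; exists k; exact: conn_sym].
have et x y z : e x y -> e y z -> e x z.
  case=> [->//|[k xy]] yz; right; exists k; apply: (conn_trans xy).
  exact: eM (conn_lst xy) yz.
have [r0 Fr0] := wball_gen_fset F gS.
have e_within x y : e x y -> within (r0 + r0) x y.
  case=> [<-|[k xy]]; first exact: within_refl.
  have [u [Bu [g gF xE] _]] := conn_fst xy.
  have [v [Bv [h hF yE] _]] := conn_lst xy.
  move: yE; rewrite -(B1 _ _ _ Bu Bv) => yE.
  exists (h * g^-1)%g; last by rewrite xE yE mulgA mulgVK.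
  by rewrite wballM ?wballV // (fsubsetP Fr0).
have efin x : finite_set [set y | e x y].
  apply: (@sub_finite_set _ _ [set` [fset (b * x)%g | b in wball S (r0 + r0)]%fset]).
    by move=> y /e_within[b bn ->] /=; apply/imfsetP; exists b.
  exact: finite_fset.
have econ x : connected S lmul [set y | e x y].
  move=> y z xy xz; have [->|[k yz]] := et _ _ _ (es _ _ xy) xz.
    by apply: conn_refl.
  apply: conn_sub (conn_component la yz) => w yw.
  by apply: (et x y w xy); right; exists k.
(* A point outside [A] and [Q] has its whole ball of radius [2n] in its cell, so a path to the net
   stays in its class. *)
have dense y : exists2 z, D0 z & steps S lmul [set w | e y w] (n + n) y z.
  have [Ay|/contrapT[k [u uy]]] := pselect (A y).
    by exists y; [left; left|apply: (steps_refl S la); left].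
  have [Qy|nQ] := pselect (Q y).
    by exists y; [left; right|apply: (steps_refl S la); left].
  have own w : within (n + n) y w -> M k w.
    move=> yw; exists u; apply: contrapT => nuw; apply: nQ.
    by exists k, u, w.
  have [z Nz yz] := Nnet y; exists z; first by right.
  apply: (within_steps la yz) => w yw; right; exists k, (n + n)%N.
  exact: within_steps.
have [f [fD0 fcard fe fconn]] :=
  @span_classes H S H lmul la e D0 (n + n) er es et efin econ dense.
pose D := [set y | exists2 z, D0 z & y \in f z].
exists (r0 + r0)%N, D, e; split; last first.
  apply: (@le_trans _ _ ((2 * (n + n)).+2%:R * m D0)).
    apply: (@mean_transport_le _ _ _ mP (wball S (2 * (n + n)).+1) D0 f) => //.
    by move=> z y _ /fe[_ [b bn ->]]; rewrite mulgK.
  by rewrite ler_wpM2l.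
split=> // x y xy nxy; suff Dx : D0 x by exists x => //; exact: fD0.
have [|/contrapT[k [u ux]]] := pselect (A x); first by left; left.
left; right; exists k, u, y; split=> // [|uy].
  by apply: (@within_le _ _ _ _ 1) => [|]; [lia|exact/nb_within].
apply: nxy; right; exists k; apply: conn1 => //; first by exists u.
by exists u.
Qed.

Theorem group_tiling (d : R) :
  (forall k, exists2 n, (0 < n)%N & (k * n <= #|` wball S n|)%N) -> 0 < d ->
  exists r D e, tiled S lmul r D e /\ m D < d.
Proof.
move=> growth d0.
(* As [n] is positive, [c] below is at most [6n]; so [4c <= 24n <= d * k * n], the bound required
   for the net. *)
have [k kd] : exists k : nat, 24 / d < k%:R.
  by exists (Num.bound (24 / d)); rewrite archi_boundP // divr_ge0 // ltW.
have [n n0 kn] := growth k.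
pose c : R := (2 * (n + n)).+2%:R; have c0 : 0 < c by rewrite ltr0n.
(* Uncovered points, boundary and net get mean [d / (4 * c)] each; joining them multiplies by [c],
   for a total of [3d / 4]. With threshold [tau * |F|] and a shell of relative size [tau * tau], the
   first two bounds are both [tau]. *)
pose tau := d / (4 * c).
have c40 : 0 < 4 * c by rewrite mulr_gt0.
have tau0 : 0 < tau by rewrite divr_gt0.
have [F0 [F [F1 [Fn0 F0F FF1 _ FF]]]] :=
  mean_Folner_shells S (n + n) mP (mulr_gt0 tau0 tau0).
have F_gt0 : 0 < #|` F|%:R :> R by rewrite ltr0n cardfs_gt0.
have W0 : 0 < #|` wball S n|%:R :> R.
  by rewrite ltr0n cardfs_gt0; apply/fset0Pn; exists 1%g; exact: wball1.
have [|r [D [e [tD mD]]]] := group_tiling_of n0 (mulr_gt0 tau0 F_gt0) F0F FF1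
    (c := tau + tau + d / (4 * c)) _ Fn0.
  rewrite mulfK ?gt_eqF // lerD ?lerD2l //.
    by rewrite (ler_pdivrMr _ _ (mulr_gt0 tau0 F_gt0)) mulrA.
  rewrite -[leLHS]div1r ler_pdivrMr // mulrAC ler_pdivlMr ?mulr_gt0 // mul1r.
  have : k%:R * n%:R <= #|` wball S n|%:R :> R by rewrite -natrM ler_nat.
  have : c <= 6 * n%:R by rewrite /c -natrM ler_nat; lia.
  have : 24 * n%:R <= d * (k%:R * n%:R).
    by rewrite mulrA ler_wpM2r // mulrC -ler_pdivrMr // ltW.
  move=> h1 h2 h3; apply: (@le_trans _ _ (24 * n%:R)); first by lra.
  by apply: le_trans h1 _; rewrite ler_pM2l.
exists r, D, e; split=> //; apply: le_lt_trans mD _.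
rewrite -/c /tau.
have -> : c * (d / (4 * c) + d / (4 * c) + d / (4 * c)) = 3 * d / 4.
  by field; rewrite gt_eqF.
by lra.
Qed.

End GroupTiling.

(** * Measures and Borel cuts of small measure *)

Section SigmaAdditive.
Import numFieldNormedType.Exports.
Variables (R : realType) (d : measure_display) (X : measurableType d).
Implicit Types (f g v : set X -> R) (A E : set X).

(** Finite signed measures as bare real-valued functions: linear combinations and translates then
    need no bundled structure. *)
Definition sigma_add f := forall F : nat -> set X,
  (forall i, measurable (F i)) -> trivIset setT F ->
  (fun n => \sum_(i < n) f (F i)) @ \oo --> f (\bigcup_i F i).

Let cvg_const_tail (u : nat -> R) (k : nat) (l c : R) :
  u @ \oo --> l -> (forall n, u (n + k)%N = c) -> l = c.
Proof.
move=> ul uc; have : (fun n => u (n + k)%N) @ \oo --> l.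
  by apply: (cvg_comp _ _ _ ul); exact: cvg_addnr.
rewrite (_ : (fun n => u (n + k)%N) = cst c); last exact/funext.
by move=> cl; apply/esym; apply: (cvg_unique _ (cvg_cst c) cl).
Qed.

Lemma sigma_add0 f : sigma_add f -> f set0 = 0.
Proof.
move=> sf; have t0 : trivIset setT (fun _ : nat => set0 : set X).
  exact: trivIset_set0.
have := sf (fun=> set0) (fun=> measurable0) t0.
rewrite bigcup0 // => cv.
have cv1 : (fun n => \sum_(i < n + 1) f set0) @ \oo --> f set0.
  by apply: (cvg_comp _ _ _ cv); exact: cvg_addnr.
(* The partial sums at [set0] converge and increase by [f set0] at each step, so this increment is
   zero. *)
have cvd : (fun n => \sum_(i < n + 1) f set0 - \sum_(i < n) f set0) @ \oo -->
    f set0 - f set0 by exact: cvgB.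
rewrite -[RHS](subrr (f set0)); apply/esym; apply: (cvg_const_tail (k := 0%N) cvd) => n.
by rewrite addn0 addn1 big_ord_recr /= addrAC subrr add0r.
Qed.

Lemma sigma_addU f A E : sigma_add f -> measurable A -> measurable E ->
  A `&` E = set0 -> f (A `|` E) = f A + f E.
Proof.
move=> sf mA mE AE0; have f0 := sigma_add0 sf; rewrite -bigcup2E.
apply: (@cvg_const_tail _ 2 _ _ (sf _ _ _)).
- by move=> [|[|i]] //=; exact: measurable0.
- by rewrite -trivIset_bigcup2.
move=> n; rewrite addn2 !big_ord_recl big1 /= ?addr0 // => i _.
Qed.

Lemma sigma_add_lin f g (c : R) : sigma_add f -> sigma_add g ->
  sigma_add (fun E => f E + c * g E).
Proof.
move=> sf sg F mF tF.
rewrite (_ : (fun n => _) = (fun n => \sum_(i < n) f (F i)) \+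
    (fun n => c * \sum_(i < n) g (F i))); last first.
  by apply/funext => n /=; rewrite big_split mulr_sumr.
by apply: cvgD; [exact: sf|apply: cvgM (sg _ _ _) => //; exact: cvg_cst].
Qed.

Lemma sigma_add_sum (I : Type) (r : seq I) (h : I -> set X -> R) :
  (forall i, sigma_add (h i)) -> sigma_add (fun E => \sum_(i <- r) h i E).
Proof.
move=> sh; elim: r => [|i r IH] F mF tF.
  rewrite big_nil (_ : (fun n => _) = cst 0); first exact: cvg_cst.
  by apply/funext => n; rewrite big1 // => i _; rewrite big_nil.
rewrite (_ : (fun n => _) = (fun n => \sum_(k < n) (h i (F k) +
    1 * \sum_(j <- r) h j (F k)))); last first.
  by apply/funext => n; apply: eq_bigr => k _; rewrite big_cons mul1r.
by rewrite big_cons -[X in _ + X]mul1r; exact: (sigma_add_lin (sh i) IH).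
Qed.

Lemma sigma_add_comp f (A : set X) (h : X -> X) : sigma_add f ->
  measurable A -> measurable_fun setT h ->
  sigma_add (fun E => f (A `&` h @^-1` E)).
Proof.
move=> sf mA mh F mF tF; rewrite preimage_bigcup setI_bigcupr.
apply: (sf (fun i => A `&` h @^-1` F i)) => [i|].
  by apply: measurableI => //; rewrite -[X in measurable X]setTI; exact: mh.
apply/trivIsetP => i j _ _ ij; rewrite setIACA -preimage_setI.
by move/trivIsetP: tF => /(_ i j I I ij) ->; rewrite preimage_set0 setI0.
Qed.

Lemma sigma_add_Hahn f : sigma_add f -> exists2 N, measurable N &
  (forall E, measurable E -> E `<=` N -> f E <= 0) /\
  (forall E, measurable E -> E `<=` ~` N -> 0 <= f E).
Proof.
move=> sf; pose nu (E : set X) : \bar R := (f E)%:E.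
have nu0 : nu set0 = 0%E by rewrite /nu sigma_add0.
have nufin E : measurable E -> nu E \is a fin_num by [].
have nus : semi_sigma_additive nu.
  move=> F mF tF _; rewrite (_ : (fun n => _) = EFin \o (fun n => \sum_(i < n) f (F i))).
    by apply: cvg_EFin; [exact: nearW|exact: sf].
  by apply/funext => n; rewrite /= sumEFin big_mkord.
pose nuC := isCharge.Build _ _ _ nu nu0 nufin nus.
pose nuc : {charge set X -> \bar R} := HB.pack nu nuC.
have [P [N [[mP posP] [mN negN] PN _]]] := Hahn_decomposition nuc.
exists N => //; split=> E mE EN.
  by have := negN _ mE EN; rewrite lee_fin.
rewrite -lee_fin; apply: posP => // x Ex.
by have : (P `|` N) x; [rewrite PN|case=> // /(EN _ Ex)].
Qed.

Record fin_measure v : Prop := FinMeasure {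
  fin_measure_ge0 : forall E, measurable E -> 0 <= v E ;
  fin_measure_sigma : sigma_add v }.

Lemma fin_measure_fine (nu : {finite_measure set X -> \bar R}) :
  fin_measure (fun E => fine (nu E)).
Proof.
split=> [E _|F mF tF]; first exact/fine_ge0/measure_ge0.
have fin E : measurable E -> nu E \is a fin_num by exact: fin_num_measure.
have mU := bigcup_measurable (fun i (_ : setT i) => mF i).
rewrite (_ : (fun n => _) = fine \o (fun n => (\sum_(0 <= i < n) nu (F i))%E)).
  apply: fine_cvg; rewrite fineK ?fin //.
  exact: measure_semi_sigma_additive.
apply/funext => n /=; rewrite big_mkord sum_fine //.
by move=> i _; exact: fin.
Qed.

Variables (v : set X -> R).
Hypothesis mv : fin_measure v.

Lemma fin_measure_content : is_content (measurable : set (set X)) v.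
Proof.
split=> [||A|A|A E mA mE]; [exact: measurableT|exact: measurableI|
  exact: measurableC|exact: fin_measure_ge0 mv A|].
exact: sigma_addU (fin_measure_sigma mv) mA mE.
Qed.

Lemma fin_measure_le A E : measurable A -> measurable E -> A `<=` E ->
  v A <= v E.
Proof.
move=> mA mE AE; have := @content_le R X _ v fin_measure_content _ _ [:: tt] [:: tt]
  (fun=> A) (fun=> E) (fun=> 1) (fun=> 1).
rewrite !big_seq1 !mul1r; apply=> // x; rewrite !big_seq1 !mul1r.
have [Ax|nA] := pselect (A x); last by rewrite (indF _ nA) ind_ge0.
by rewrite !indT //; exact: AE.
Qed.

Lemma fin_measure_bigcup_le (E : nat -> set X) (L : R) :
  (forall k, measurable (E k)) -> (forall n, \sum_(k < n) v (E k) <= L) ->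
  v (\bigcup_k E k) <= L.
Proof.
move=> mE EL; rewrite seqDU_bigcup_eq.
have cv := fin_measure_sigma mv (seqDU_measurable mE) (trivIset_seqDU E).
rewrite -(cvg_lim (@norm_hausdorff _ _) cv); apply: limr_le.
  by apply/cvg_ex; exists (v (\bigcup_i seqDU E i)).
apply: nearW => n; apply: le_trans (EL n); apply: ler_sum => i _.
by apply: fin_measure_le => //; [exact: seqDU_measurable|exact: subset_seqDU].
Qed.

End SigmaAdditive.

(** * Measurability of sets defined by countable formulas *)

Section MeasurableSets.
Variables (d : measure_display) (X : measurableType d).

Lemma measurable_not (P : set X) : measurable P -> measurable [set x | ~ P x].
Proof. exact: measurableC. Qed.

Lemma measurable_and (P Q : set X) : measurable P -> measurable Q ->
  measurable [set x | P x /\ Q x].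
Proof. exact: measurableI. Qed.

Lemma measurable_const (Q : Prop) : measurable [set _ : X | Q].
Proof.
have [q|nq] := pselect Q.
  by rewrite (_ : [set _ | _] = setT) //; apply/seteqP; split.
by rewrite (_ : [set _ | _] = set0) //; apply/seteqP; split.
Qed.

Lemma measurable_ex_nat (P : nat -> set X) : (forall n, measurable (P n)) ->
  measurable [set x | exists n, P n x].
Proof.
move=> mP; rewrite (_ : [set x | _] = \bigcup_n P n); first exact: bigcupT_measurable.
by apply/seteqP; split=> x [n]; [move=> Pn|move=> _ Pn]; exists n.
Qed.

Lemma measurable_all_nat (P : nat -> set X) : (forall n, measurable (P n)) ->
  measurable [set x | forall n, P n x].
Proof.
move=> mP; rewrite (_ : [set x | _] = ~` [set x | exists n, ~ P n x]).
  by apply: measurableC; apply: measurable_ex_nat => n; exact: measurable_not.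
apply/seteqP; split=> x /= Px.
  by move=> [n nPn]; exact/nPn/Px.
by move=> n; apply: contrapT => Pn; apply: Px; exists n.
Qed.

Lemma measurable_ex_seq (I : eqType) (s : seq I) (P : I -> set X) :
  (forall i, measurable (P i)) -> measurable [set x | exists2 i, i \in s & P i x].
Proof.
move=> mP; elim: s => [|i s IH].
  by rewrite (_ : [set x | _] = set0) //; apply/seteqP; split=> x // -[].
rewrite (_ : [set x | _] = P i `|` [set x | exists2 i, i \in s & P i x]).
  exact: measurableU.
apply/seteqP; split=> x /=.
  by move=> [j]; rewrite in_cons => /orP[/eqP ->|js] Pj; [left|right; exists j].
move=> [Pi|[j js Pj]]; [exists i => //|exists j => //].
  by rewrite inE eqxx.
by rewrite inE js orbT.
Qed.

Lemma measurable_all_seq (I : eqType) (s : seq I) (P : I -> set X) :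
  (forall i, measurable (P i)) -> measurable [set x | forall i, i \in s -> P i x].
Proof.
move=> mP; rewrite (_ : [set x | _] = ~` [set x | exists2 i, i \in s & ~ P i x]).
  by apply: measurableC; apply: measurable_ex_seq => i; exact: measurable_not.
apply/seteqP; split=> x /= Px.
  by move=> [i si nPi]; exact/nPi/Px.
by move=> i si; apply: contrapT => nPi; apply: Px; exists i.
Qed.

(** The form in which Polishness enters: equality of points is decided by countably many measurable
    sets. *)
Definition separating (O : nat -> set X) : Prop :=
  (forall n, measurable (O n)) /\
  forall x y, (forall n, O n x <-> O n y) -> x = y.

End MeasurableSets.

Lemma sum_ind_le1 (R : realType) (T : Type) (I : eqType) (r : seq I)
    (A : I -> set T) (x : T) : uniq r ->
  (forall i j, i \in r -> j \in r -> A i x -> A j x -> i = j) ->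
  \sum_(i <- r) 1 * ind R (A i) x <= 1.
Proof.
move=> ur A1; have [[i [ir Ai]]|nA] := pselect (exists i, i \in r /\ A i x).
  rewrite (bigD1_seq i) //= big1_seq ?addr0 ?mul1r ?ind_le1 // => j /andP[ji jr].
  rewrite mul1r indF // => Aj; move/eqP: ji; apply; exact: A1.
rewrite big1_seq ?ler01 // => i /= ir; rewrite mul1r indF // => Ai.
by apply: nA; exists i.
Qed.

Lemma sum_ind_ge (R : realType) (T : Type) (I : eqType) (r : seq I)
    (A : I -> set T) (x : T) (i : I) : i \in r -> A i x ->
  1 <= \sum_(j <- r) 1 * ind R (A j) x.
Proof.
move=> + Ai; elim: r => // j r IH; rewrite inE big_cons => /orP[/eqP <-|/IH].
  rewrite indT // mulr1 lerDl sumr_ge0 // => k _.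
  by rewrite mul1r ind_ge0.
by move=> h; apply: le_trans h _; rewrite lerDr mul1r ind_ge0.
Qed.

Lemma conn_map (H : groupType) (S : {fset H}) (X Y : Type) (a : H -> X -> X)
    (b : H -> Y -> Y) (p : X -> Y) (A : set X) (B : set Y) x y :
  is_group_action a -> (forall g z, p (a g z) = b g (p z)) ->
  (forall z, A z -> B (p z)) -> conn S a A x y -> conn S b B (p x) (p y).
Proof.
move=> aP pab AB; move: y; apply: (conn_ind aP) => [/AB Bx|y z _ IH [s sS ->] /AB Bz].
  exact: conn_refl.
by apply: conn_step IH _ Bz; exists s; rewrite ?pab.
Qed.

Section FreeActions.
Variables (d : measure_display) (X : measurableType d) (H : groupType).
Variables (a : H -> X -> X) (O : nat -> set X).
Hypothesis hact : is_group_action a.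
Hypothesis hfree : is_free a.
Hypothesis ma : is_borel_action a.
Hypothesis sepO : separating O.

Lemma free_inj g h x : a g x = a h x -> g = h.
Proof.
move=> /(congr1 (a h^-1%g)); rewrite (actK hact) -(actM hact) => /hfree e.
by apply: (mulgI h^-1%g); rewrite e mulVg.
Qed.

Lemma measurable_act g (A : set X) : measurable A -> measurable [set x | A (a g x)].
Proof.
move=> mA; have := ma g measurableT mA.
by rewrite setTI.
Qed.

(** A colour is a finite box of sets [O n] and complements, restricted to the points whose
    translates by nontrivial elements of [F^-1 F] avoid the box. Every point gets one, since by
    freeness some [O n] separates it from each of these translates. *)
Lemma independent_cover (F : {fset H}) : exists Y : nat -> set X,
  [/\ (forall c, measurable (Y c)), (forall x, exists c, Y c x) &
      (forall c x z g h, Y c x -> Y c z -> g \in F -> h \in F ->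
        a g x = a h z -> x = z)].
Proof.
have [mO sO] := sepO.
pose lit (p : nat * bool) : set X := if p.2 then O p.1 else ~` O p.1.
have mlit p : measurable (lit p).
  by rewrite /lit; case: p.2; [exact: mO|exact/measurableC/mO].
pose box (l : seq (nat * bool)) : set X := [set x | forall p, p \in l -> lit p x].
pose G := fmul [fset g^-1%g | g in F]%fset F.
pose Y l : set X := [set x | box l x /\
  forall g, g \in [seq g <- enum_fset G | g != 1%g] -> ~ box l (a g x)].
have mbox l : measurable (box l) by exact: measurable_all_seq.
have mY l : measurable (Y l).
  apply: measurable_and => //; apply: measurable_all_seq => g.
  by apply: measurable_not; exact: measurable_act.
exists (fun c => if @choice.unpickle (seq (nat * bool)) c is Some l then Y l else set0).
split=> [c|x|c x z g h].
- by case: choice.unpickle => [l|]; [exact: mY|exact: measurable0].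
- have /choice[n nP] g : exists n, g != 1%g -> ~ (O n x <-> O n (a g x)).
    have [->|g1] := eqVneq g 1%g; first by exists 0%N.
    have /existsNP[n nP] : ~ forall n, O n x <-> O n (a g x).
      by move=> /sO xg; move/eqP: g1; apply; exact: (hfree (esym xg)).
    by exists n.
  pose l := [seq (n g, `[< O (n g) x >]) | g <- [seq g <- enum_fset G | g != 1%g]].
  exists (choice.pickle l); rewrite choice.pickleK; split.
    by move=> p /mapP[g _ ->]; rewrite /lit /=; case: ifP => /asboolP.
  move=> g gG /(_ (n g, `[< O (n g) x >])); rewrite map_f // => /(_ isT).
  rewrite mem_filter in gG; have /andP[g1 _] := gG.
  have := nP g g1; rewrite /lit /=; case: ifP => /asboolP Ox h1 h2; apply: h1.
    by split.
  by split=> // /h2.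
case: choice.unpickle => // l [bx nx] [bz _] gF hF e.
have zE : z = a (h^-1 * g)%g x by rewrite (actM hact) e (actK hact).
have [e1|n1] := eqVneq (h^-1 * g)%g 1%g; first by rewrite zE e1 (act1 hact).
exfalso; apply: (nx (h^-1 * g)%g); last by rewrite -zE.
rewrite mem_filter n1 /=; apply/fmulP; exists h^-1%g, g; split=> //.
by apply/imfsetP; exists h.
Qed.

End FreeActions.

(** * Greedy covering of the space by tiles *)

Section KeyCut.
Import numFieldNormedType.Exports.
Variables (R : realType) (d : measure_display) (X : measurableType d).
Variables (v : set X -> R) (H : groupType) (a : H -> X -> X).
Hypothesis mv : fin_measure v.
Hypothesis hact : is_group_action a.
Hypothesis hfree : is_free a.
Hypothesis ma : is_borel_action a.

Let tr g (E : set X) : set X := [set p | E (a g^-1%g p)].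

Let mtr g E : measurable E -> measurable (tr g E).
Proof. exact: measurable_act. Qed.

Let tr_act g E x : tr g E (a g x) = E x.
Proof. by rewrite /tr /= (actK hact). Qed.

Let trP g E p : tr g E p -> exists2 x, E x & p = a g x.
Proof. by move=> Ep; exists (a g^-1%g p) => //; rewrite (actVK hact). Qed.

Let v_content := fin_measure_content mv.

Section Stages.
Variables (F D : {fset H}) (k : R).

(** A signed measure in the set [E] of centres: the boundaries of the tiles against [k] times their
    parts in [A]. The set [D] will be the shell between [F0] and [F1]. *)
Let gap A E : R :=
  \sum_(g <- D) v (tr g E) + (- k) * \sum_(g <- F) v (A `&` tr g E).

Let gap_sigma A : measurable A -> sigma_add (gap A).
Proof.
move=> mA; apply: sigma_add_lin; apply: sigma_add_sum => g; last first.
  exact: sigma_add_comp (fin_measure_sigma mv) mA (ma g^-1%g).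
have := @sigma_add_comp _ _ _ v setT (a g^-1%g) (fin_measure_sigma mv)
  measurableT (ma _).
rewrite (_ : (fun E => _) = (fun E => v (tr g E))) //.
by apply/funext => E; rewrite setTI.
Qed.

Definition before (B : nat -> set X) c : set X :=
  [set p | forall j, (j < c)%N -> forall g, g \in F -> ~ tr g (B j) p].

Lemma measurable_before B c : (forall j, measurable (B j)) -> measurable (before B c).
Proof.
move=> mB; apply: (@measurable_all_nat _ _
  (fun j => [set p | (j < c)%N -> forall g, g \in F -> ~ tr g (B j) p])) => j.
have [jc|nj] := boolP (j < c)%N; last first.
  by rewrite (_ : [set p | _] = setT) //; apply/seteqP; split.
rewrite (_ : [set p | _] = [set p | forall g, g \in F -> ~ tr g (B j) p]).
  apply: (@measurable_all_seq _ _ _ _ (fun g => [set p | ~ tr g (B j) p])) => g.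
  by apply: measurable_not; exact: mtr.
by apply/seteqP; split=> p /= h; [exact: h isT|move=> _; exact: h].
Qed.

(** [B c] is the negative part of [gap (before B c)] in [Y c]. On [B c] the boundary is paid for by
    the points newly covered; elsewhere the newly covered points are few compared with the boundary,
    which bounds what stays uncovered. *)
Lemma ex_stages (Y : nat -> set X) : (forall c, measurable (Y c)) ->
  exists B : nat -> set X, forall c, [/\ measurable (B c), B c `<=` Y c,
    \sum_(g <- D) v (tr g (B c)) <=
      k * \sum_(g <- F) v (before B c `&` tr g (B c)) &
    forall E, measurable E -> E `<=` Y c -> E `<=` ~` B c ->
      k * \sum_(g <- F) v (before B c `&` tr g E) <= \sum_(g <- D) v (tr g E)].
Proof.
move=> mY; pose st (s : seq (set X)) := nth set0 s.
have [|B BP] := @dependent_sequence (set X) (fun c s E =>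
    (forall j, measurable (st s j)) ->
    [/\ measurable E, E `<=` Y c, gap (before (st s) c) E <= 0 &
    forall E', measurable E' -> E' `<=` Y c -> E' `<=` ~` E ->
      0 <= gap (before (st s) c) E']).
  move=> c s; have [ms|?] := pselect (forall j, measurable (st s j)); last by exists set0.
  have [N mN [negN posN]] := sigma_add_Hahn (gap_sigma (measurable_before c ms)).
  exists (N `&` Y c) => _; split.
  - exact: measurableI.
  - by move=> x [].
  - by apply: negN => [|x []]; first exact: measurableI.
  - move=> E mE EY EN; apply: posN => // x Ex Nx; apply: (EN x Ex).
    by split=> //; exact: EY.
have stE c j : st (mkseq B c) j = if (j < c)%N then B j else set0.
  case: ltnP => jc; first by rewrite /st nth_mkseq.
  by rewrite /st nth_default // size_mkseq.
have mB c : measurable (B c).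
  elim/ltn_ind: c => c IH; suff mst : forall j, measurable (st (mkseq B c) j).
    by have [] := BP c mst.
  by move=> j; rewrite stE; case: ifP => // /IH.
have befE c : before (st (mkseq B c)) c = before B c.
  by apply/seteqP; split=> p h j jc; have := h j jc; rewrite stE jc.
exists B => c; have [|_ BY neg pos] := BP c.
  by move=> j; rewrite stE; case: ifP.
move: neg pos; rewrite befE => neg pos; split=> //.
  by rewrite -subr_le0 -mulNr.
by move=> E mE EY EB; rewrite -subr_ge0 -mulNr; exact: pos.
Qed.

Variables (Y B : nat -> set X).
Hypothesis Ycover : forall x, exists c, Y c x.
Hypothesis Yind : forall c x z g h, Y c x -> Y c z -> g \in F -> h \in F ->
  a g x = a h z -> x = z.
Hypothesis mY : forall c, measurable (Y c).
Hypothesis mB : forall c, measurable (B c).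
Hypothesis BY : forall c, B c `<=` Y c.
Hypothesis Bneg : forall c, \sum_(g <- D) v (tr g (B c)) <=
  k * \sum_(g <- F) v (before B c `&` tr g (B c)).
Hypothesis Bpos : forall c E, measurable E -> E `<=` Y c -> E `<=` ~` B c ->
  k * \sum_(g <- F) v (before B c `&` tr g E) <= \sum_(g <- D) v (tr g E).
Hypothesis k0 : 0 <= k.

Let mbef c : measurable (before B c). Proof. exact: measurable_before. Qed.

Definition uncovered : set X := [set p | forall c, before B c p].

Let muncov : measurable uncovered.
Proof. by apply: measurable_all_nat => c; exact: mbef. Qed.

(** The new parts are disjoint: [before] separates the stages, [Yind] the centres of a stage,
    freeness the positions in a tile. *)
Lemma sum_stages n :
  \sum_(c < n) \sum_(g <- F) v (before B c `&` tr g (B c)) <= v setT.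
Proof.
rewrite -(big_mkord xpredT (fun c => \sum_(g <- F) v (before B c `&` tr g (B c)))) /=.
pose r := [seq (c, g) | c <- index_iota 0 n, g <- enum_fset F].
pose E (p : nat * H) := before B p.1 `&` tr p.2 (B p.1).
have mE p : measurable (E p) by apply: measurableI; [exact: mbef|exact: mtr].
have -> : \sum_(0 <= c < n) \sum_(g <- F) v (before B c `&` tr g (B c)) =
    \sum_(p <- r) 1 * v (E p).
  rewrite big_allpairs; apply: eq_bigr => c _; apply: eq_bigr => g _.
  by rewrite mul1r.
have := @content_le R X _ v v_content _ _ r [:: tt] E (fun=> setT) (fun=> 1) (fun=> 1).
rewrite big_seq1 mul1r; apply=> // x.
rewrite big_seq1 indT // mulr1; apply: sum_ind_le1.
  by rewrite allpairs_uniq ?iota_uniq // => -[? ?] [].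
move=> [? ?] [? ?] /allpairsPdep[c [g [_ gF [-> ->]]]].
move=> /allpairsPdep[c' [g' [_ g'F [-> ->]]]] [/= cx gx] [/= cx' gx'].
have e : c = c'.
  case: (ltngtP c c') => // [cc'|c'c].
    by case: (cx' c cc' g gF).
  by case: (cx c' c'c g' g'F).
move: gx' {cx cx'}; rewrite -e => gx'.
have [y By xy] := trP gx; have [y' By' xy'] := trP gx'.
have yy' : y = y'.
  by apply: (Yind (BY By) (BY By') gF g'F); rewrite -xy -xy'.
by move: xy'; rewrite xy -yy' => /(free_inj hact hfree) ->.
Qed.

(** [gap uncovered] is nonnegative on each [Y c]: within [B c] its second term vanishes, as tiles
    miss [uncovered]; off [B c] it is at least [gap (before B c)]. Summed over a partition
    subordinate to [Y], it is nonnegative at [setT]. *)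
Lemma measure_uncovered : k * #|` F|%:R * v uncovered <= #|` D|%:R * v setT.
Proof.
have gap_ge0 c E : measurable E -> E `<=` Y c -> 0 <= gap uncovered E.
  move=> mE EY; have sg := gap_sigma muncov.
  have -> : E = (E `&` B c) `|` (E `\` B c) by rewrite -setIUr setUv setIT.
  have mEB : measurable (E `&` B c) by exact: measurableI.
  have mED : measurable (E `\` B c) by exact: measurableD.
  rewrite (sigma_addU sg) //; last by rewrite setDE setIACA setICr setI0.
  have g1 : 0 <= gap uncovered (E `&` B c).
    rewrite /gap [X in _ * X]big1_seq ?mulr0 ?addr0.
      by apply: sumr_ge0 => g _; apply: (fin_measure_ge0 mv); exact: mtr.
    move=> g /= gF; rewrite (_ : _ `&` _ = set0).
      exact: sigma_add0 (fin_measure_sigma mv).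
    by rewrite -subset0 => p [/(_ c.+1)/(_ c (ltnSn c) g gF) nBp [_ Bp]].
  have g2 : 0 <= gap uncovered (E `\` B c).
    rewrite /gap mulNr subr_ge0; apply: le_trans (Bpos mED _ _).
    - apply: ler_wpM2l => //; apply: ler_sum => g _; apply: (fin_measure_le mv).
      + by apply: measurableI => //; exact: mtr.
      + by apply: measurableI => //; exact: mtr.
      + by move=> p [up Ep]; split.
    - by move=> x [Ex _]; exact: EY.
    - by move=> x [_ nBx].
  by rewrite addr_ge0.
have gapT : 0 <= gap uncovered setT.
  have YT : setT = \bigcup_c seqDU Y c.
    rewrite -seqDU_bigcup_eq; apply/seteqP; split=> // x _.
    by have [c] := Ycover x; exists c.
  rewrite YT; have cv := gap_sigma muncov (seqDU_measurable mY) (trivIset_seqDU Y).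
  rewrite -(cvg_lim (@norm_hausdorff _ _) cv); apply: limr_ge.
    by apply/cvg_ex; exists (gap uncovered (\bigcup_i seqDU Y i)).
  apply: nearW => n; apply: sumr_ge0 => i _; apply: (gap_ge0 i); last exact: subset_seqDU.
  exact: seqDU_measurable.
have trT g : tr g setT = setT by [].
have sumC (G : {fset H}) (c : R) : \sum_(g <- G) c = #|` G|%:R * c.
  by rewrite card_fset_sum1 natr_sum mulr_suml; apply: eq_bigr => g _; rewrite mul1r.
have gapE : gap uncovered setT = #|` D|%:R * v setT - k * (#|` F|%:R * v uncovered).
  rewrite /gap -!sumC mulNr.
  by congr (_ - _ * _); apply: eq_bigr => g _; rewrite trT ?setIT.
by rewrite -mulrA -subr_ge0 -gapE.
Qed.

End Stages.

End KeyCut.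

(** * Copying the pattern of the group into the tiles *)

Section KeyCutTheorem.
Variables (R : realType) (d : measure_display) (X : measurableType d).
Variables (v : set X -> R) (H : groupType) (S : {fset H}) (a : H -> X -> X).
Variables (O : nat -> set X) (m : set H -> R).
Hypothesis mv : fin_measure v.
Hypothesis hact : is_group_action a.
Hypothesis hfree : is_free a.
Hypothesis ma : is_borel_action a.
Hypothesis sepO : separating O.
Hypothesis gS : generates S.
Hypothesis mP : is_mean m.

Let tr g (E : set X) : set X := [set p | E (a g^-1%g p)].

Let mtr g E : measurable E -> measurable (tr g E).
Proof. exact: measurable_act. Qed.

Let tr_act g E x : tr g E (a g x) = E x.
Proof. by rewrite /tr /= (actK hact). Qed.

Let trP g E p : tr g E p -> exists2 x, E x & p = a g x.
Proof. by move=> Ep; exists (a g^-1%g p) => //; rewrite (actVK hact). Qed.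

Let v_content := fin_measure_content mv.

Lemma measure_ex_seq_le (I : eqType) (s : seq I) (E : I -> set X) :
  (forall i, measurable (E i)) ->
  v [set p | exists2 i, i \in s & E i p] <= \sum_(i <- s) v (E i).
Proof.
move=> mE; have mU : measurable [set p | exists2 i, i \in s & E i p].
  exact: measurable_ex_seq.
have := @content_le R X _ v v_content _ _ [:: tt] s
  (fun=> [set p | exists2 i, i \in s & E i p]) E (fun=> 1) (fun=> 1).
have -> : \sum_(i <- s) v (E i) = \sum_(i <- s) 1 * v (E i).
  by apply: eq_bigr => i _; rewrite mul1r.
rewrite big_seq1 mul1r; apply=> // p; rewrite big_seq1 mul1r.
have [[i si Ei]|nE] := pselect (exists2 i, i \in s & E i p).
  by rewrite indT; [exact: sum_ind_ge Ei|exists i].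
by rewrite indF // sumr_ge0 // => i _; rewrite mul1r ind_ge0.
Qed.

Lemma measureU_le A B : measurable A -> measurable B -> v (A `|` B) <= v A + v B.
Proof.
move=> mA mB; pose AB (b : bool) := if b then A else B.
have -> : A `|` B = [set p | exists2 b, b \in [:: true; false] & AB b p].
  apply/seteqP; split=> p /=; first by move=> [Ap|Bp]; [exists true|exists false].
  by move=> [[] _]; [left|right].
apply: le_trans (@measure_ex_seq_le bool [:: true; false] AB _) _; first by case.
by rewrite !big_cons big_nil addr0.
Qed.

Section Assemble.
Variables (r : nat) (D : set H) (e : H -> H -> Prop) (dl k : R).
Variables (F0 F F1 : {fset H}) (Y B : nat -> set X) (yc : nat -> {fset H} -> H).
Hypothesis tD : tiled S (fun s h : H => (s * h)%g) r D e.
Hypothesis F0F : forall b g, b \in wball S r -> g \in F0 -> (b * g)%g \in F.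
Hypothesis FF1 : forall b g, b \in wball S r -> g \in F -> (b * g)%g \in F1.
Hypothesis Yind : forall c x z g h, Y c x -> Y c z -> g \in F -> h \in F ->
  a g x = a h z -> x = z.
Hypothesis mB : forall c, measurable (B c).
Hypothesis BY : forall c, B c `<=` Y c.
Hypothesis dl0 : 0 <= dl.
Hypothesis k0 : 0 <= k.

Let bef c := before a F B c.

Let mbef c : measurable (bef c). Proof. exact: measurable_before. Qed.

(** Centres are sorted by the shape [L] of the new part of their tile. One translate of the pattern
    is chosen for each of the finitely many shapes of a stage, so the copied cut is Borel. *)
Definition tile_shape c (L : {fset H}) : set X :=
  [set x | B c x /\ forall g, g \in F -> (bef c (a g x) <-> g \in L)].

Lemma measurable_tile_shape c L : measurable (tile_shape c L).
Proof.
apply: measurable_and => //.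
apply: (@measurable_all_seq _ _ _ _ (fun g => [set x | bef c (a g x) <-> g \in L])) => g.
have [gL|gL] := boolP (g \in L).
  rewrite (_ : [set x | _] = [set x | bef c (a g x)]); first exact: measurable_act.
  by apply/seteqP; split=> x /= h; [apply/h|].
rewrite (_ : [set x | _] = [set x | ~ bef c (a g x)]).
  by apply: measurable_not; exact: measurable_act.
by apply/seteqP; split=> x /= h; [move=> /h|].
Qed.

Hypothesis ycP : forall c (L : {fset H}),
  \sum_(g <- L) v (tr g (tile_shape c L)) * ind R D (g * yc c L)%g <=
  dl * \sum_(g <- L) v (tr g (tile_shape c L)).

(* [p] lies, at the position [u] of the pattern of the group, in a copy of a
   whole class of the pattern inside the tile of centre [x]. *)
Definition placed c L x u p := [/\ (L `<=` F)%fset, tile_shape c L x,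
  (forall h, e u h -> (h * (yc c L)^-1)%g \in L) & p = a (u * (yc c L)^-1)%g x].

Let owns_bef c x p : B c x -> bef c p -> covers a F x p -> owns a F B c x p.
Proof.
move=> Bx cp xp; split=> // j z jc Bz [g gF pE].
by apply: (cp j jc g gF); rewrite pE /= (actK hact).
Qed.

Let bef_owns c x p : owns a F B c x p -> bef c p.
Proof.
move=> [_ _ first] j jc g gF Bp; apply: (first j (a g^-1%g p) jc Bp).
by exists g => //; rewrite (actVK hact).
Qed.

Let placed_owns c L x u p : placed c L x u p -> owns a F B c x p.
Proof.
case=> LF [Bx xL] uL ->; have gL := uL u (tiled_refl tD u).
have gF := fsubsetP LF _ gL.
by apply: owns_bef => //; [exact/xL|exists (u * (yc c L)^-1)%g].
Qed.

Let owns_centre c x z p : owns a F B c x p -> owns a F B c z p -> x = z.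
Proof.
move=> [Bx [g gF pg] _] [Bz [h hF ph] _].
by apply: (Yind (BY Bx) (BY Bz) gF hF); rewrite -pg -ph.
Qed.

Let placed_uniq c L x u c' L' x' u' p :
  placed c L x u p -> placed c' L' x' u' p -> [/\ c = c', L = L', x = x' & u = u'].
Proof.
move=> pp pp'; have o := placed_owns pp; have o' := placed_owns pp'.
have ec := owns_stage o o'; move: o' pp'; rewrite -ec => o' pp'.
have ex := owns_centre o o'; move: o' pp'; rewrite -ex => o' pp'.
case: pp pp' => LF [Bx xL] _ pE [L'F [_ xL'] _ pE'].
have eL : L = L'.
  apply/fsetP => g; apply/idP/idP => gL.
    by have gF := fsubsetP LF _ gL; apply/(xL' _ gF)/(xL _ gF).
  by have gF := fsubsetP L'F _ gL; apply/(xL _ gF)/(xL' _ gF).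
split=> //; apply: (@mulIg _ (yc c L)^-1%g); apply: (free_inj hact hfree (x := x)).
by rewrite -pE pE' eL.
Qed.

Let placed_class c L x u w p : placed c L x u p -> e u w ->
  placed c L x w (a (w * (yc c L)^-1)%g x).
Proof.
move=> [LF xL uL _] uw; split=> // h wh; apply: uL.
exact: tiled_trans tD _ _ _ uw wh.
Qed.

Definition placed_rel p q :=
  p = q \/ exists c L x u w, [/\ placed c L x u p, placed c L x w q & e u w].

(** The default is to be cut: a point in no whole copied class is in the cut and alone in its
    class. *)
Definition placed_cut : set X :=
  [set p | ~ exists c L x u, placed c L x u p /\ ~ D u].

Lemma placed_cut_D c L x u p : placed_cut p -> placed c L x u p -> D u.
Proof. by move=> Pp pp; apply: contrapT => nD; apply: Pp; exists c, L, x, u. Qed.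

Lemma placed_tiled : tiled S a r placed_cut placed_rel.
Proof.
split=> [p|p q|p q s|p q|p q|p q].
- by left.
- move=> [->|[c [L [x [u [w [pp pq uw]]]]]]]; [by left|right].
  by exists c, L, x, w, u; split=> //; exact: tiled_sym tD _ _ uw.
- move=> [->//|[c [L [x [u [w [pp pq uw]]]]]]].
  move=> [<-|[c' [L' [x' [u' [w' [pq' ps uw']]]]]]]; right.
    by exists c, L, x, u, w.
  have [ec eL ex ew] := placed_uniq pq pq'.
  move: ps uw'; rewrite -ec -eL -ex -ew => ps uw'.
  by exists c, L, x, u, w'; split=> //; exact: tiled_trans tD _ _ _ uw uw'.
- move=> [<-|[c [L [x [u [w [[_ _ _ ->] [_ _ _ ->] uw]]]]]]].
    exact: within_refl.
  have [b bn ->] := tiled_within tD uw; exists b => //.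
  by rewrite -(actM hact) mulgA.
- move=> [<-|[c [L [x [u [w [pp pq uw]]]]]]] Pp Pq.
    by apply: conn_refl; split=> //; left.
  have Du := placed_cut_D Pp pp; have Dw := placed_cut_D Pq pq.
  have -> : p = a (u * (yc c L)^-1)%g x by case: pp.
  have -> : q = a (w * (yc c L)^-1)%g x by case: pq.
  apply: (conn_map (p := fun z => a (z * (yc c L)^-1)%g x) (lmul_action H) _ _
    (tiled_conn tD uw Du Dw)) => [g z|z [uz Dz]].
    by rewrite -(actM hact) mulgA.
  have pz := placed_class pp uz; split.
    right; exists c, L, x, u, z; split=> //.
    by case: pp => ? ? ? _; split.
  move=> [c' [L' [x' [u' [pz' nD]]]]].
  by have [_ _ _ eu] := placed_uniq pz pz'; apply: nD; rewrite -eu.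
move=> [s sS qE] npq [c [L [x [u [pp nD]]]]].
have pE : p = a (u * (yc c L)^-1)%g x by case: pp.
have [esu|nesu] := pselect (e u (s * u)%g); last first.
  by apply: nD; apply: (tiled_bd tD _ nesu); exists s.
apply: npq; right; exists c, L, x, u, (s * u)%g; split=> //.
by rewrite qE pE -(actM hact) mulgA; exact: placed_class pp esu.
Qed.

Lemma measurable_placed_cut : measurable placed_cut.
Proof.
apply: (@measurable_not _ _ [set p | exists c L x u, placed c L x u p /\ ~ D u]).
(* The conditions on [e] and [D] do not mention [p], so they count as constants for
   measurability. *)
pose E c (L : {fset H}) g : set X := [set p | ((forall h, e (g * yc c L)%g h ->
  (h * (yc c L)^-1)%g \in L) /\ ~ D (g * yc c L)%g) /\ tr g (tile_shape c L) p].
have mE c L g : measurable (E c L g).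
  apply: measurable_and; first exact: measurable_const.
  exact/mtr/measurable_tile_shape.
rewrite (_ : [set p | _] = [set p | exists c, exists2 L, L \in enum_fset (fpowerset F) &
    exists2 g, g \in enum_fset L & E c L g p]).
  apply: (@measurable_ex_nat _ _ (fun c => [set p | exists2 L,
    L \in enum_fset (fpowerset F) & exists2 g, g \in enum_fset L & E c L g p])) => c.
  apply: (@measurable_ex_seq _ _ _ (enum_fset (fpowerset F)) (fun L : {fset H} =>
    [set p | exists2 g, g \in enum_fset L & E c L g p])) => L.
  exact: (@measurable_ex_seq _ _ _ (enum_fset L) (E c L)).
apply/seteqP; split=> p /=.
  move=> [c [L [x [u [[LF xL uL pE] nD]]]]]; exists c, L.
    by rewrite fpowersetE.
  exists (u * (yc c L)^-1)%g; first exact: uL (tiled_refl tD u).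
  by rewrite /E /= mulgVK; split=> //; rewrite pE tr_act.
move=> [c [L]]; rewrite fpowersetE => LF [g gL [[uL nD] /trP[x xL pE]]].
exists c, L, x, (g * yc c L)%g; split=> //.
by split=> //; rewrite mulgK.
Qed.

Let Bd c : set X :=
  [set p | exists2 g, g \in enum_fset (F1 `\` F0)%fset & tr g (B c) p].

Let pairs : seq ({fset H} * H)%type :=
  [seq (L, g) | L <- enum_fset (fpowerset F), g <- enum_fset L].

Let pairsP L g : (L, g) \in pairs <-> (L `<=` F)%fset /\ g \in L.
Proof.
have P : reflect _ ((L, g) \in pairs) :=
  @allpairsPdep {fset H} (fun=> H) ({fset H} * H)%type (fun L g => (L, g))
    (enum_fset (fpowerset F)) (fun L => enum_fset L) (L, g).
split=> [/P[L' [g' [+ + [-> ->]]]]|[LF gL]]; first by rewrite fpowersetE.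
by apply/P; exists L, g; rewrite fpowersetE.
Qed.

Let pairs_uniq : uniq pairs.
Proof.
apply: (@allpairs_uniq_dep {fset H} (fun=> H) ({fset H} * H)%type).
- exact: fset_uniq.
- by move=> L _; exact: fset_uniq.
- by move=> [L g] [L' g'] _ _ /= [-> ->].
Qed.

Let Pat c : set X := [set p | exists2 q, q \in pairs &
  D (q.2 * yc c q.1)%g /\ tr q.2 (tile_shape c q.1) p].

(** If the class of the position of [p] sticks out of [L], some point within [r] of [p] has another
    owner or none, and [owns_bd] puts [p] in a shell. *)
Lemma placed_cut_sub :
  placed_cut `<=` uncovered a F B `|` (\bigcup_c Bd c `|` \bigcup_c Pat c).
Proof.
move=> p Pp; have [up|nup] := pselect (uncovered a F B p); [by left|right].
have [j [z [Bz zp]]] : exists j z, B j z /\ covers a F z p.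
  apply: contrapT => nz; apply: nup => c j jc g gF Bp; apply: nz.
  exists j, (a g^-1%g p); split=> //; exists g => //.
  by rewrite (actVK hact).
have [c [x cxp]] := covers_owned Bz zp.
have [Bx [g gF pE] _] := cxp.
pose L := [fset h in F | `[< bef c (a h x) >]]%fset.
have LF : (L `<=` F)%fset by exact: fset_sub.
have xL : tile_shape c L x.
  split=> // h hF; rewrite !inE /= hF; split=> [?|/asboolP//]; exact/asboolP.
have gL : g \in L.
  by apply/(xL.2 g gF); rewrite -pE; exact: bef_owns cxp.
have [uL|/existsNP[h /not_implyP[uh nhL]]] := pselect (forall h,
    e (g * yc c L)%g h -> (h * (yc c L)^-1)%g \in L).
  right; exists c => //; exists (L, g); first exact/pairsP.
  rewrite /= pE tr_act; split=> //; apply: (placed_cut_D Pp).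
  by split; [exact: LF|exact: xL|exact: uL|rewrite mulgK].
left; pose w := a (h * (yc c L)^-1)%g x.
have pw : within S a r p w.
  have [b bn hE] := tiled_within tD uh; exists b => //.
  by rewrite /w hE pE -(actM hact) !mulgA mulgK.
have nw : ~ owns a F B c x w.
  move=> ow; have [_ [g' g'F wE] _] := ow; apply: nhL.
  rewrite (free_inj hact hfree wE); apply/(xL.2 g' g'F).
  by rewrite -wE; exact: bef_owns ow.
have [j' [z' [g' [Bz' g'1 g'0 pE']]]] := owns_bd hact F0F FF1 cxp pw nw.
exists j' => //; exists g'; first by apply/fsetDP; split=> //; exact/negP.
by rewrite pE' tr_act.
Qed.

Hypothesis Bneg : forall c, \sum_(g <- (F1 `\` F0)%fset) v (tr g (B c)) <=
  k * \sum_(g <- F) v (bef c `&` tr g (B c)).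

Let mBd c : measurable (Bd c).
Proof. by apply: measurable_ex_seq => g; exact: mtr. Qed.

Let mPatE c (q : {fset H} * H) : measurable
  [set p | D (q.2 * yc c q.1)%g /\ tr q.2 (tile_shape c q.1) p].
Proof.
apply: measurable_and; first exact: measurable_const.
exact/mtr/measurable_tile_shape.
Qed.

Let mPat c : measurable (Pat c).
Proof. exact: (@measurable_ex_seq _ _ _ pairs _ (mPatE c)). Qed.

Lemma measure_Bd : v (\bigcup_c Bd c) <= k * v setT.
Proof.
apply: (fin_measure_bigcup_le mv) => // n.
apply: le_trans (_ : k * \sum_(c < n) \sum_(g <- F) v (bef c `&` tr g (B c)) <= _).
  rewrite mulr_sumr; apply: ler_sum => c _; apply: le_trans (Bneg c).
  by apply: measure_ex_seq_le => g; exact: mtr.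
apply: ler_wpM2l => //; exact: (sum_stages mv hact hfree ma Yind mB BY).
Qed.

(** The choice of [yc] bounds the pattern shape by shape; the translates of the shapes are disjoint
    and lie in the new parts of the tiles, so the bounds add up. *)
Lemma measure_Pat : v (\bigcup_c Pat c) <= dl * v setT.
Proof.
apply: (fin_measure_bigcup_le mv) => // n.
apply: le_trans (_ : dl * \sum_(c < n) \sum_(g <- F) v (bef c `&` tr g (B c)) <= _).
  rewrite mulr_sumr; apply: ler_sum => [[c _] _] /=.
  have PatE q : v [set p | D (q.2 * yc c q.1)%g /\ tr q.2 (tile_shape c q.1) p] =
      v (tr q.2 (tile_shape c q.1)) * ind R D (q.2 * yc c q.1)%g.
    have [Dq|nD] := pselect (D (q.2 * yc c q.1)%g).
      rewrite indT // mulr1; congr (v _).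
      by apply/seteqP; split=> p /= [].
    rewrite indF // mulr0 (_ : [set p | _] = set0).
      exact: sigma_add0 (fin_measure_sigma mv).
    by apply/seteqP; split=> p // [].
  have PatS : v (Pat c) <= \sum_(q <- pairs)
      v (tr q.2 (tile_shape c q.1)) * ind R D (q.2 * yc c q.1)%g.
    apply: le_trans (measure_ex_seq_le pairs (mPatE c)) _.
    by rewrite le_eqVlt; apply/orP; left; apply/eqP/eq_bigr => q _; exact: PatE.
  apply: le_trans PatS _; rewrite big_allpairs_dep /=.
  apply: le_trans (ler_sum _ (fun L _ => ycP c L)) _; rewrite -mulr_sumr.
  apply: ler_wpM2l => //.
  have -> : \sum_(L <- fpowerset F) \sum_(g <- L) v (tr g (tile_shape c L)) =
      \sum_(q <- pairs) 1 * v (tr q.2 (tile_shape c q.1)).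
    rewrite big_allpairs_dep /=; apply: eq_bigr => L _; apply: eq_bigr => g _.
    by rewrite mul1r.
  have -> : \sum_(g <- F) v (bef c `&` tr g (B c)) =
      \sum_(g <- F) 1 * v (bef c `&` tr g (B c)).
    by apply: eq_bigr => g _; rewrite mul1r.
  apply: (content_le v_content) => [q|g|p].
  - exact/mtr/measurable_tile_shape.
  - by apply: measurableI => //; exact: mtr.
  have [[[L g] [/pairsP[LF gL]]]|nq] := pselect (exists q, q \in pairs /\
      tr q.2 (tile_shape c q.1) p); last first.
    rewrite big1_seq ?sumr_ge0 // => [g _|q /= qr]; first by rewrite mul1r ind_ge0.
    by rewrite mul1r indF // => qp; apply: nq; exists q.
  move=> /trP[x xL pE] /=; have gF := fsubsetP LF _ gL.
  have cp : bef c p by rewrite pE; exact/(xL.2 g gF).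
  apply: (@le_trans _ _ 1); last first.
    apply: (@sum_ind_ge _ _ _ _ (fun g => bef c `&` tr g (B c)) p g gF).
    by split=> //; rewrite pE tr_act; case: xL.
  apply: sum_ind_le1.
    exact: pairs_uniq.
  suff uq q : q \in pairs -> tr q.2 (tile_shape c q.1) p -> q = (L, g).
    by move=> q q' qr q'r /(uq _ qr) -> /(uq _ q'r) ->.
  case: q => L' g' /pairsP[L'F g'L'] /trP[x' x'L' pE'] /=.
  have g'F := fsubsetP L'F _ g'L'.
  have xx' : x = x'.
    by apply: (Yind (BY xL.1) (BY x'L'.1) gF g'F); rewrite -pE -pE'.
  move: pE' x'L'; rewrite -xx' => pE' x'L'.
  have -> : g' = g by apply: (free_inj hact hfree (x := x)); rewrite -pE -pE'.
  congr pair; apply/fsetP => h; apply/idP/idP => hL.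
    by have hF := fsubsetP L'F _ hL; apply/(xL.2 _ hF)/(x'L'.2 _ hF).
  by have hF := fsubsetP LF _ hL; apply/(x'L'.2 _ hF)/(xL.2 _ hF).
apply: ler_wpM2l => //; exact: (sum_stages mv hact hfree ma Yind mB BY).
Qed.

Lemma measure_placed_cut :
  v placed_cut <= v (uncovered a F B) + (k * v setT + dl * v setT).
Proof.
have mbd : measurable (\bigcup_c Bd c) by exact: bigcupT_measurable.
have mpat : measurable (\bigcup_c Pat c) by exact: bigcupT_measurable.
have munc : measurable (uncovered a F B).
  by apply: measurable_all_nat => c; exact: mbef.
apply: le_trans (fin_measure_le mv measurable_placed_cut _ placed_cut_sub) _.
  by apply: measurableU => //; exact: measurableU.
apply: le_trans (measureU_le munc (measurableU _ _ mbd mpat)) _; rewrite lerD2l.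
apply: le_trans (measureU_le mbd mpat) _.
by apply: lerD; [exact: measure_Bd|exact: measure_Pat].
Qed.

End Assemble.

Theorem key_cut (eps : R) :
  (forall k, exists2 n, (0 < n)%N & (k * n <= #|` wball S n|)%N) -> 0 < eps ->
  exists r P e, [/\ measurable P, tiled S a r P e & v P <= eps * v setT].
Proof.
(* One third each for the uncovered set, the shells and the pattern. The shells get relative size
   [k * k] because [measure_uncovered] loses a factor [k]. *)
move=> growth eps0; pose k := eps / 3; have k0 : 0 < k by rewrite divr_gt0.
have [r [D [e [tD mD]]]] := group_tiling gS mP growth k0.
have [F0 [F [F1 [Fn0 F0F FF1 _ FF]]]] :=
  mean_Folner_shells S r mP (mulr_gt0 k0 k0).
have [Y [mY Ycover Yind]] := independent_cover hact hfree ma sepO F.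
have [B BP] := ex_stages mv ma F (F1 `\` F0)%fset k mY.
have mB c : measurable (B c) by have [] := BP c.
have BY c : B c `<=` Y c by have [] := BP c.
have [yc ycP] : exists yc : nat -> {fset H} -> H, forall c (L : {fset H}),
    \sum_(g <- L) v (tr g (tile_shape F B c L)) * ind R D (g * yc c L)%g <=
    k * \sum_(g <- L) v (tr g (tile_shape F B c L)).
  have /choice[yc ycP] : forall q : nat * {fset H}, exists y,
      \sum_(g <- q.2) v (tr g (tile_shape F B q.1 q.2)) * ind R D (g * y)%g <=
      k * \sum_(g <- q.2) v (tr g (tile_shape F B q.1 q.2)).
    move=> [c L]; apply: (mean_choose mP) => // g.
    exact/(fin_measure_ge0 mv)/mtr/measurable_tile_shape.
  by exists (fun c L => yc (c, L)) => c L; exact: (ycP (c, L)).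
exists r, (placed_cut D e F B yc), (placed_rel e F B yc); split.
- exact: measurable_placed_cut tD mB.
- exact: placed_tiled tD Yind BY.
have Bneg c := let: And4 _ _ h _ := BP c in h.
have Bpos c := let: And4 _ _ _ h := BP c in h.
have unc := measure_uncovered mv ma Ycover mY mB Bpos (ltW k0).
have cut := measure_placed_cut tD F0F FF1 Yind mB BY (ltW k0) (ltW k0) ycP Bneg.
apply: le_trans cut _.
have F_gt0 : 0 < #|` F|%:R :> R by rewrite ltr0n cardfs_gt0.
have v0 : 0 <= v setT by exact: fin_measure_ge0 mv _ measurableT.
have unc' : v (uncovered a F B) <= k * v setT.
  rewrite -(ler_pM2l (mulr_gt0 k0 F_gt0)); apply: le_trans unc _.
  apply: le_trans (ler_wpM2r v0 FF) _; rewrite le_eqVlt; apply/orP; left.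
  by apply/eqP; ring.
apply: le_trans (lerD unc' (lexx _)) _; rewrite le_eqVlt; apply/orP; left.
by apply/eqP; rewrite /k; field.
Qed.

End KeyCutTheorem.

(** * Layers *)

Section Layers.
Variables (H : groupType) (S : {fset H}) (X : Type) (a : H -> X -> X).
Hypothesis hact : is_group_action a.
Hypothesis gS : generates S.
Variables (r : nat -> nat) (P : nat -> set X) (e : nat -> X -> X -> Prop).
Hypothesis tP : forall i, tiled S a (r i) (P i) (e i).
Hypothesis r0 : forall i, (0 < r i)%N.

Local Notation nb := (nb S a).
Local Notation within := (within S a).
Local Notation conn := (conn S a).

Definition radius j : nat := \sum_(k < j) r k.

(* [cut i] is the union of [P i] and of the [r i]-neighbourhood of
   [cut i.+1], as the radii add up. *)
Definition cut i : set X := [set x | exists j w,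
  [/\ (i <= j)%N, within (radius j - radius i) x w & P j w]].

Lemma radiusS i : radius i.+1 = (radius i + r i)%N.
Proof. by rewrite /radius big_ord_recr. Qed.

Lemma radius_le i j : (i <= j)%N -> (radius i <= radius j)%N.
Proof.
move=> /subnKC <-; elim: (j - i)%N => [|k IH]; first by rewrite addn0.
by rewrite addnS radiusS; apply: leq_trans IH (leq_addr _ _).
Qed.

Lemma cut_P i : P i `<=` cut i.
Proof.
by move=> x Px; exists i, x; split=> //; exact: within_refl.
Qed.

Lemma cut_nbhd i x w : within (r i) x w -> cut i.+1 w -> cut i x.
Proof.
move=> xw [j [z [ij wz Pz]]]; exists j, z; split=> //; first exact: ltnW.
have := radius_le ij; rewrite radiusS => le.
rewrite (_ : (_ - _)%N = (r i + (radius j - radius i.+1))%N).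
  exact: within_trans wz.
by rewrite radiusS; lia.
Qed.

Lemma cutE i x : cut i x -> P i x \/ exists2 w, within (r i) x w & cut i.+1 w.
Proof.
move=> [j [z [ij xz Pz]]]; case: (ltngtP i j) ij => // [ij _|ij _]; last first.
  left; move: xz; rewrite -ij subnn => /(within0 hact) <-.
  by rewrite ij.
right; have le := radius_le ij; rewrite radiusS in le.
move: xz; rewrite (_ : (_ - _)%N = ((radius j - radius i.+1) + r i)%N); last first.
  by rewrite radiusS; lia.
move=> [b /wball_split[g [h [gn hn ->]]] zE].
exists (a h x); first by exists h.
by exists j, z; split=> //; exists g; rewrite // zE (actM hact).
Qed.

Lemma cutS i x : cut i.+1 x -> cut i x.
Proof. by apply: cut_nbhd; exact: within_refl. Qed.

Lemma cut_le i j x : (i <= j)%N -> cut j x -> cut i x.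
Proof.
move=> /subnKC <-.
by elim: (j - i)%N => [|k IH]; rewrite ?addn0 // addnS => /cutS.
Qed.

Lemma cut_nb i x y : nb x y -> cut i.+1 y -> cut i x.
Proof.
by move=> /nb_within xy; apply: cut_nbhd; exact: within_le xy.
Qed.

Lemma conn_uncut i x y : conn (~` cut i) x y -> within (r i) x y.
Proof.
move=> xy; apply: (tiled_comp hact (tP i)); apply: conn_sub xy => z nz Pz.
exact/nz/cut_P.
Qed.

Let exit_within A n x z w : conn A x z -> within n z w -> ~ conn A x w ->
  exists2 w', within n z w' & ~ A w'.
Proof.
elim: n z => [z xz /(within0 hact) -> //|n IH z xz /(withinS hact)[z1 zz1 z1w] nw].
have [Az1|nAz1] := pselect (A z1); last first.
  by exists z1 => //; apply: within_le (proj1 (nb_within _ _ _ _) zz1).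
have [w' z1w' nAw'] := IH z1 (conn_step xz zz1 Az1) z1w nw.
exists w' => //; rewrite -add1n; apply: within_trans z1w' => //.
exact/nb_within.
Qed.

(** On the component [L] of [x] off [cut i.+1], [cut i] and [thick L] agree: a walk out of [L] meets
    [cut i.+1], so being [r i]-close to the complement of [L] amounts to being [r i]-close to
    [cut i.+1]. *)
Lemma cut_conn i x y : conn (~` cut i.+1) x y -> cut i x -> cut i y ->
  conn (cut i `&` ~` cut i.+1) x y.
Proof.
move=> xy cx cy; pose L := [set z | conn (~` cut i.+1) x z].
have cL : connected S a L.
  move=> z w xz xw; have zw := conn_trans (conn_sym hact xz) xw.
  apply: conn_sub (conn_component hact zw) => t zt.
  exact: conn_trans xz zt.
have thickE z : L z -> cut i z -> thick S a (r i) (P i) L z.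
  move=> Lz /cutE[Pz|[w zw cw]]; split=> //; [by left|right].
  by exists w => // xw; exact: (conn_lst xw).
have Lx : L x by apply: conn_refl; exact: conn_fst xy.
apply: conn_sub (thick_connected hact (tP i) cL (thickE x Lx cx) (thickE y xy cy)).
move=> z [Lz h]; split; last exact: conn_lst Lz.
case: h => [|[w zw nLw]]; first exact: cut_P.
have [w' zw' /contrapT cw'] := exit_within Lz zw nLw.
exact: cut_nbhd zw' cw'.
Qed.

(** As the cuts decrease, every translate of such a point leaves them for good; quantifying over the
    orbit makes the set invariant. *)
Definition core : set X := [set x | forall g, exists i, ~ cut i (a g x)].

Lemma core_act g x : core x -> core (a g x).
Proof.
by move=> cx h; have [i ci] := cx (h * g)%g; exists i; rewrite -(actM hact).
Qed.

Lemma core_nb x y : nb x y -> core x -> core y.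
Proof. by move=> [s _ ->]; exact: core_act. Qed.

(** The first cuts may swallow a whole orbit; [n] is the first level that does not, and it is the
    origin of the levels of that orbit. *)
Definition entry n : set X := [set x | (exists g, ~ cut n (a g x)) /\
  forall k, (k < n)%N -> forall g, cut k (a g x)].

Lemma entry_act n g x : entry n x -> entry n (a g x).
Proof.
move=> [[h ch] lt]; split=> [|k kn h']; last by rewrite -(actM hact); exact: lt.
by exists (h * g^-1)%g; rewrite (actM hact) (actK hact).
Qed.

Lemma entry_uniq n k x : entry n x -> entry k x -> n = k.
Proof.
move=> [[g cg] ltn] [[h ch] ltk]; case: (ltngtP n k) => // [nk|kn].
  by case: (cg (ltk _ nk g)).
by case: (ch (ltn _ kn h)).
Qed.

Lemma entry_core x : core x -> exists n, entry n x.
Proof.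
move=> /(_ 1%g)[i]; rewrite (act1 hact) => ci.
have : exists n, `[< exists g, ~ cut n (a g x) >].
  by exists i; apply/asboolP; exists 1%g; rewrite (act1 hact).
case/ex_minnP => n /asboolP[g cg] nmin; exists n; split; first by exists g.
move=> k kn h; apply: contrapT => nch.
have /nmin : `[< exists g, ~ cut k (a g x) >] by apply/asboolP; exists h.
by rewrite leqNgt kn.
Qed.

Lemma conn_act A x y : conn A x y -> exists g, y = a g x.
Proof. by move=> /(conn_within hact)[n [b _ ->]]; exists b. Qed.

(* The components of the complement of [cut (n + i)] that do not meet the
   complement of [cut n] are dropped, so that every chain of components starts
   at level [0]. *)
Definition stage i : set X := [set x | core x /\ exists n, [/\ entry n x,
  ~ cut (n + i) x & exists g, ~ cut n (a g x) /\ conn (~` cut (n + i)) x (a g x)]].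

Let stageP n i x : core x -> entry n x -> stage i x <->
  (~ cut (n + i) x /\ exists y, ~ cut n y /\ conn (~` cut (n + i)) x y).
Proof.
move=> cx nx; split=> [[_ [k [kx ck [g [cg xg]]]]]|[ci [y [cy xy]]]].
  rewrite (entry_uniq nx kx); split=> //.
  by exists (a g x).
by split=> //; exists n; split=> //; have [g gE] := conn_act xy; exists g; rewrite -gE.
Qed.

Lemma stage_core i : stage i `<=` core. Proof. by move=> x []. Qed.

Let stage_conn n i x y : core x -> entry n x -> stage i x ->
  conn (~` cut (n + i)) x y -> stage i y.
Proof.
move=> cx nx /(stageP _ cx nx)[ci [z [cz xz]]] xy; have [g yE] := conn_act xy.
apply/(@stageP n); [by rewrite yE; exact: core_act|by rewrite yE; exact: entry_act|].
split; first exact: conn_lst xy.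
by exists z; split=> //; apply: conn_trans xz; exact: conn_sym.
Qed.

Let conn_stage n i x y : core x -> entry n x -> stage i x ->
  conn (stage i) x y <-> conn (~` cut (n + i)) x y.
Proof.
move=> cx nx sx; split=> xy.
  apply: conn_sub (conn_component hact xy) => z xz; have [g zE] := conn_act xz.
  have sz := conn_lst xz; have nz : entry n z by rewrite zE; exact: entry_act.
  by have [] := (stageP i (stage_core sz) nz).1 sz.
apply: conn_sub (conn_component hact xy) => z xz.
exact: stage_conn xz.
Qed.

(** The buffer between levels: since [r] is positive, a neighbour of a point of [cut (n + i).+1] is
    in [cut (n + i)]. *)
Lemma stage_nb i x y : stage i x -> nb x y -> stage i.+1 y.
Proof.
move=> sx xy; have cx := stage_core sx; have [n nx] := entry_core cx.
have [ci [z [cz xz]]] := (stageP _ cx nx).1 sx.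
have ny : entry n y by case: xy => s _ ->; exact: entry_act.
have cy : ~ cut (n + i).+1 y.
  by move=> cy; apply: ci; exact: cut_nb xy cy.
apply/(@stageP n) => //; first exact: core_nb cx.
rewrite addnS; split=> //; exists z; split=> //.
apply: (@conn_trans _ _ _ _ _ _ x).
  apply: conn1 => //; [by move=> /cutS|exact: nb_sym].
by apply: conn_sub xz => w nw /cutS.
Qed.

Lemma stage_finite i x : exists k, forall y, conn (stage i) x y -> within k x y.
Proof.
have [sx|nsx] := pselect (stage i x); last first.
  by exists 0%N => y xy; case: nsx; exact: conn_fst xy.
have cx := stage_core sx; have [n nx] := entry_core cx.
by exists (r (n + i)) => y xy; exact/conn_uncut/(conn_stage _ cx nx sx).
Qed.

Lemma stage_meets i x : stage i.+1 x -> exists y, conn (stage i.+1) x y /\ stage i y.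
Proof.
move=> sx; have cx := stage_core sx; have [n nx] := entry_core cx.
have [ci [z [cz xz]]] := (stageP _ cx nx).1 sx.
exists z; split; first exact/(conn_stage _ cx nx sx).
have [g zE] := conn_act xz; have ncz : ~ cut (n + i) z.
  by move=> /(cut_le (leq_addr _ _)).
apply/(@stageP n); [by rewrite zE; exact: core_act|by rewrite zE; exact: entry_act|].
by split=> //; exists z; split=> //; apply: conn_refl; exact: ncz.
Qed.

Let conn_orbit g x : conn setT x (a g x).
Proof.
have [n gn] := wball_gen gS g; exists n.
by apply: (within_steps hact) => //; exists g.
Qed.

(** A finite walk joins [x] to a point uncut at the entry level, and each of its vertices is uncut
    from some level on. *)
Lemma stage_cover x : core x -> exists i, stage i x.
Proof.
move=> cx; have [n nx] := entry_core cx; have [[g cg] _] := nx.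
pose y := a g x; have yx := conn_sym hact (conn_orbit g x).
have reach z : conn setT y z -> exists i, conn (~` cut (n + i)) y z.
  move: z; apply: (conn_ind hact) => [_|z z' yz [i IH] zz' _].
    by exists 0%N; rewrite addn0; apply: conn_refl.
  have [h zE] := conn_act yz.
  have : core z' by apply: (core_nb zz'); rewrite zE; exact/core_act/core_act.
  move=> /(_ 1%g)[j]; rewrite (act1 hact) => cj; exists (maxn i j).
  apply: conn_step _ zz' _.
    by apply: conn_sub IH => w nw /(cut_le (leq_add (leqnn n) (leq_maxl i j))).
  by move=> c; apply: cj; apply: cut_le c; lia.
have [i yi] := reach x yx.
exists i; apply/(@stageP n) => //; split; first exact: conn_lst yi.
by exists y; split=> //; exact: conn_sym.
Qed.

(** Besides points of the cut, the difference contains the dropped components. From such a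
    component, a walk towards [stage i] leaves through a point of the cut, and [cut_conn] joins two
    points of the cut. *)
Lemma stage_connected i x y : conn (stage i.+1) x y -> ~ stage i x -> ~ stage i y ->
  conn (stage i.+1 `\` stage i) x y.
Proof.
move=> xy; have sx := conn_fst xy; have cx := stage_core sx.
have [n nx] := entry_core cx.
have to_cut u : conn (stage i.+1) x u -> ~ stage i u -> exists w,
    [/\ conn (stage i.+1 `\` stage i) u w, conn (stage i.+1) x w & cut (n + i) w].
  move=> xu nsu; have su := conn_lst xu; have cu := stage_core su.
  have nu : entry n u by have [g ->] := conn_act xu; exact: entry_act.
  have [cutu|ncutu] := pselect (cut (n + i) u).
    by exists u; split=> //; apply: conn_refl.
  have not_stage w : conn (~` cut (n + i)) u w -> ~ stage i w.
    move=> uw sw; apply: nsu; have cw := stage_core sw.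
    have nw : entry n w by have [g ->] := conn_act uw; exact: entry_act.
    exact: stage_conn cw nw sw (conn_sym hact uw).
  have [y1 [uy sy]] := stage_meets su.
  have [uy'|[z [w [uz zw ncw uw]]]] := conn_exit hact uy (ncutu : (~` cut (n + i)) u).
    by case: (@not_stage y1) => //; apply: conn_sub uy' => t [].
  have cutw : cut (n + i) w by exact: contrapT.
  have nsw : ~ stage i w.
    have cw := core_nb zw (stage_core (conn_lst uz).1).
    have nw : entry n w by have [g ->] := conn_act uw; exact: entry_act.
    by move=> /(stageP _ cw nw)[].
  exists w; split=> //; last exact: conn_trans xu uw.
  apply: conn_step zw _; last by split=> //; exact: conn_lst uw.
  apply: conn_sub (conn_component hact uz) => t ut; split.
    by have [] := conn_lst ut.
  by apply: not_stage; apply: conn_sub ut => ? [].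
move=> nsx nsy; have [u [xu xu' cu]] := to_cut x (conn_refl S a (conn_fst xy)) nsx.
have [v [yv xv cv]] := to_cut y xy nsy.
apply: (conn_trans xu); apply: conn_trans (conn_sym hact yv).
have su := conn_lst xu'; have core_u := stage_core su.
have nu : entry n u by have [g ->] := conn_act xu'; exact: entry_act.
have uv := conn_trans (conn_sym hact xu') xv.
have {}uv : conn (~` cut (n + i).+1) u v.
  by rewrite -addnS; apply/(conn_stage _ core_u nu su).
apply: conn_sub (conn_component hact (cut_conn uv cu cv)) => w uw.
have [cw ncw] := conn_lst uw; have [g wE] := conn_act uw; split.
  apply: (stage_conn core_u nu su); rewrite addnS.
  by apply: conn_sub uw => t [].
have nw : entry n w by rewrite wE; exact: entry_act.
by move=> sw; have [] := (stageP _ (stage_core sw) nw).1 sw.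
Qed.

End Layers.

(** * The toast made of the components of the stages *)

Section StagesToast.
Variables (d : measure_display) (X : measurableType d).
Variables (H : groupType) (S : {fset H}) (a : H -> X -> X).
Hypothesis hact : is_group_action a.
Variables (X' : set X) (W : nat -> set X).

Local Notation nb := (nb S a).
Local Notation within := (within S a).
Local Notation conn := (conn S a).

Hypothesis W_X' : forall i, W i `<=` X'.
Hypothesis W_nb : forall i x y, W i x -> nb x y -> W i.+1 y.
Hypothesis W_finite : forall i x, exists k, forall y, conn (W i) x y -> within k x y.
Hypothesis W_meets : forall i x, W i.+1 x ->
  exists y, conn (W i.+1) x y /\ W i y.
Hypothesis W_cover : forall x, X' x -> exists i, W i x.
Hypothesis W_connected : forall i x y, conn (W i.+1) x y -> ~ W i x -> ~ W i y ->
  conn (W i.+1 `\` W i) x y.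
Hypothesis orbit_unbounded : forall k x, exists g, ~ within k x (a g x).
Hypothesis orbit_connected : forall g x, conn setT x (a g x).

Let G := induced_subgraph (schreier S a) X'.

Definition is_comp i (K : {fset X}) : Prop :=
  exists2 x, W i x & forall y, y \in K <-> conn (W i) x y.

Definition comps : set {fset X} := [set K | exists i, is_comp i K].

Let W_le i j : (i <= j)%N -> W i `<=` W j.
Proof.
move=> /subnKC <-; elim: (j - i)%N => [|k IH] x; rewrite ?addn0 // addnS => /IH Wx.
by apply: W_nb Wx _; exact: nb_refl.
Qed.

Let comp_W i K x : is_comp i K -> x \in K -> W i x.
Proof. by move=> [z _ zK] /zK zx; exact: conn_lst zx. Qed.

Let comp_conn i K x y : is_comp i K -> x \in K -> (y \in K <-> conn (W i) x y).
Proof.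
move=> [z _ zK] /zK zx; rewrite zK; split=> h; last exact: conn_trans zx h.
exact: conn_trans (conn_sym hact zx) h.
Qed.

Let ex_comp i x : W i x -> exists2 K, is_comp i K & x \in K.
Proof.
move=> Wx; have [k kP] := W_finite i x.
pose K := [fset y in [fset a b x | b in wball S k] | `[< conn (W i) x y >]]%fset.
have KP y : y \in K <-> conn (W i) x y.
  rewrite !inE /=; split=> [/andP[_ /asboolP]//|xy]; apply/andP; split.
    by have [b bk ->] := kP y xy; apply/imfsetP; exists b.
  exact/asboolP.
by exists K; [exists x|apply/KP; exact: conn_refl].
Qed.

Let comp_nonempty i K : is_comp i K -> exists x, x \in K.
Proof. by move=> [x Wx KP]; exists x; apply/KP; exact: conn_refl. Qed.

Let comp_eq i K L x : is_comp i K -> is_comp i L -> x \in K -> x \in L -> K = L.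
Proof.
move=> cK cL xK xL; apply/fsetP => y; apply/idP/idP => h.
  by apply/(comp_conn y cL xL)/(comp_conn y cK xK).
by apply/(comp_conn y cK xK)/(comp_conn y cL xL).
Qed.

(** The neighbours of [K] are in [W j] and linked through [K], so if one of them is in [L], all
    are. *)
Let comp_nest i j K L x y u w : is_comp i K -> is_comp j L -> (i < j)%N ->
  x \in K -> nb x y -> y \in L -> u \in K -> nb u w -> w \in L.
Proof.
move=> cK cL ij xK xy yL uK uw; apply/(comp_conn w cL yL).
have Wj z : W i z -> W j z by apply: W_le; exact: ltnW.
have xu : conn (W j) x u by apply: conn_sub ((comp_conn u cK xK).1 uK) => z /Wj.
have Wy : W j y by exact: comp_W cL yL.
apply: (@conn_trans _ _ _ _ _ _ x).
  by apply: conn1 => //; [exact/Wj/(comp_W cK)|exact: nb_sym].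
apply: (conn_step xu uw); apply: (W_le ij); apply: W_nb _ uw.
exact: comp_W cK uK.
Qed.

(** A finite set cannot contain an unbounded orbit. This makes inclusions between levels strict, so
    that a member of [comps] has a single level. *)
Let comp_bd i K : is_comp i K -> exists x y, [/\ x \in K, nb x y & y \notin K].
Proof.
move=> cK; have [x xK] := comp_nonempty cK; have [k kP] := W_finite i x.
have [g ng] := orbit_unbounded k x.
have [xg|[z [w [xz zw nw _]]]] := conn_exit hact (orbit_connected g x)
    (xK : [set` K] x); last first.
  by have [_ zK] := conn_lst xz; exists z, w; split=> //; exact/negP.
have [_ gK] := conn_lst xg; case: ng; apply: kP.
exact/(comp_conn _ cK xK).
Qed.

Let comp_lt i j K L x : is_comp i K -> is_comp j L -> (i < j)%N ->
  x \in K -> x \in L -> (K `<` L)%fset.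
Proof.
move=> cK cL ij xK xL; rewrite fproperE; apply/andP; split.
  apply/fsubsetP => y yK.
  exact: (comp_nest cK cL ij xK (nb_refl S hact x) xL yK (nb_refl S hact y)).
have [u [w [uK uw wK]]] := comp_bd cK; apply/negP => /fsubsetP/(_ w).
rewrite (negbTE wK) => /(_ _)/notF; apply.
exact: (comp_nest cK cL ij xK (nb_refl S hact x) xL uK uw).
Qed.

Let comp_index i j K : is_comp i K -> is_comp j K -> i = j.
Proof.
move=> cK cK'; have [x xK] := comp_nonempty cK.
case: (ltngtP i j) => // [ij|ji].
  by have := comp_lt cK cK' ij xK xK; rewrite fproperEneq eqxx.
by have := comp_lt cK' cK ji xK xK; rewrite fproperEneq eqxx.
Qed.

Let comp_sub i j K L x : is_comp i K -> is_comp j L -> (i <= j)%N ->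
  x \in K -> x \in L -> (K `<=` L)%fset.
Proof.
move=> cK cL; rewrite leq_eqVlt => /orP[/eqP ij|ij] xK xL.
  by move: cL; rewrite -ij => cL; rewrite (comp_eq cK cL xK xL).
exact: fproper_sub (comp_lt cK cL ij xK xL).
Qed.

Let comp_meets i j L : is_comp j L -> (i <= j)%N ->
  exists K x, [/\ is_comp i K, x \in K & x \in L].
Proof.
move=> + /subnKC ij; rewrite -ij; elim: (j - i)%N L => [|k IH] L.
  rewrite addn0 => cL; have [x xL] := comp_nonempty cL.
  by exists L, x.
rewrite addnS => cL; have [x xL] := comp_nonempty cL.
have [y [xy Wy]] := W_meets (comp_W cL xL).
have yL : y \in L by exact/(comp_conn y cL xL).
have [M cM yM] := ex_comp Wy.
have [K [z [cK zK zM]]] := IH M cM; exists K, z; split=> //.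
by apply: (fsubsetP (comp_sub cM cL (leqnSn _) yM yL)).
Qed.

Let comps_from i : set {fset X} := [set K | exists2 j, (i <= j)%N & is_comp j K].

(** A component of a higher level contains one of level [i], by [W_meets]; this is what identifies
    the layers of the toast with the levels. *)
Let minimal_comps i : minimal_elements (comps_from i) = is_comp i.
Proof.
apply/seteqP; split=> K.
  move=> [[j ij cK] Kmin]; have [L [x [cL xL xK]]] := comp_meets cK ij.
  by rewrite -(Kmin L) //; [exists i|exact: comp_sub cL cK ij xL xK].
move=> cK; split; first by exists i.
move=> L [j ij cL] LK; have [x xL] := comp_nonempty cL.
have xK : x \in K by exact: (fsubsetP LK).
by apply/eqP; rewrite eqEfsubset LK; exact: comp_sub cK cL ij xK xL.
Qed.

Let remainder_comps i : remainder comps i = comps_from i.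
Proof.
elim: i => [|i IH] /=.
  by apply/seteqP; split=> K [j]; [exists j|move=> _ cK; exists j].
rewrite IH minimal_comps; apply/seteqP; split=> K.
  move=> [[j ij cK] ncK]; exists j => //; rewrite ltn_neqAle ij andbT.
  by apply/eqP => e; apply: ncK; rewrite e.
move=> [j ij cK]; split; first by exists j => //; exact: ltnW.
by move=> /comp_index/(_ cK) e; move: ij; rewrite e ltnn.
Qed.

Lemma layer_comps i : layer comps i = is_comp i.
Proof. by rewrite /layer remainder_comps minimal_comps. Qed.

Lemma comps_layered : layered_toast comps.
Proof.
move=> i x [K]; rewrite !layer_comps => cK xK.
have [L cL xL] := ex_comp (W_le (leqnSn i) (comp_W cK xK)).
by exists L.
Qed.

Let adjE x y : adj G x y <-> [/\ x <> y, nb x y, X' x & X' y].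
Proof.
split=> [[/(schreier_adjE S hact)[? ?] ? ?]|[? ? ? ?]]; first by [].
by split=> //; exact/(schreier_adjE S hact).
Qed.

Let ball1P (K : {fset X}) x : ball1 G [set` K] x -> exists2 y, y \in K & nb y x.
Proof.
move=> [xK|[y yK /adjE[_ yx _ _]]]; first by exists x => //; exact: nb_refl.
by exists y.
Qed.

Let comp_nested i j K L : is_comp i K -> is_comp j L -> (i < j)%N ->
  ball1 G [set` K] `&` [set` L] = set0 \/ ball1 G [set` K] `<=` [set` L].
Proof.
move=> cK cL ij; have [[y [/ball1P[x xK xy] yL]]|no] :=
    pselect (exists y, ball1 G [set` K] y /\ y \in L).
  right=> w /ball1P[u uK uw].
  exact: (comp_nest cK cL ij xK xy yL uK uw).
by left; rewrite -subset0 => y [Ky yL]; apply: no; exists y.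
Qed.

Lemma comps_toast : borel_fsets comps -> toast G comps.
Proof.
move=> bT; split=> //.
- by move=> K [i cK] x xK; split=> //; apply: W_X' (comp_W cK xK).
- apply/seteqP; split=> [[x y] [K _ [/= xy _ _]]//|[x y] /= xy].
  have [_ xy' X'x _] := (adjE x y).1 xy; have [i Wx] := W_cover X'x.
  have Wx1 : W i.+1 x by apply: W_nb Wx _; exact: nb_refl.
  have [K cK xK] := ex_comp Wx1; exists K; first by exists i.+1.
  split=> //=; apply/(comp_conn y cK xK); apply: conn1 => //.
  exact: W_nb Wx xy'.
move=> K L [i cK] [j cL] KL; case: (ltngtP i j) => [ij|ji|ij].
- by have [] := comp_nested cK cL ij; [constructor 1|constructor 2].
- have [LK|] := comp_nested cL cK ji; last by constructor 3.
  constructor 1; rewrite -subset0 => y [/ball1P[x xK xy] yL].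
  have : (ball1 G [set` L] `&` [set` K]) x; last by rewrite LK.
  have X'x := W_X' (comp_W cK xK); have X'y := W_X' (comp_W cL yL).
  split=> //; have [->|nxy] := pselect (x = y); first by left.
  by right; exists y => //; apply/adjE; split=> //; [exact/nesym|exact: nb_sym].
- constructor 1; rewrite -subset0 => y [/ball1P[x xK xy] yL]; apply: KL.
  move: cL; rewrite -ij => cL; apply: (comp_eq cK cL _ yL).
  apply/(comp_conn y cK xK); apply: conn1 => //; first exact: comp_W cK xK.
  exact: comp_W cL yL.
Qed.

Let smaller (K : {fset X}) :=
  \bigcup_(L in [set L | comps L /\ (L `<` K)%fset]) [set` L].

Let smaller0 K : is_comp 0 K -> smaller K = set0.
Proof.
move=> cK; rewrite -subset0 => x [L [[j cL] LK] xL].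
have xK : x \in K by exact: (fsubsetP (fproper_sub LK)).
have := comp_sub cK cL (leq0n j) xK xL; move: LK.
by rewrite fproperE => /andP[_ /negP].
Qed.

Let smallerS i K x : is_comp i.+1 K -> x \in K -> smaller K x <-> W i x.
Proof.
move=> cK xK; split=> [[L [[j cL] LK] xL]|Wx].
  apply: W_le (comp_W cL xL); rewrite leqNgt; apply/negP => ij.
  have := comp_sub cK cL ij xK xL; move: LK.
  by rewrite fproperE => /andP[_ /negP].
have [L cL xL] := ex_comp Wx; exists L => //; split; first by exists i.
exact: comp_lt cL cK (ltnSn i) xL xK.
Qed.

Lemma comps_connected : connected_toast G comps.
Proof.
move=> K [i cK] x y; rewrite -/(smaller K) => -[_ [xK xs]] [_ [yK ys]].
pose A := [set` K] `\` smaller K.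
have X'A : A `<=` X' by move=> z [zK _]; exact: W_X' (comp_W cK zK).
apply/(@clos_conn H S X a hact _ A) => [u v|//|].
  split=> [[/adjE[? ? _ _] ? ?]//|[uv nuv Au Av]]; split=> //.
  by apply/adjE; split=> //; exact: X'A.
have xy : conn (W i) x y by exact/(comp_conn y cK xK).
have inK A' z : conn A' x z -> A' `<=` W i -> z \in K.
  by move=> xz A'W; apply/(comp_conn z cK xK); exact: conn_sub xz.
case: i cK xy inK => [|i] cK xy inK.
  apply: conn_sub (conn_component hact xy) => z xz; split; first exact: inK xz _.
  by rewrite smaller0.
have nWx : ~ W i x by move=> /(smallerS cK xK).
have nWy : ~ W i y by move=> /(smallerS cK yK).
apply: conn_sub (conn_component hact (W_connected xy nWx nWy)) => z xz.
have zK : z \in K by apply: inK xz _ => t [].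
split=> // /(smallerS cK zK) Wz.
by have [_] := conn_lst xz.
Qed.

End StagesToast.

(** * Measurability of the stages and of the toast *)

Section StageMeasurability.
Variables (d : measure_display) (X : measurableType d).
Variables (H : groupType) (S : {fset H}) (a : H -> X -> X) (O : nat -> set X).
Hypothesis hact : is_group_action a.
Hypothesis hfree : is_free a.
Hypothesis ma : is_borel_action a.
Hypothesis sepO : separating O.
Hypothesis gS : generates S.

Lemma measurable_preim d' (T : measurableType d') (f : T -> X) (A : set X) :
  measurable_fun setT f -> measurable A -> measurable [set t | A (f t)].
Proof. by move=> mf mA; have := mf measurableT A mA; rewrite setTI. Qed.

Lemma measurable_iff d' (T : measurableType d') (A B : set T) :
  measurable A -> measurable B -> measurable [set t | A t <-> B t].
Proof.
move=> mA mB; rewrite (_ : [set t | _] = (A `&` B) `|` (~` A `&` ~` B)).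
  by apply: measurableU; apply: measurableI => //; exact: measurableC.
apply/seteqP; split=> t /=; last by move=> [[? ?]|[? ?]]; tauto.
by have [At|nAt] := pselect (A t) => AB; [left|right]; tauto.
Qed.

Lemma measurable_ex_group d' (T : measurableType d') (A : H -> set T) :
  (forall g, measurable (A g)) -> measurable [set t | exists g, A g t].
Proof.
move=> mA; rewrite (_ : [set t | _] = [set t | exists n, A (group_enum S n) t]).
  by apply: (@measurable_ex_nat _ _ (fun n => A (group_enum S n))) => n.
apply/seteqP; split=> t /=; last by move=> [n Ant]; exists (group_enum S n).
by move=> [g Ag]; have [n gE] := group_enumP gS g; exists n; rewrite gE.
Qed.

Lemma measurable_all_group d' (T : measurableType d') (A : H -> set T) :
  (forall g, measurable (A g)) -> measurable [set t | forall g, A g t].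
Proof.
move=> mA; rewrite (_ : [set t | _] = ~` [set t | exists g, (~` A g) t]).
  apply: measurableC; apply: (@measurable_ex_group _ _ (fun g => ~` A g)) => g.
  exact: measurableC.
apply/seteqP; split=> t /= h; first by move=> [g ng]; exact: ng.
by move=> g; apply: contrapT => ng; apply: h; exists g.
Qed.

(** By freeness the endpoint determines [g], which allows a recursion on the length of the walk:
    after a step [s], the element left to reach the endpoint is [g * s^-1]. *)
Lemma measurable_conn (A : set X) g : measurable A ->
  measurable [set x | conn S a A x (a g x)].
Proof.
move=> mA; apply: (@measurable_ex_nat _ _ (fun n => [set x | steps S a A n x (a g x)])).
move=> n; elim: n g => [|n IH] g.
  have [->|g1] := eqVneq g 1%g.
    rewrite (_ : [set x | _] = A) //; apply/seteqP; split=> x /=.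
      by rewrite (act1 hact) => -[].
    by rewrite (act1 hact).
  rewrite (_ : [set x | _] = set0) //; apply/seteqP; split=> x //= -[/esym/hfree e _].
  by rewrite e eqxx in g1.
rewrite (_ : [set x | _] = A `&` [set x | exists2 s, s \in enum_fset (symgen S) &
    [set y | steps S a A n y (a (g * s^-1)%g y)] (a s x)]).
  apply: measurableI => //.
  apply: (@measurable_ex_seq _ _ _ (enum_fset (symgen S)) (fun s =>
    [set x | [set y | steps S a A n y (a (g * s^-1)%g y)] (a s x)])) => s.
  exact: measurable_preim (ma s) (IH _).
apply/seteqP; split=> x /=.
  move=> [Ax [_ [s sS ->] h]]; split=> //; exists s => //=.
  by rewrite -(actM hact) mulgVK.
move=> [Ax [s sS]]; rewrite /= -(actM hact) mulgVK => h; split=> //.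
by exists (a s x) => //; exists s.
Qed.

Section Stages.
Variables (r : nat -> nat) (P : nat -> set X).
Hypothesis mP : forall i, measurable (P i).

Lemma measurable_cut i : measurable (cut S a r P i).
Proof.
rewrite (_ : cut _ _ _ _ _ = [set x | exists j, [set x | exists2 b,
    b \in enum_fset (wball S (radius r j - radius r i)) & [set x |
    (i <= j)%N /\ P j (a b x)] x] x]).
  apply: (@measurable_ex_nat _ _ (fun j => [set x | exists2 b,
    b \in enum_fset (wball S (radius r j - radius r i)) & [set x |
    (i <= j)%N /\ P j (a b x)] x])) => j.
  apply: (@measurable_ex_seq _ _ _ (enum_fset (wball S (radius r j - radius r i)))
    (fun b => [set x | (i <= j)%N /\ P j (a b x)])) => b.
  apply: measurable_and; first exact: measurable_const.
  exact: measurable_preim (ma b) (mP j).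
apply/seteqP; split=> x /=.
  by move=> [j [w [ij [b bn ->] Pw]]]; exists j, b.
by move=> [j [b bn [ij Pb]]]; exists j, (a b x); split=> //; exists b.
Qed.

Lemma measurable_core : measurable (core S a r P).
Proof.
apply: (@measurable_all_group _ _ (fun g => [set x | exists i, ~ cut S a r P i (a g x)])) => g.
apply: (@measurable_ex_nat _ _ (fun i => [set x | ~ cut S a r P i (a g x)])) => i.
by apply: measurable_not; exact: measurable_preim (ma g) (measurable_cut i).
Qed.

Lemma measurable_entry n : measurable (entry S a r P n).
Proof.
apply: measurable_and.
  apply: (@measurable_ex_group _ _ (fun g => [set x | ~ cut S a r P n (a g x)])) => g.
  by apply: measurable_not; exact: measurable_preim (ma g) (measurable_cut n).
rewrite (_ : (fun x => _) = [set x | forall k, k \in iota 0 n ->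
    [set x | forall g, cut S a r P k (a g x)] x]).
  apply: (@measurable_all_seq _ _ _ (iota 0 n) (fun k =>
    [set x | forall g, cut S a r P k (a g x)])) => k.
  apply: (@measurable_all_group _ _ (fun g => [set x | cut S a r P k (a g x)])) => g.
  exact: measurable_preim (ma g) (measurable_cut k).
by apply/seteqP; split=> x h k; have := h k; rewrite mem_iota.
Qed.

Lemma measurable_stage i : measurable (stage S a r P i).
Proof.
apply: measurable_and; first exact: measurable_core.
apply: (@measurable_ex_nat _ _ (fun n => [set x | [/\ entry S a r P n x,
  ~ cut S a r P (n + i) x & exists g, ~ cut S a r P n (a g x) /\
  conn S a (~` cut S a r P (n + i)) x (a g x)]])) => n.
rewrite (_ : [set x | _] = entry S a r P n `&` (~` cut S a r P (n + i) `&`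
    [set x | exists g, ~ cut S a r P n (a g x) /\
    conn S a (~` cut S a r P (n + i)) x (a g x)])); last first.
  by apply/seteqP; split=> x [] // h1 [].
apply: measurableI; first exact: measurable_entry.
apply: measurableI; first by apply: measurableC; exact: measurable_cut.
apply: (@measurable_ex_group _ _ (fun g => [set x | ~ cut S a r P n (a g x) /\
    conn S a (~` cut S a r P (n + i)) x (a g x)])) => g.
apply: measurable_and.
  by apply: measurable_not; exact: measurable_preim (ma g) (measurable_cut n).
by apply: measurable_conn; apply: measurableC; exact: measurable_cut.
Qed.

End Stages.

Lemma comps_borel (W : nat -> set X) : (forall i, measurable (W i)) ->
  borel_fsets (comps S a W).
Proof.
move=> mW n; have mtn (j : 'I_n) : measurable_fun setT (fun t : n.-tuple X => tnth t j).
  exact: measurable_tnth.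
have [mO sO] := sepO.
have meq (j k : 'I_n) g : measurable [set t : n.-tuple X | tnth t k = a g (tnth t j)].
  rewrite (_ : [set t | _] = [set t : n.-tuple X |
      forall l, O l (tnth t k) <-> O l (a g (tnth t j))]).
    apply: (@measurable_all_nat _ _ (fun l => [set t : n.-tuple X |
      O l (tnth t k) <-> O l (a g (tnth t j))])) => l.
    apply: measurable_iff; first exact: measurable_preim (mtn k) (mO l).
    exact: measurable_preim (mtn j) (measurable_preim (ma g) (mO l)).
  by apply/seteqP; split=> t /= h; [rewrite h|exact: sO].
have mconn (j : 'I_n) i g : measurable
    [set t : n.-tuple X | conn S a (W i) (tnth t j) (a g (tnth t j))].
  exact: measurable_preim (mtn j) (measurable_conn g (mW i)).
(* [A] makes the component of the [j]-th entry part of the tuple, [B] the tuple part of the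
   component; repeated entries are harmless. *)
pose A i (j : 'I_n) g := [set t : n.-tuple X |
  ~ (conn S a (W i) (tnth t j) (a g (tnth t j)) /\
     ~ exists2 k, k \in enum 'I_n & tnth t k = a g (tnth t j))].
pose B i (j k : 'I_n) := [set t : n.-tuple X | exists g,
  tnth t k = a g (tnth t j) /\ conn S a (W i) (tnth t j) (a g (tnth t j))].
rewrite (_ : [set t | _] = [set t : n.-tuple X | exists i, exists2 j, j \in enum 'I_n &
   W i (tnth t j) /\ ((forall g, A i j g t) /\ forall k, k \in enum 'I_n -> B i j k t)]).
  apply: (@measurable_ex_nat _ _ (fun i => [set t : n.-tuple X |
    exists2 j, j \in enum 'I_n & W i (tnth t j) /\
    ((forall g, A i j g t) /\ forall k, k \in enum 'I_n -> B i j k t)])) => i.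
  apply: (@measurable_ex_seq _ _ _ (enum 'I_n) (fun j => [set t : n.-tuple X |
    W i (tnth t j) /\
    ((forall g, A i j g t) /\ forall k, k \in enum 'I_n -> B i j k t)])) => j.
  apply: measurable_and; first exact: measurable_preim (mtn j) (mW i).
  apply: measurable_and.
    apply: (@measurable_all_group _ _ (A i j)) => g.
    have mE := @measurable_ex_seq _ _ _ (enum 'I_n) _ (fun k => meq j k g).
    exact: measurable_not (measurable_and (mconn j i g) (measurable_not mE)).
  apply: (@measurable_all_seq _ _ _ (enum 'I_n) (B i j)) => k.
  apply: (@measurable_ex_group _ _ (fun g => [set t : n.-tuple X |
    tnth t k = a g (tnth t j) /\ conn S a (W i) (tnth t j) (a g (tnth t j))])) => g.
  exact: measurable_and (meq j k g) (mconn j i g).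
have conn_orb A' x y : conn S a A' x y -> exists g, y = a g x.
  by move=> /(conn_within hact)[k [b _ ->]]; exists b.
apply/seteqP; split=> t /=.
  move=> [i [x Wx xP]]; have : x \in [fset y in tval t]%fset.
    by apply: (xP x).2; exact: conn_refl.
  rewrite !inE /= => /tnthP[j xE]; exists i, j; first by rewrite mem_enum.
  rewrite -xE; split=> //; split=> [g [xg ng]|k _].
    apply: ng; move: xg; rewrite -xE => xg; have := (xP _).2 xg.
    rewrite !inE /= => /tnthP[k gE].
    by exists k; rewrite ?mem_enum.
  have tk : tnth t k \in [fset y in tval t]%fset by rewrite !inE /= mem_tnth.
  have xk := (xP _).1 tk.
  have [g kE] := conn_orb _ _ _ xk; exists g; rewrite -xE -kE; split=> //.
move=> [i [j _ [Wj [hA hB]]]]; exists i, (tnth t j) => // y.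
rewrite !inE /=; split=> [/tnthP[k ->]|jy].
  by have [g [-> ?]] := hB k (mem_enum _ k).
have [g yE] := conn_orb _ _ _ jy.
have [//|ng] := pselect (y \in tval t); case: (hA g); split; first by rewrite -yE.
by move=> [k _ kE]; apply: ng; rewrite yE -kE mem_tnth.
Qed.

End StageMeasurability.

Lemma polish_separating (R : realType) (X : ptopologicalType) :
  polish R X -> exists O : nat -> set (Borel X), separating O.
Proof.
move=> [[D /countable_injP[f f_inj] dD] [dist [d0 dC dT dN _]]].
have dist_ge0 x y : 0 <= dist x y.
  have := dT x y x; rewrite (dC y x) ((d0 x x).2 erefl); lra.
pose bl z (e : R) : set X := [set y | dist z y < e].
have open_bl z e : open (bl z e).
  rewrite openE => y zy; apply/dN; exists (e - dist z y); first by rewrite subr_gt0.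
  move=> w /= yw; rewrite /bl /=; have := dT z y w; lra.
(* An index codes the number [f z] of a dense point and a radius; as [f] is injective on [D], the
   union has at most one ball, and none if the number is not taken. *)
pose O k : set X :=
  let: (i, n) := odflt (0, 0)%N (@choice.unpickle (nat * nat)%type k) in
  \bigcup_(z in [set z | D z /\ f z = i]) bl z n.+1%:R^-1.
exists O; split=> [k|x y Oxy].
  apply: sub_sigma_algebra; rewrite /O; case: (odflt _ _) => i n.
  by apply: bigcup_open => z _; exact: open_bl.
apply: contrapT => xy; have r0 : 0 < dist x y.
  by rewrite lt0r dist_ge0 andbT; apply/eqP => /d0.
(* A dense point within [1 / (n + 1)] of both [x] and [y] would put them at distance less than
   [2 / (n + 1)]. *)
have [n nr] : exists n : nat, 2 / dist x y < n%:R.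
  by exists (Num.bound (2 / dist x y)); rewrite archi_boundP // divr_ge0 // ltW.
have n0 : (0 : R) < n.+1%:R^-1 by rewrite invr_gt0 ltr0n.
have [|z [xz Dz]] := dD (bl x n.+1%:R^-1) _ (open_bl _ _).
  by exists x; rewrite /bl /= (d0 x x).2.
have := Oxy (choice.pickle (f z, n)); rewrite /O choice.pickleK /= => -[h _].
have [|z' [Dz' fz'] z'y] := h; first by exists z => //; rewrite /bl /= dC.
have zz' : z' = z by apply: f_inj; rewrite ?inE.
rewrite zz' /bl /= in z'y xz.
have := dT x z y; apply/negP; rewrite -ltNge.
apply: lt_trans (ltrD xz z'y) _.
rewrite -mulr2n -[_ *+ 2]mulr_natl ltr_pdivrMr ?ltr0n //.
rewrite ltr_pdivrMr // in nr; apply: lt_trans nr _; rewrite mulrC ltr_pM2l //.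
by rewrite ltr_nat.
Qed.

(** * Almost every orbit escapes the cuts *)

Section CoreConull.
Variables (R : realType) (d : measure_display) (X : measurableType d).
Variables (v : set X -> R) (H : groupType) (S : {fset H}) (a : H -> X -> X).
Variables (O : nat -> set X) (m : set H -> R).
Hypothesis mv : fin_measure v.
Hypothesis hact : is_group_action a.
Hypothesis hfree : is_free a.
Hypothesis ma : is_borel_action a.
Hypothesis sepO : separating O.
Hypothesis gS : generates S.
Hypothesis mP : is_mean m.
Hypothesis growth : forall k, exists2 n, (0 < n)%N & (k * n <= #|` wball S n|)%N.

Definition nbhd n (P : set X) : set X :=
  [set x | exists2 b, b \in enum_fset (wball S n) & P (a b x)].

Lemma measurable_nbhd n P : measurable P -> measurable (nbhd n P).
Proof.
move=> mP'; apply: (@measurable_ex_seq _ _ _ (enum_fset (wball S n))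
  (fun b => [set x | P (a b x)])) => b.
exact: measurable_preim (ma b) mP'.
Qed.

(* Apply [key_cut] to the sum of the translates of the measure by a ball. *)
Lemma nbhd_cut n (eps : R) : 0 < eps -> exists r P e,
  [/\ (0 < r)%N, measurable P, tiled S a r P e & v (nbhd n P) <= eps].
Proof.
move=> eps0; pose w A := \sum_(b <- wball S n) v (setT `&` a b @^-1` A).
have mw : fin_measure w.
  split=> [E mE|]; last first.
    apply: sigma_add_sum => b.
    exact: sigma_add_comp (fin_measure_sigma mv) measurableT (ma b).
  apply: sumr_ge0 => b _; apply: (fin_measure_ge0 mv); rewrite setTI.
  exact: measurable_preim (ma b) mE.
have w0 : 0 <= w setT by exact: fin_measure_ge0 mw _ measurableT.
have eps'0 : 0 < eps / (1 + w setT) by rewrite divr_gt0 // ltr_wpDr.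
have [r [P [e [mP' tP wP]]]] := key_cut mw hact hfree ma sepO gS mP growth eps'0.
exists r.+1, P, e; split=> //.
  by apply: (tiled_le tP).
have vw : v (nbhd n P) <= w P.
  have -> : w P = \sum_(b <- wball S n) v [set x | P (a b x)].
    by apply: eq_bigr => b _; rewrite setTI.
  apply: (measure_ex_seq_le mv) => b; exact: measurable_preim (ma b) mP'.
apply: le_trans vw _; apply: le_trans wP _.
rewrite mulrAC ler_pdivrMr ?ltr_wpDr // ler_pM2l // lerDr //.
Qed.

(** Telescoping weights, whose tail from [i] is at most [1 / (i + 1)]. *)
Let weight n : R := n.+1%:R^-1 - n.+2%:R^-1.

Let weight_gt0 n : 0 < weight n.
Proof. by rewrite subr_gt0 ltf_pV2 ?posrE ?ltr0n // ltr_nat. Qed.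

Let sum_weight i n : \sum_(k < n) weight (i + k)%N <= i.+1%:R^-1.
Proof.
suff -> : \sum_(k < n) weight (i + k)%N = i.+1%:R^-1 - (i + n).+1%:R^-1.
  by rewrite gerBl invr_ge0 ler0n.
elim: n => [|n IH]; first by rewrite big_ord0 addn0 subrr.
by rewrite big_ord_recr /= IH /weight addnS addrA subrK.
Qed.

(** A Borel-Cantelli argument. [P n] is chosen knowing the earlier radii, so that its neighbourhood
    of radius [radius r n + n] is small: the first term pays for the neighbourhoods in [cut], the
    second for the translations in [core]. *)
Lemma ex_cuts : exists (r : nat -> nat) (P : nat -> set X),
  [/\ forall i, (0 < r i)%N, forall i, measurable (P i),
      forall i, exists e, tiled S a (r i) (P i) e &
      v (~` core S a r P) <= 0].
Proof.
have [|u uP] := @dependent_sequence (nat * set X)%type (fun n s p => [/\ (0 < p.1)%N,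
    measurable p.2, exists e, tiled S a p.1 p.2 e &
    v (nbhd (\sum_(q <- s) q.1 + n) p.2) <= weight n]).
  move=> n s; have [r [P [e [r0 mP' tP vP]]]] :=
    nbhd_cut (\sum_(q <- s) q.1 + n) (weight_gt0 n).
  by exists (r, P); split=> //; exists e.
pose r i := (u i).1; pose P i := (u i).2; exists r, P.
have mP' i : measurable (P i) by have [] := uP i.
split=> // [i|i|]; [by have [] := uP i|by have [] := uP i|].
have radE n : \sum_(q <- mkseq u n) q.1 = radius r n.
  by rewrite /mkseq big_map -{1}[n]subn0 -/(index_iota 0 n) big_mkord.
have vP n : v (nbhd (radius r n + n)%N (P n)) <= weight n.
  by rewrite -radE; have [] := uP n.
pose Z g := [set x | forall i, cut S a r P i (a g x)].
have mZ g : measurable (Z g).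
  apply: (@measurable_all_nat _ _ (fun i => [set x | cut S a r P i (a g x)])) => i.
  exact: measurable_preim (ma g) (measurable_cut _ ma _ mP' i).
have coreE : ~` core S a r P = \bigcup_n Z (group_enum S n).
  apply/seteqP; split=> x /=.
    move=> /existsNP[g ng]; have [n gE] := group_enumP gS g; exists n => // i.
    by rewrite gE; apply: contrapT => nc; apply: ng; exists i.
  by move=> [n _ Zn] /(_ (group_enum S n))[i]; apply; exact: Zn.
rewrite coreE; apply: (fin_measure_bigcup_le mv) => [n|n]; first exact: mZ.
apply: sumr_le0 => /= k _; move: (group_enum S k) => g {n k}.
have [N gN] := wball_gen gS g.
(* If [a g x] is in [cut i], then [x] is close to some [P j] with [j >= i >= N], and the extra [j]
   in the radius absorbs the length of [g]. *)
have vZ i : (N <= i)%N -> v (Z g) <= i.+1%:R^-1.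
  move=> Ni; pose E k := nbhd (radius r (i + k) + (i + k)) (P (i + k)%N).
  have mE k : measurable (E k) by exact: measurable_nbhd.
  apply: (@le_trans _ _ (v (\bigcup_k E k))).
    apply: (fin_measure_le mv) => //; first exact: bigcupT_measurable.
    move=> x /(_ i)[j [w [ij [b bn ->] Pw]]]; exists (j - i)%N => //.
    rewrite /E subnKC //; exists (b * g)%g; last by rewrite (actM hact).
    have : (b * g)%g \in wball S (radius r j - radius r i + N) by exact: wballM.
    apply: wball_le; apply: leq_add; first exact: leq_subr.
    exact: leq_trans ij.
  apply: (fin_measure_bigcup_le mv) => // n.
  apply: le_trans (sum_weight i n); apply: ler_sum => k _; exact: vP.
rewrite leNgt; apply/negP => Z0.
have [k kZ] : exists k : nat, (v (Z g))^-1 < k%:R.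
  by exists (Num.bound (v (Z g))^-1); rewrite archi_boundP // invr_ge0 ltW.
have := vZ (N + k)%N (leq_addr _ _); rewrite leNgt => /negP; apply.
rewrite invf_plt ?posrE ?ltr0n //; apply: lt_le_trans kZ _.
by rewrite ler_nat; lia.
Qed.

End CoreConull.

Theorem theorem3p5 (R : realType) (X : ptopologicalType)
    (mu : probability (Borel X) R) (Gamma : groupType) (S : {fset Gamma})
    (a : Gamma -> Borel X -> Borel X) :
  polish R X ->
  generates S ->
  one_ended_group Gamma ->
  amenable Gamma R ->
  is_group_action a ->
  is_borel_action a ->
  is_free a ->
  null_preserving mu (orbit_rel a) ->
  exists X' : set (Borel X),
    [/\ measurable X',
        graph_invariant (schreier S a) X',
        mu (~` X') = 0%E &
        exists T : set {fset Borel X},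
          [/\ toast (induced_subgraph (schreier S a) X') T,
              layered_toast T &
              connected_toast (induced_subgraph (schreier S a) X') T]].
Proof.
move=> /polish_separating[U sepU] gS oS [m mP] hact ma hfree _.
have growth := one_ended_group_growth gS oS.
have mv := fin_measure_fine mu.
have [r [P [r0 mP' /choice[e tP] v0]]] := ex_cuts mv hact hfree ma sepU gS mP growth.
pose W := stage S a r P; pose X' := core S a r P.
have mX' : measurable X' by exact: measurable_core.
have orbit_connected g x : conn S a setT x (a g x).
  have [n gn] := wball_gen gS g; exists n.
  by apply: (within_steps hact) => //; exists g.
have orbit_unbounded k x : exists g, ~ within S a k x (a g x).
  (* Growth at a rate above the size of the ball of radius [k] gives a ball that is not contained in
     it. *)
  have [n n0 le] := growth #|` wball S k|.+1.
  have [g gn gk] : exists2 g, g \in wball S n & g \notin wball S k.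
    apply: contrapT => no; have : (wball S n `<=` wball S k)%fset.
      apply/fsubsetP => g gn; apply: contrapT => /negP gk; apply: no.
      by exists g.
    move=> /fsubset_leq_card/(leq_trans le).
    by rewrite leqNgt (leq_trans (ltnSn _) (leq_pmulr _ n0)).
  exists g; move=> [b bk /(free_inj hact hfree) gb].
  by rewrite gb bk in gk.
have W_nb := @stage_nb _ S _ a hact r P r0.
have W_finite := @stage_finite _ S _ a hact r P e tP.
have W_meets := @stage_meets _ S _ a hact r P.
have W_cover := @stage_cover _ S _ a hact gS r P.
have W_connected := @stage_connected _ S _ a hact r P e tP.
have X'_nb := @core_nb _ S _ a hact r P.
exists X'; split=> //.
- exists (component (schreier S a) @` X'); first by move=> _ [x _ <-]; exists x.
  apply/seteqP; split=> [x X'x|y [_ [x X'x <-] xy]].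
    exists (component (schreier S a) x); first by exists x.
    exact: Relation_Operators.rt_refl.
  have {xy} : conn S a setT x y.
    apply/(@clos_conn _ S _ a hact (schreier S a)) => [u v|//|//].
    by split=> [/(schreier_adjE S hact)[]//|[? ? _ _]]; exact/(schreier_adjE S hact).
  move: y; apply: (conn_ind hact) => [_ //|y z _ X'y yz _].
  exact: X'_nb yz X'y.
- have fin : mu (~` X') \is a fin_num by exact/fin_num_measure/measurableC.
  rewrite -(fineK fin); congr EFin; apply/eqP; rewrite eq_le v0 /=.
  exact/fine_ge0/measure_ge0.
have W_core i : W i `<=` X' by exact: stage_core.
have bT : borel_fsets (comps S a W).
  by apply: (comps_borel hact hfree ma sepU gS) => i; exact: measurable_stage.
exists (comps S a W); split.
- exact: (comps_toast hact W_core W_nb W_finite W_cover bT).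
- exact: (comps_layered hact W_nb W_finite W_meets orbit_unbounded orbit_connected).
- exact: (comps_connected hact W_core W_nb W_finite W_connected orbit_unbounded
    orbit_connected).
Qed.
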